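(* For every even integer $n=2k\ge 2$ and every oriented basis $(\omega_1,\omega_2)$ of $\mathbb{C}$ with $L=\mathbb{Z}\omega_1+\mathbb{Z}\omega_2$ one has $$e^*_{n}=\frac{2}{(n-1)!}f_{n-1,1}+\sum_{m=2}^{n}\frac{1}{(n-m)!}f_{n-m,m}=\sum_{\omega\in L\setminus\{0\}}\frac{P_{n-1}\left(\frac{\pi}{a(L)}|\omega|^2\right)}{\omega^n}\exp\left(-\frac{\pi}{a(L)}|\omega|^2\right),$$ where $$P_{n-1}(z)=\frac{2z^{n-1}}{(n-1)!}+\sum_{m=2}^n\frac{z^{n-m}}{(n-m)!}.$$
   Context: For an oriented basis $(\omega_1,\omega_2)$ of $\mathbb{C}=\mathbb{R}^2$ let $L=\mathbb{Z}\omega_1+\mathbb{Z}\omega_2$ and $a(L)=\operatorname{Im}(\overline{\omega}_1\omega_2)$ (the area of $\mathbb{C}/L$). For $k\ge 2$, $e^*_{2k}=e_{2k}=\sum_{\omega\in L\setminus\{0\}}\omega^{-2k}$. For $k=1$, $e_2(\omega_1,\omega_2)=\sum_m\sum_{n;\,n\ne 0\text{ if }m=0}\frac{1}{(m\omega_2+n\omega_1)^2}$ (Eisenstein summation: inner sum over $n$ first), and $e^*_2(\omega_1,\omega_2)=e_2(\omega_1,\omega_2)-\frac{\pi}{a(L)}\frac{\overline{\omega}_1}{\omega_1}$. For $m,n\in\mathbb{Z}$, $f_{m,n}=f_{m,n}(L)=\left(\frac{\pi}{a(L)}\right)^m\sum_{\omega\in L\setminus\{0\}}\frac{\overline{\omega}^m}{\omega^n}\exp\left(-\frac{\pi}{a(L)}|\omega|^2\right)$.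 *)

(* Defs.v *)
From HB Require Import structures.
From mathcomp Require Import all_boot all_order all_algebra.
From mathcomp Require Import all_classical all_reals all_analysis.
From mathcomp.analysis.showcase Require Import summability.
From mathcomp Require Import complex.

Set Implicit Arguments.
Unset Strict Implicit.
Unset Printing Implicit Defensive.

Import Order.TTheory GRing.Theory Num.Theory.
Import ComplexField.

Local Open Scope classical_set_scope.
Local Open Scope ring_scope.
Local Open Scope complex_scope.

(* [sum] is the limit of the finite partial sums along the net of finite
   subsets of the index type.  The topology on the complex numbers is that of
   R[i]^o, given by the complex modulus.  The patch [f \_ D] is f on D and 0
   elsewhere, so that this is the unordered sum of f over D. *)
Definition csum (R : realType) (I : choiceType) (D : set I) (f : I -> R[i]) :
  R[i] := sum ((f : I -> R[i]^o) \_ D).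

(* Positive determinant with respect to the basis (1, i) of C = R^2. *)
Definition oriented_basis (R : realType) (w1 w2 : R[i]) : Prop :=
  0 < complex.Re w1 * complex.Im w2 - complex.Im w1 * complex.Re w2.

Definition lattice (R : realType) (w1 w2 : R[i]) : set R[i] :=
  [set w | exists m n : int, w = m%:~R * w1 + n%:~R * w2].

Definition area (R : realType) (w1 w2 : R[i]) : R :=
  complex.Im (conjc w1 * w2).

Definition lattice_sum (R : realType) (w1 w2 : R[i]) (f : R[i] -> R[i]) :
  R[i] := csum (lattice w1 w2 `\ 0) f.

(* Eisenstein summation: the inner sum, over n, is performed first.  Only the
   iterated sum converges absolutely, the double series does not. *)
Definition e2 (R : realType) (w1 w2 : R[i]) : R[i] :=
  csum [set: int] (fun m : int =>
    csum [set n : int | m = 0 -> n <> 0] (fun n : int =>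
      ((m%:~R * w2 + n%:~R * w1) ^+ 2)^-1)).

(* The Eisenstein series e_n, meaningful for even n >= 2. *)
Definition e_ (R : realType) (w1 w2 : R[i]) (n : nat) : R[i] :=
  if n == 2%N then e2 w1 w2 else lattice_sum w1 w2 (fun w => (w ^+ n)^-1).

Definition estar (R : realType) (w1 w2 : R[i]) (n : nat) : R[i] :=
  if n == 2%N then e_ w1 w2 2 - (pi / area w1 w2)%:C * (conjc w1 / w1)
  else e_ w1 w2 n.

Definition f_ (R : realType) (w1 w2 : R[i]) (m n : int) : R[i] :=
  (pi / area w1 w2)%:C ^ m *
  lattice_sum w1 w2 (fun w =>
    (conjc w) ^ m / w ^ n *
    (expR (- (pi / area w1 w2 * Normc.normc w ^+ 2)))%:C).

(* Indexed by the degree d = n - 1. *)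
Definition P_ (R : realType) (d : nat) : {poly R} :=
  (2 / d`!%:R) *: 'X^d
  + \sum_(2 <= m < d.+2) ((d.+1 - m)`!%:R)^-1 *: 'X^(d.+1 - m).

(* Main.v *)
Require Import Defs.
From HB Require Import structures.
From mathcomp Require Import all_boot all_order all_algebra.
From mathcomp Require Import all_classical all_reals all_analysis.
From mathcomp.analysis.showcase Require Import summability.
From mathcomp Require Import complex finmap ring lra zify.

(* Write L = Z^2, c = pi / a(L) and Q for the regularized incomplete gamma
   function Gamma(n, x) / Gamma(n).  For t > 0 put
     K(t) = sum_w Q(n, c t |w|^2) / w^n
            + c^(n-1) / (n-1)! sum_w conj(w)^(n-1) / w e^(- c |w|^2 / t).
   Since d/dx Q(n, x) = - x^(n-1) e^(-x) / (n-1)!, the derivative of K is a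
   multiple of t^(-2) theta_n(1/t) - t^(n-1) theta_n(t) with
   theta_n(t) = sum_w conj(w)^n e^(- c t |w|^2), and vanishes for even n by the
   inversion formula of theta_n: with respect to the symplectic pairing the
   rescaled lattice is its own dual.  K(1) is the Gaussian sum of the theorem,
   and K(t) tends to e_n as t -> 0 when n > 2.  For n = 2 the sum is
   rearranged along the shifts w -> w + w1, which produces e_2 together with
   - c t theta_0(t) = - c theta_0(1/t) -> - c.
   The inversion formula is obtained row by row from the Poisson formula for
   one-dimensional Gaussians, proved by Polya's method: sum
   ((2 + Z + 1/Z) / 4)^m over the l-th roots of unity, shifted, expand by the
   binomial theorem, and let l, m -> oo with m / l^2 -> kappa. *)

Set Implicit Arguments.
Unset Strict Implicit.
Unset Printing Implicit Defensive.

Import Order.TTheory GRing.Theory Num.Theory.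
Import numFieldNormedType.Exports.
Import ComplexField.

Local Open Scope classical_set_scope.
Local Open Scope ring_scope.
Local Open Scope complex_scope.

Local Notation nc := Normc.normc.

(** * Unordered summation *)

Section Modulus.
Variable R : realType.
Implicit Types (x y z : R[i]) (a : R).

(** Three obstacles shape the proof. The constant of the one-dimensional Poisson formula is only
    known as the limit [C0] of sqrt(m) cbin(m). It cancels, because the theta inversion applies that
    formula once to each of its two sides and meets the same double series up to a swap of
    coordinates. The moments theta_n are reached through one generating function, theta_0 with a
    factor e^(z conj(w)): its inversion is proved first, then Taylor coefficients at small real z
    are compared. Termwise differentiation of K is replaced by an estimate: with t = e^u, the
    first-order part of an increment of K sums to 0 by the inversion, the remainders have total O((v
    - u)^2), and a function with such increments is constant. In weight 2 the majorant |w|^(-2) is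
    not summable over the lattice, which is why the limit is taken on a regularized series. Series
    are indexed by all of Z^2 with the convention 1/0 = 0, so that the origin contributes nothing
    where a power of w is in the denominator. *)

Lemma normc_ge0 x : 0 <= nc x.
Proof. by case: x => a b /=; exact: sqrtr_ge0. Qed.

Lemma ler_normcD x y : nc (x + y) <= nc x + nc y.
Proof. exact: (@le_normcD R). Qed.

Lemma normcN x : nc (- x) = nc x.
Proof. exact: (@complex.normcN R). Qed.

Lemma normcB x y : nc (x - y) = nc (y - x).
Proof. by rewrite -normcN opprB. Qed.

Lemma ler_normcB x y z : nc (x - z) <= nc (x - y) + nc (y - z).
Proof. by apply: le_trans (ler_normcD _ _); rewrite addrA subrK. Qed.

Lemma normc_real a : nc a%:C = `|a|.
Proof. by rewrite /= expr0n addr0 sqrtr_sqr. Qed.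

Lemma normc_eq0 x : (nc x == 0) = (x == 0).
Proof.
apply/eqP/eqP => [/Normc.eq0_normc//|->]; exact: Normc.normc0.
Qed.

Lemma normc_gt0 x : (0 < nc x) = (x != 0).
Proof. by rewrite lt_def normc_ge0 andbT normc_eq0. Qed.

Lemma normcX x n : nc (x ^+ n) = nc x ^+ n.
Proof.
by elim: n => [|n IH]; rewrite ?Normc.normc1// !exprS Normc.normcM IH.
Qed.

Lemma normc_conj x : nc (conjc x) = nc x.
Proof. by case: x => a b /=; rewrite sqrrN. Qed.

Lemma normc_nat n : nc (n%:R : R[i]) = n%:R.
Proof. by rewrite -(rmorph_nat (real_complex R)) normc_real normr_nat. Qed.

Lemma sqr_normc_conj x : x * conjc x = (nc x ^+ 2)%:C.
Proof.
case: x => a b; rewrite /= sqr_sqrtr ?addr_ge0 ?sqr_ge0//.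
by simpc; rewrite -!expr2 [b * a]mulrC addNr.
Qed.

Lemma normc_Re x : `|complex.Re x| <= nc x.
Proof. by case: x => a b /=; rewrite -sqrtr_sqr ler_wsqrtr // lerDl sqr_ge0. Qed.

Lemma normc_Im x : `|complex.Im x| <= nc x.
Proof. by case: x => a b /=; rewrite -sqrtr_sqr ler_wsqrtr // lerDr sqr_ge0. Qed.

Lemma ler_normc_sum (I : Type) (r : seq I) (P : pred I) (f : I -> R[i]) :
  nc (\sum_(i <- r | P i) f i) <= \sum_(i <- r | P i) nc (f i).
Proof.
elim/big_rec2: _ => [|i y x _ H]; first by rewrite Normc.normc0.
by apply: le_trans (ler_normcD _ _) _; rewrite lerD2l.
Qed.

End Modulus.

Section Summation.
Variable R : realType.

Definition has_sum (I : choiceType) (f : I -> R[i]) (s : R[i]) :=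
  forall e : R, 0 < e -> exists A : {fset I}, forall B : {fset I},
    (A `<=` B)%fset -> nc (\sum_(i <- B) f i - s) <= e.

Definition bounded_sums (I : choiceType) (g : I -> R) :=
  (forall i, 0 <= g i) /\ exists M, forall A : {fset I}, \sum_(i <- A) g i <= M.

Definition abs_summable (I : choiceType) (f : I -> R[i]) :=
  bounded_sums (fun i => nc (f i)).

Lemma has_sum_cvg (I : choiceType) (f : I -> R[i]) s : has_sum f s ->
  partial_sum (f : I -> R[i]^o) @ totally --> (s : R[i]^o).
Proof.
move=> fs; have FF := @totally_filter I.
apply/cvgrPdist_le => /= e e0.
have [er e'E] : exists er : R, e = er%:C.
  by have := gtr0_real e0 => /complex_realP.
have er0 : 0 < er by rewrite e'E ltcR in e0.
have [A HA] := fs _ er0.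
exists A => // B /= AB; rewrite e'E /partial_sum distrC.
rewrite -(big_seq_fsetE _ B xpredT (fun i => f i : R[i]^o)) /=.
by have := HA _ AB; rewrite -lecR.
Qed.

Lemma csum_has_sum (I : choiceType) (D : set I) (f : I -> R[i]) s :
  has_sum (((f : I -> R[i]^o) \_ D) : I -> R[i]) s -> csum D f = s.
Proof.
move=> /has_sum_cvg fs; have FF := @totally_filter I.
by apply: cvg_lim fs; exact: norm_hausdorff.
Qed.

Lemma has_sum_uniq (I : choiceType) (f : I -> R[i]) s t :
  has_sum f s -> has_sum f t -> s = t.
Proof.
move=> /has_sum_cvg fs /has_sum_cvg ft; have FF := @totally_filter I.
exact: (cvg_unique (@norm_hausdorff _ R[i]^o) fs ft).
Qed.

Lemma has_sumD (I : choiceType) (f g : I -> R[i]) s t :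
  has_sum f s -> has_sum g t -> has_sum (fun i => f i + g i) (s + t).
Proof.
move=> fs gt e e0; have e2 : 0 < e / 2 by rewrite divr_gt0.
have [A HA] := fs _ e2; have [B HB] := gt _ e2.
exists (A `|` B)%fset => C; rewrite fsubUset => /andP[AC BC].
rewrite big_split opprD addrACA (splitr e).
by apply: le_trans (ler_normcD _ _) _; rewrite lerD ?HA ?HB.
Qed.

Lemma has_sumZ (I : choiceType) (f : I -> R[i]) s c :
  has_sum f s -> has_sum (fun i => c * f i) (c * s).
Proof.
move=> fs e e0; have c1 : 0 < nc c + 1 by rewrite ltr_wpDl ?normc_ge0.
have [A HA] := fs (e / (nc c + 1)) (divr_gt0 e0 c1).
exists A => B AB; rewrite -mulr_sumr -mulrBr Normc.normcM.
have := HA _ AB; rewrite ler_pdivlMr// => H.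
apply: le_trans H; rewrite mulrC ler_wpM2l ?normc_ge0//.
by rewrite lerDl.
Qed.

Lemma has_sumN (I : choiceType) (f : I -> R[i]) s :
  has_sum f s -> has_sum (fun i => - f i) (- s).
Proof.
move=> /(has_sumZ (-1)); rewrite mulN1r.
by under eq_fun do rewrite mulN1r.
Qed.

Lemma has_sumB (I : choiceType) (f g : I -> R[i]) s t :
  has_sum f s -> has_sum g t -> has_sum (fun i => f i - g i) (s - t).
Proof. by move=> fs /has_sumN; exact: has_sumD. Qed.

Lemma has_sum0 (I : choiceType) : has_sum (fun _ : I => 0) 0.
Proof.
by move=> e e0; exists fset0%fset => B _; rewrite big1// subrr Normc.normc0 ltW.
Qed.

Lemma has_sum_sum (I : choiceType) (J : Type) (r : seq J) (P : pred J)
    (f : J -> I -> R[i]) (s : J -> R[i]) :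
  (forall j, P j -> has_sum (f j) (s j)) ->
  has_sum (fun i => \sum_(j <- r | P j) f j i) (\sum_(j <- r | P j) s j).
Proof.
move=> H; elim: r => [|j r IH].
  by rewrite big_nil; under eq_fun do rewrite big_nil; exact: has_sum0.
rewrite big_cons; under eq_fun do rewrite big_cons.
by case: ifP => // Pj; exact: has_sumD (H _ Pj) IH.
Qed.

Lemma has_sum_finite (I : choiceType) (f : I -> R[i]) (A : {fset I}) :
  (forall i, i \notin A -> f i = 0) -> has_sum f (\sum_(i <- A) f i).
Proof.
move=> f0 e e0; exists A => B AB.
rewrite (big_fset_incl _ AB) ?subrr ?Normc.normc0 ?ltW//.
by move=> i _; exact: f0.
Qed.

Lemma has_sum1 (I : choiceType) (i0 : I) c :
  has_sum (fun i => if i == i0 then c else 0) c.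
Proof.
have := @has_sum_finite _ (fun i => if i == i0 then c else 0) [fset i0]%fset.
rewrite big_seq_fset1 eqxx; apply => i; rewrite inE.
by case: eqP.
Qed.

Lemma has_sum_reindex (I J : choiceType) (h : I -> J) (h' : J -> I)
    (f : J -> R[i]) s : cancel h h' -> cancel h' h ->
  has_sum f s -> has_sum (f \o h) s.
Proof.
move=> hK h'K fs e e0; have [A HA] := fs e e0.
exists [fset h' j | j in A]%fset => B AB.
have -> : \sum_(i <- B) (f \o h) i = \sum_(j <- [fset h i | i in B]%fset) f j.
  rewrite big_imfset//= => x y _ _; exact: (can_inj hK).
apply: HA; apply/fsubsetP => j jA.
apply/imfsetP; exists (h' j) => //=.
by apply: (fsubsetP AB); apply/imfsetP; exists j.
Qed.

Lemma bounded_sums_reindex (I J : choiceType) (h : I -> J) (g : J -> R) :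
  injective h -> bounded_sums g -> bounded_sums (g \o h).
Proof.
move=> hI [g0 [M HM]]; split=> [i|]; first exact: g0.
exists M => A; have := HM [fset h i | i in A]%fset; rewrite big_imfset//=.
by move=> x y _ _; exact: hI.
Qed.

Lemma bounded_sums_le (I : choiceType) (f g : I -> R) :
  (forall i, 0 <= f i <= g i) -> bounded_sums g -> bounded_sums f.
Proof.
move=> fg [_ [M HM]]; split=> [i|]; first by case/andP: (fg i).
exists M => A; apply: le_trans (HM A).
by apply: ler_sum => i _; case/andP: (fg i).
Qed.

Lemma bounded_sumsZ (I : choiceType) (g : I -> R) c : 0 <= c ->
  bounded_sums g -> bounded_sums (fun i => c * g i).
Proof.
move=> c0 [g0 [M HM]]; split=> [i|]; first by rewrite mulr_ge0.
by exists (c * M) => A; rewrite -mulr_sumr ler_wpM2l.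
Qed.

Lemma bounded_sumsD (I : choiceType) (f g : I -> R) :
  bounded_sums f -> bounded_sums g -> bounded_sums (fun i => f i + g i).
Proof.
move=> [f0 [M HM]] [g0 [N HN]]; split=> [i|]; first by rewrite addr_ge0.
by exists (M + N) => A; rewrite big_split lerD.
Qed.

Lemma ler_sum_fsubset (I : choiceType) (g : I -> R) (A B : {fset I}) :
  (forall i, 0 <= g i) -> (A `<=` B)%fset ->
  \sum_(i <- A) g i <= \sum_(i <- B) g i.
Proof.
move=> g0 AB; pose h i := if i \in A then g i else 0.
have -> : \sum_(i <- A) g i = \sum_(i <- A) h i.
  by rewrite big_seq [RHS]big_seq; apply: eq_bigr => i iA; rewrite /h iA.
rewrite (big_fset_incl _ AB); last by move=> i _ /negbTE iA; rewrite /h iA.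
by apply: ler_sum => i _; rewrite /h; case: ifP.
Qed.

Lemma ler_sum_const_share (I : choiceType) (A : {fset I}) (e : R) : 0 < e ->
  \sum_(i <- A) (e / (#|` A|%:R + 1)) <= e.
Proof.
move=> e0; rewrite big_const_seq count_predT iter_addr addr0 -mulrnAl.
rewrite ler_pdivrMr ?ltr_wpDl// -mulr_natr; apply: ler_wpM2l; first exact: ltW.
by rewrite lerDl.
Qed.

Lemma sum_fsetX (I J : choiceType) (V : nmodType) (A : {fset I})
    (B : {fset J}) (f : I * J -> V) :
  \sum_(p <- (A `*` B)%fset) f p = \sum_(i <- A) \sum_(j <- B) f (i, j).
Proof.
rewrite -big_allpairs; apply: perm_big.
apply: uniq_perm => [||p]; first exact: fset_uniq.
  by apply: allpairs_uniq; rewrite ?fset_uniq// => -[a b] [c d] _ _ [-> ->].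
rewrite in_fsetM; apply/andP/allpairsP => [[p1 p2]|[q [q1 q2 ->]]//].
by exists p; split=> //; case: (p).
Qed.

Lemma bounded_sums_prod (I J : choiceType) (f : I -> R) (g : J -> R) :
  bounded_sums f -> bounded_sums g ->
  bounded_sums (fun p : I * J => f p.1 * g p.2).
Proof.
move=> [f0 [M HM]] [g0 [N HN]]; split=> [p|]; first by rewrite mulr_ge0.
exists (M * N) => A.
pose A1 := [fset p.1 | p in A]%fset; pose A2 := [fset p.2 | p in A]%fset.
have AA : (A `<=` A1 `*` A2)%fset.
  apply/fsubsetP => p pA; rewrite in_fsetM.
  by apply/andP; split; apply/imfsetP; exists p.
apply: (@le_trans _ _ (\sum_(p <- (A1 `*` A2)%fset) f p.1 * g p.2)).
  by apply: ler_sum_fsubset => // p; rewrite mulr_ge0.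
rewrite sum_fsetX /=.
under eq_bigr do rewrite -mulr_sumr.
rewrite -mulr_suml; apply: ler_pM => //; exact: sumr_ge0.
Qed.

Lemma bounded_sums_has_sum (I : choiceType) (g : I -> R) :
  bounded_sums g -> exists s : R, has_sum (fun i => (g i)%:C) s%:C.
Proof.
move=> [g0 [M HM]].
pose S := [set x | exists A : {fset I}, x = \sum_(i <- A) g i].
have hS : has_sup S.
  split; first by exists (\sum_(i <- fset0%fset) g i), fset0%fset.
  by exists M => _ [A ->].
exists (sup S) => e e0.
have [_ [A ->] HA] := sup_adherent e0 hS.
exists A => B AB.
have AB' := ler_sum_fsubset g0 AB.
have BS : \sum_(i <- B) g i <= sup S by apply: ub_le_sup; [exact: hS.2|exists B].
rewrite -rmorph_sum -rmorphB normc_real ler_norml; apply/andP; split; lra.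
Qed.

Lemma abs_summable_has_sum (I : choiceType) (f : I -> R[i]) :
  abs_summable f -> exists s, has_sum f s.
Proof.
move=> fs.
have pos (u : I -> R) : (forall i, `|u i| <= nc (f i)) ->
    exists s, has_sum (fun i => (u i)%:C) s.
  move=> uf.
  (* A real family is the difference of the nonnegative families u + |u| and |u|, both dominated by
     a multiple of |f|. *)
  have [s1 H1] : exists s : R, has_sum (fun i => (u i + `|u i|)%:C) s%:C.
    apply: bounded_sums_has_sum.
    apply: (@bounded_sums_le _ _ (fun i => 2 * nc (f i))).
      move=> i; have := uf i; have := ler_norm (u i); have := ler_norm (- u i).
      by rewrite normrN => *; apply/andP; split; lra.
    exact: bounded_sumsZ.
  have [s2 H2] : exists s : R, has_sum (fun i => `|u i|%:C) s%:C.
    apply: bounded_sums_has_sum; apply: bounded_sums_le fs => i.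
    by rewrite normr_ge0 uf.
  exists (s1%:C - s2%:C); have := has_sumB H1 H2.
  by under eq_fun do rewrite -rmorphB addrK.
have [s1 H1] := pos _ (fun i => normc_Re (f i)).
have [s2 H2] := pos _ (fun i => normc_Im (f i)).
exists (s1 + 'i * s2); have := has_sumD H1 (has_sumZ 'i H2).
by under eq_fun do rewrite -complexE.
Qed.

Lemma has_sum_norm_le (I : choiceType) (f : I -> R[i]) s M :
  has_sum f s -> (forall A : {fset I}, \sum_(i <- A) nc (f i) <= M) ->
  nc s <= M.
Proof.
move=> fs HM; apply/ler_addgt0Pl => e e0.
have [A HA] := fs e e0.
have := HA _ (fsubset_refl _); rewrite normcB => H.
rewrite -[s](subrK (\sum_(i <- A) f i)).
apply: le_trans (ler_normcD _ _) _; apply: lerD => //.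
exact: le_trans (ler_normc_sum _ _ _) (HM _).
Qed.

(** For a finite set [B] of rows one finite set of columns serves: the columns of [A] together with
    a good set for each row in [B]. The rectangle then contains [A], and each row sum is reached up
    to e / 2 / (#B + 1). *)
Lemma has_sum_fubini (I J : choiceType) (f : I * J -> R[i]) s (r : I -> R[i]) :
  has_sum f s -> (forall i, has_sum (fun j => f (i, j)) (r i)) -> has_sum r s.
Proof.
move=> fs fr e e0; have e2 : 0 < e / 2 by rewrite divr_gt0.
have [A HA] := fs _ e2.
exists [fset p.1 | p in A]%fset => B AB.
pose d : R := e / 2 / (#|` B|%:R + 1).
have d0 : 0 < d by rewrite divr_gt0// ltr_wpDl.
have [K HK] := choice (fun i => fr i _ d0).
pose J0 := ([fset p.2 | p in A] `|` \bigcup_(i <- B) K i)%fset.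
have AJ : (A `<=` B `*` J0)%fset.
  apply/fsubsetP => p pA; rewrite in_fsetM; apply/andP; split.
    by apply: (fsubsetP AB); apply/imfsetP; exists p.
  by rewrite inE; apply/orP; left; apply/imfsetP; exists p.
have := HA _ AJ; rewrite sum_fsetX => H.
apply: le_trans (ler_normcB _ (\sum_(i <- B) \sum_(j <- J0) f (i, j)) _) _.
rewrite (splitr e); apply: lerD => //.
rewrite -sumrB; apply: le_trans (ler_normc_sum _ _ _) _.
apply: (@le_trans _ _ (\sum_(i <- B) d)).
  rewrite big_seq [leRHS]big_seq; apply: ler_sum => i iB; rewrite normcB.
  apply: HK; apply: fsubset_trans (fsubsetUr _ _).
  exact: bigfcup_sup.
exact: ler_sum_const_share.
Qed.

Lemma abs_summable_row (I J : choiceType) (f : I * J -> R[i]) i :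
  abs_summable f -> abs_summable (fun j => f (i, j)).
Proof.
by apply: (@bounded_sums_reindex _ _ (fun j => (i, j))) => x y [].
Qed.

(** Convergence is phrased through the real sequence |u - l|, so that squeezing and the algebra of
    limits over [R] apply directly. *)
Definition ccvg (u : nat -> R[i]) (l : R[i]) :=
  nc (u k - l) @[k --> \oo] --> (0 : R).

Lemma ccvgP (u : nat -> R[i]) l : ccvg u l <->
  (forall e, 0 < e -> exists N, forall k, (N <= k)%N -> nc (u k - l) <= e).
Proof.
split=> [/cvgrPdist_le H e e0|H].
  have [N _ HN] := H _ e0; exists N => k Nk.
  by have := HN k Nk; rewrite /= sub0r normrN ger0_norm// normc_ge0.
apply/cvgrPdist_le => e e0; have [N HN] := H _ e0.
by exists N => // k /= Nk; rewrite sub0r normrN ger0_norm ?normc_ge0// HN.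
Qed.

(** Dominated convergence for unordered sums. The majorant is required only from some index on,
    because the bounds for Polya's sums hold for large parameters. *)
Lemma has_sum_tannery (I : choiceType) (f : nat -> I -> R[i]) (f0 : I -> R[i])
    (g : I -> R) (s : nat -> R[i]) s0 : bounded_sums g ->
  (exists K, forall k i, (K <= k)%N -> nc (f k i) <= g i) ->
  (forall i, ccvg (f ^~ i) (f0 i)) ->
  (forall k, has_sum (f k) (s k)) -> has_sum f0 s0 -> ccvg s s0.
Proof.
move=> [g0 [M HM]] [K fg] ff0 fs f0s; apply/ccvgP => e e0.
have f0g i : nc (f0 i) <= g i.
  apply/ler_addgt0Pl => d d0; have /ccvgP/(_ _ d0) [N HN] := ff0 i.
  have := HN (maxn N K) (leq_maxl _ _); rewrite normcB => H.
  rewrite -[f0 i](subrK (f (maxn N K) i)).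
  by apply: le_trans (ler_normcD _ _) _; rewrite lerD// fg// leq_maxr.
(* The finite sum over [A] costs e / 5; each of the two tails costs twice as much, being bounded by
   the difference of two partial sums of [g]. *)
have e5 : 0 < e / 5 by rewrite divr_gt0.
have [t gt] := bounded_sums_has_sum (conj g0 (ex_intro _ M HM)).
have [A HA] := gt _ e5.
(* Beyond A the tails of all the series are at most 2 e / 5. *)
have tail (h : I -> R[i]) x : (forall i, nc (h i) <= g i) -> has_sum h x ->
    nc (\sum_(i <- A) h i - x) <= 2 * (e / 5).
  move=> hg hx; apply/ler_addgt0Pl => d d0.
  have [B HB] := hx _ d0.
  have := HB _ (fsubsetUr A B).
  have := HA _ (fsubsetUl A B); have := HA _ (fsubset_refl A).
  rewrite -!rmorph_sum -!rmorphB !normc_real !ler_norml.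
  move=> /andP[h1 h2] /andP[h3 h4] h5.
  apply: le_trans (ler_normcB _ (\sum_(i <- (A `|` B)%fset) h i) _) _.
  rewrite addrC lerD// normcB.
  have split (V : nmodType) (u : I -> V) : \sum_(i <- (A `|` B)%fset) u i =
      \sum_(i <- A) u i + \sum_(i <- ((A `|` B) `\` A)%fset) u i.
    rewrite (big_fsetID _ (mem A)) /=; congr (_ + _); apply: eq_fbigl => i;
    rewrite !inE/=; by case: (i \in A); case: (i \in B).
  rewrite split addrAC subrr add0r.
  apply: le_trans (ler_normc_sum _ _ _) _.
  apply: (@le_trans _ _ (\sum_(i <- ((A `|` B) `\` A)%fset) g i)).
    by apply: ler_sum => i _; exact: hg.
  rewrite split in h3 h4; lra.
pose d : R := e / 5 / (#|` A|%:R + 1).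
have d0 : 0 < d by rewrite divr_gt0// ltr_wpDl.
have [N HN] : exists N, forall i, i \in A -> forall k, (N <= k)%N ->
    nc (f k i - f0 i) <= d.
  have [n Hn] := choice (fun i => (ccvgP _ _).1 (ff0 i) _ d0).
  exists (\max_(i <- A) n i)%N => i iA k nk; apply: Hn.
  by apply: leq_trans nk; apply: leq_bigmax_seq.
exists (maxn N K) => k; rewrite geq_max => /andP[Nk Kk].
apply: le_trans (ler_normcB _ (\sum_(i <- A) f k i) _) _.
have h1 := tail _ _ (fun i => fg k i Kk) (fs k).
have h2 := tail _ _ f0g f0s.
apply: (@le_trans _ _ (2 * (e / 5) + (e / 5 + 2 * (e / 5)))); last by lra.
rewrite lerD ?[nc (s k - _)]normcB//.
apply: le_trans (ler_normcB _ (\sum_(i <- A) f0 i) _) _; rewrite lerD//.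
rewrite -sumrB; apply: le_trans (ler_normc_sum _ _ _) _.
apply: (@le_trans _ _ (\sum_(i <- A) d)).
  by rewrite big_seq [leRHS]big_seq; apply: ler_sum => i iA; exact: HN.
exact: ler_sum_const_share.
Qed.

End Summation.

(** * The complex exponential *)

Section ComplexLimits.
Variable R : realType.
Implicit Types (u v : nat -> R[i]) (l m : R[i]).

Lemma ccvg_le u l (b : nat -> R) : (\forall k \near \oo, nc (u k - l) <= b k) ->
  b k @[k --> \oo] --> (0 : R) -> ccvg u l.
Proof.
move=> ub b0; apply: (squeeze_cvgr _ (cvg_cst (0 : R)) b0).
by apply: filterS ub => k; rewrite normc_ge0.
Qed.

Lemma ccvg_cst l : ccvg (fun=> l) l.
Proof. by rewrite /ccvg subrr Normc.normc0; exact: cvg_cst. Qed.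

Lemma ccvgD u v l m : ccvg u l -> ccvg v m -> ccvg (fun k => u k + v k) (l + m).
Proof.
move=> ul vm; apply: (@ccvg_le _ _ (fun k => nc (u k - l) + nc (v k - m))).
  by apply: nearW => k; rewrite opprD addrACA ler_normcD.
by rewrite -[X in _ --> X](addr0 (0 : R)); exact: cvgD.
Qed.

Lemma ccvgM u v l m : ccvg u l -> ccvg v m -> ccvg (fun k => u k * v k) (l * m).
Proof.
move=> ul vm; apply: (@ccvg_le _ _ (fun k => nc (u k - l) * nc (v k - m)
   + (nc (u k - l) * nc m + nc l * nc (v k - m)))).
  apply: nearW => k; rewrite -!Normc.normcM.
  apply: le_trans (_ : nc ((u k - l) * (v k - m)
    + ((u k - l) * m + l * (v k - m))) <= _); last first.
    by apply: le_trans (ler_normcD _ _) _; rewrite lerD2l ler_normcD.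
  by rewrite le_eqVlt; apply/orP; left; apply/eqP; congr nc; ring.
rewrite [X in _ --> X](_ : 0 = 0 * 0 + (0 * nc m + nc l * 0)); last first.
  by rewrite !(mul0r, mulr0) !addr0.
apply: cvgD; first exact: cvgM.
by apply: cvgD; apply: cvgM => //; exact: cvg_cst.
Qed.

Lemma ccvgZ v l m : ccvg v m -> ccvg (fun k => l * v k) (l * m).
Proof. by apply: ccvgM; exact: ccvg_cst. Qed.

Lemma ccvgN u l : ccvg u l -> ccvg (fun k => - u k) (- l).
Proof.
by move=> /(ccvgZ (-1)); rewrite mulN1r; under eq_fun do rewrite mulN1r.
Qed.

Lemma ccvgB u v l m : ccvg u l -> ccvg v m -> ccvg (fun k => u k - v k) (l - m).
Proof. by move=> ul /ccvgN; exact: ccvgD. Qed.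

Lemma ccvgX u l n : ccvg u l -> ccvg (fun k => u k ^+ n) (l ^+ n).
Proof.
move=> ul; elim: n => [|n IH]; first exact: ccvg_cst.
by under eq_fun do rewrite exprS; rewrite exprS; exact: ccvgM.
Qed.

Lemma ccvg_real (b : nat -> R) (c : R) :
  b k @[k --> \oo] --> c -> ccvg (fun k => (b k)%:C) c%:C.
Proof.
move=> bc; rewrite /ccvg; under eq_fun do rewrite -rmorphB normc_real.
apply/norm_cvg0P; rewrite -(subrr c); apply: cvgB => //; exact: cvg_cst.
Qed.

Lemma ccvg_uniq u l m : ccvg u l -> ccvg u m -> l = m.
Proof.
move=> ul um; apply/eqP; rewrite -subr_eq0 -normc_eq0 eq_le normc_ge0 andbT.
apply/ler_addgt0Pl => e e0; rewrite addr0.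
have e2 : 0 < e / 2 by rewrite divr_gt0.
have [N HN] := (ccvgP _ _).1 ul _ e2; have [M HM] := (ccvgP _ _).1 um _ e2.
apply: le_trans (ler_normcB _ (u (maxn N M)) _) _; rewrite (splitr e) normcB.
by apply: lerD; [apply: HN; exact: leq_maxl|apply: HM; exact: leq_maxr].
Qed.

Lemma ccvg_near u v l : (\forall k \near \oo, u k = v k) -> ccvg u l -> ccvg v l.
Proof.
move=> uv ul; apply: (ccvg_le _ ul).
by apply: filterS uv => k ->.
Qed.

End ComplexLimits.

Section ComplexExponential.
Variable R : realType.
Implicit Types (x y z w : R[i]) (s a b : R).

Definition cexp z : R[i] :=
  (expR (complex.Re z) * cos (complex.Im z))
  +i* (expR (complex.Re z) * sin (complex.Im z)).

Definition exp_trunc n z : R[i] := \sum_(j < n) z ^+ j / j`!%:R.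

Lemma cexpD z w : cexp (z + w) = cexp z * cexp w.
Proof.
case: z w => [a b] [c d]; rewrite /cexp /= expRD cosD sinD.
by simpc; congr (_ +i* _); ring.
Qed.

Lemma cexp0 : cexp 0 = 1.
Proof. by rewrite /cexp /= expR0 cos0 sin0 mulr0 mulr1. Qed.

Lemma cexp_real a : cexp a%:C = (expR a)%:C.
Proof. by rewrite /cexp /= cos0 sin0 mulr0 mulr1. Qed.

Lemma normc_cexp z : nc (cexp z) = expR (complex.Re z).
Proof.
by rewrite /cexp /= !exprMn -mulrDr cos2Dsin2 mulr1 sqrtr_sqr ger0_norm.
Qed.

Lemma cexp_neq0 z : cexp z != 0.
Proof. by rewrite -normc_eq0 normc_cexp expR_eq0. Qed.

Lemma cexpN z : cexp (- z) = (cexp z)^-1.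
Proof.
by apply: (mulfI (cexp_neq0 z)); rewrite -cexpD subrr cexp0 divff// cexp_neq0.
Qed.

Lemma cexpMn n z : cexp (n%:R * z) = cexp z ^+ n.
Proof.
elim: n => [|n IH]; first by rewrite mul0r cexp0.
by rewrite -addn1 natrD mulrDl mul1r cexpD IH exprD.
Qed.

Lemma normc_cexp_le z : nc (cexp z) <= expR (nc z).
Proof.
by rewrite normc_cexp ler_expR; apply: le_trans (normc_Re z); exact: ler_norm.
Qed.

(** The Taylor polynomial at 0, of degree below n, of the real function s |-> Re (l e^(s z)). *)
Let p (l z : R[i]) n : {poly R} :=
  \poly_(j < n) (complex.Re (l * z ^+ j) / j`!%:R).

(** The mean value theorem is one for real functions, hence the projection onto a direction l.
    Differentiating Re (l e^(s z)) in s replaces l by l z, so the induction on n runs over all l at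
    once and each step costs a factor |z|. *)
Lemma cexp_taylor_Re n l z s : 0 <= s <= 1 ->
  `|expR (s * complex.Re z) * (complex.Re l * cos (s * complex.Im z)
      - complex.Im l * sin (s * complex.Im z)) - (p l z n).[s]|
  <= nc l * nc z ^+ n * expR (nc z).
Proof.
elim: n l s => [|n IH] l s /andP[s0 s1].
  rewrite /p (_ : \poly_(j < 0) _ = 0); last first.
    by apply/polyP => i; rewrite coef_poly coef0.
  rewrite horner0 subr0 expr0 mulr1 normrM.
  have H : nc (l * ((cos (s * complex.Im z)) +i* (sin (s * complex.Im z)))) = nc l.
    by rewrite Normc.normcM /= cos2Dsin2 sqrtr1 mulr1.
  rewrite mulrC ler_pM//.
    rewrite -[leRHS]H; apply: le_trans (normc_Re _).
    by case: (l) => u v /=.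
  rewrite ger0_norm ?expR_ge0// ler_expR.
  apply: le_trans (_ : `|complex.Re z| <= _); last exact: normc_Re.
  apply: le_trans (ler_norm _) _; rewrite normrM ger0_norm//.
  by rewrite ler_piMl.
pose F t := expR (t * complex.Re z) * (complex.Re l * cos (t * complex.Im z)
      - complex.Im l * sin (t * complex.Im z)) - (p l z n.+1).[t].
pose dF t := expR (t * complex.Re z) * (complex.Re (l * z) * cos (t * complex.Im z)
      - complex.Im (l * z) * sin (t * complex.Im z)) - (p (l * z) z n).[t].
rewrite -/(F s).
have pE : (p l z n.+1)^`() = p (l * z) z n.
  apply/polyP => i; rewrite coef_deriv !coef_poly ltnS.
  case: ltnP => // _; last by rewrite mul0rn.
  rewrite -mulrA -exprS factS natrM invfM -[LHS]mulr_natr.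
  by rewrite -mulrA; congr (_ * _); rewrite mulrAC mulVf ?mul1r.
have FdF (t : R) : is_derive t (1 : R) F (dF t).
  rewrite /F /dF -pE; apply: is_derive_eq; rewrite /=.
  case: (z) (l) => [a b] [c d] /=; rewrite /GRing.scale /=; ring.
have F0 : F 0 = 0.
  rewrite /F !mul0r expR0 cos0 sin0 mulr0 mulr1 mul1r subr0 horner_coef0.
  by rewrite coef_poly /= expr0 mulr1 divr1 subrr.
have [c] := MVT_segment s0 (fun t _ => FdF t)
  (derivable_within_continuous (fun t _ => @ex_derive _ _ _ _ _ _ _ (FdF t))).
rewrite in_itv /= => /andP[c0 c1]; rewrite F0 !subr0 => ->.
have c01 : 0 <= c <= 1 by rewrite c0 (le_trans _ s1).
rewrite normrM (ger0_norm s0); apply: le_trans (_ : `|dF c| <= _).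
  by rewrite ler_piMr.
apply: le_trans (IH (l * z) c c01) _.
by rewrite Normc.normcM exprS mulrA.
Qed.

Lemma cexp_taylor n z :
  nc (cexp z - exp_trunc n z) <= nc z ^+ n * expR (nc z).
Proof.
set X := cexp z - _; have [->|X0] := eqVneq X 0.
  by rewrite Normc.normc0 mulr_ge0 ?exprn_ge0 ?normc_ge0 ?expR_ge0.
(* In the direction l = conj(X) of the error X itself, Re (l X) = |X|^2, and one factor |X| is
   cancelled. *)
have := @cexp_taylor_Re n (conjc X) z 1; rewrite ler01 lexx => /(_ isT).
rewrite !mul1r normc_conj => H.
have /ler_pM2l <- : 0 < nc X by rewrite normc_gt0.
rewrite mulrA; apply: le_trans H; rewrite -expr2.
rewrite [X in _ <= `|X|](_ : _ = nc X ^+ 2) ?ger0_norm ?sqr_ge0//.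
transitivity (complex.Re (conjc X * X)); last by rewrite mulrC sqr_normc_conj.
have -> : (p (conjc X) z n).[1] = complex.Re (conjc X * exp_trunc n z).
  rewrite /p horner_poly /exp_trunc mulr_sumr.
  rewrite (raddf_sum (@complex.Re R : Rcomplex R -> R)).
  apply: eq_bigr => j _; rewrite expr1n mulr1 mulrA.
  rewrite -(rmorph_nat (real_complex R)) -fmorphV.
  by case: (conjc X * _) => u v /=; rewrite mulr0 subr0.
rewrite [RHS](_ : _ = complex.Re (conjc X * (cexp z - exp_trunc n z)))//.
case: (conjc X) => u v; case: (exp_trunc n z) => c d; rewrite /cexp /=; ring.
Qed.

Lemma cexp_taylor1 z : nc (cexp z - 1) <= nc z * expR (nc z).
Proof.
have := cexp_taylor 1 z.
by rewrite /exp_trunc big_ord_recl big_ord0 expr0 divr1 addr0 expr1.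
Qed.

Lemma cexp_taylor2 z : nc (cexp z - (1 + z)) <= nc z ^+ 2 * expR (nc z).
Proof.
have := cexp_taylor 2 z.
by rewrite /exp_trunc !big_ord_recl big_ord0 expr0 !divr1 addr0 /= expr1.
Qed.

Lemma cexp_taylor3 z :
  nc (cexp z - (1 + z + z ^+ 2 / 2)) <= nc z ^+ 3 * expR (nc z).
Proof.
have := cexp_taylor 3 z.
by rewrite /exp_trunc !big_ord_recl big_ord0 expr0 !divr1 addr0 /= expr1 addrA.
Qed.

Lemma ccvg_cexp (u : nat -> R[i]) l :
  ccvg u l -> ccvg (fun k => cexp (u k)) (cexp l).
Proof.
move=> ul; apply: (@ccvg_le _ _ _ (fun k => nc (cexp l) *
    (nc (u k - l) * expR (nc (u k - l))))).
  apply: nearW => k.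
  have {1}-> : u k = l + (u k - l) by rewrite addrC subrK.
  rewrite cexpD.
  rewrite -[X in _ - X]mulr1 -mulrBr Normc.normcM ler_wpM2l ?normc_ge0//.
  exact: cexp_taylor1.
rewrite [X in _ --> X](_ : 0 = nc (cexp l) * (0 * expR 0)); last first.
  by rewrite mul0r mulr0.
apply: cvgM; first exact: cvg_cst.
apply: cvgM => //; apply: continuous_cvg => //; exact: continuous_expR.
Qed.

End ComplexExponential.

(** * Lattice sums *)

Section SummableBounds.
Variable R : realType.

Lemma bounded_sums_int (g : int -> R) (b : nat -> R) (M : R) :
  (forall k, 0 <= g k <= b `|k|%N) -> (forall k, 0 <= b k) ->
  (forall N, \sum_(0 <= k < N) b k <= M) -> bounded_sums g.
Proof.
move=> gb b0 HM; split=> [i|]; first by case/andP: (gb i).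
exists (M + M) => A.
have [N AN] : exists N, forall i, i \in A -> (`|i| < N)%N.
  exists (\max_(i <- A) `|i|%N).+1 => i iA.
  by rewrite ltnS; exact: leq_bigmax_seq.
pose s := [seq Posz k | k <- iota 0 N] ++ [seq Negz k | k <- iota 0 N].
have us : uniq s.
  rewrite cat_uniq !map_inj_uniq ?iota_uniq ?andbT; last 2 first.
  - by move=> x y [].
  - by move=> x y [].
  by apply/hasPn => _ /mapP[k _ ->]; apply/mapP => -[].
apply: (@le_trans _ _ (\sum_(i <- [fset i in s]%fset) g i)).
  apply: ler_sum_fsubset => [i|]; first by case/andP: (gb i).
  apply/fsubsetP => i /AN iN; rewrite !inE.
  case: i iN => k kN; apply/orP; [left|right]; apply: map_f;
    by rewrite mem_iota; lia.
rewrite (perm_big s); last first.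
  by apply: uniq_perm => [||i]; [exact: fset_uniq|exact: us|rewrite !inE mem_cat].
rewrite big_cat !big_map; apply: lerD.
  apply: le_trans (HM N); rewrite /index_iota subn0; apply: ler_sum => k _.
  by case/andP: (gb k).
(* [Negz k] is -(k + 1): this half is bounded by b 1 + ... + b N, to which the nonnegative b 0 is
   added. *)
apply: le_trans (HM N.+1).
rewrite big_nat_recl//= -[leLHS]add0r lerD// /index_iota subn0.
by apply: ler_sum => k _; case/andP: (gb (Negz k)).
Qed.

(** This is (2 + |k|)^(-3/2), a summable majorant for one-dimensional series; two copies multiply to
    a bound for [decay2]. *)
Definition decay1 (k : int) : R :=
  ((2 + `|k%:~R|) * Num.sqrt (2 + `|k%:~R|))^-1.

(* 1 / sqrt (k + 1) - 1 / sqrt (k + 2) >= 1 / (2 (k + 2)^(3/2)), and the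
   left-hand side telescopes. *)
Lemma bounded_sums_decay1 : bounded_sums decay1.
Proof.
pose r (k : nat) : R := (Num.sqrt k.+1%:R)^-1.
pose b (k : nat) : R := 2 * (r k - r k.+1).
have key (k : nat) : ((2 + k%:R : R) * Num.sqrt (2 + k%:R))^-1 <= b k.
  rewrite /b /r; have -> : 2 + k%:R = k.+2%:R :> R by rewrite -natrD.
  set s := Num.sqrt k.+1%:R; set u := Num.sqrt k.+2%:R.
  have s0 : 0 < s by rewrite sqrtr_gt0.
  have su : s <= u by rewrite ler_wsqrtr// ler_nat.
  have u0 : 0 < u by apply: lt_le_trans su.
  have s2 : s ^+ 2 = k.+1%:R by rewrite sqr_sqrtr.
  have u2 : u ^+ 2 = k.+2%:R by rewrite sqr_sqrtr.
  have e1 : (u - s) * (u + s) = 1.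
    by rewrite -subr_sqr u2 s2 -[k.+2]addn1 natrD addrC addKr.
  have -> : s^-1 - u^-1 = (s * u * (u + s))^-1.
    apply: (@mulfI _ (s * u * (u + s))).
      by rewrite !mulf_neq0 ?gt_eqF// addr_gt0.
    rewrite divff ?mulf_neq0 ?gt_eqF// ?addr_gt0//.
    transitivity ((u - s) * (u + s)); last by [].
    by field; rewrite !gt_eqF.
  rewrite -u2 -exprSr -[X in _ <= X * _]invrK -invfM lef_pV2 ?posrE ?mulr_gt0 ?exprn_gt0 ?addr_gt0//.
  have : s * u * (u + s) <= u * u * (u + u).
    have s0' := ltW s0; have u0' := ltW u0.
    apply: ler_pM; [exact: mulr_ge0|exact: addr_ge0| |by rewrite lerD2l].
    by rewrite ler_pM2r.
  rewrite exprS expr2; lra.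
apply: (@bounded_sums_int _ b 2).
- move=> k; rewrite {1}/decay1 invr_ge0 mulr_ge0 ?sqrtr_ge0 ?addr_ge0//=.
  by rewrite /decay1 -intr_norm -natr_absz; exact: key.
- by move=> k; apply: le_trans (key k); rewrite invr_ge0 mulr_ge0 ?sqrtr_ge0.
- move=> N; rewrite /b -mulr_sumr.
  have -> : \sum_(0 <= k < N) (r k - r k.+1) = r 0%N - r N.
    rewrite -[RHS]opprB -telescope_sumr// -sumrN.
    by apply: eq_bigr => k _; rewrite opprB.
  rewrite {1}/r sqrtr1 invr1 ler_piMr// lerBlDr lerDl invr_ge0.
  exact: sqrtr_ge0.
Qed.

Definition decay2 (p : int * int) : R :=
  ((2 + `|p.1%:~R| + `|p.2%:~R|) ^+ 3)^-1.

(** Raising (2 + a) (2 + b) <= (2 + a + b)^2 to the power 3/2 bounds the inverse cube by a product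
    of two one-dimensional terms. *)
Lemma bounded_sums_decay2 : bounded_sums decay2.
Proof.
apply: bounded_sums_le (bounded_sums_prod bounded_sums_decay1 bounded_sums_decay1).
case=> m n; rewrite /decay2 /decay1 /=.
set a := `|m%:~R|; set b := `|n%:~R|.
have a0 : 0 <= a := normr_ge0 _; have b0 : 0 <= b := normr_ge0 _.
rewrite invr_ge0 exprn_ge0 ?addr_ge0//= -invfM.
have a2 : 0 < 2 + a by rewrite ltr_wpDr.
have b2 : 0 < 2 + b by rewrite ltr_wpDr.
have ab2 : 0 < 2 + a + b by rewrite ltr_wpDr.
rewrite lef_pV2 ?posrE ?exprn_gt0 ?mulr_gt0 ?sqrtr_gt0//.
rewrite mulrACA -sqrtrM ?addr_ge0// exprSr.
have H : (2 + a) * (2 + b) <= (2 + a + b) ^+ 2 by nra.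
apply: ler_pM; rewrite ?mulr_ge0 ?addr_ge0 ?sqrtr_ge0//.
apply: le_trans (ler_wsqrtr H) _.
by rewrite sqrtr_sqr ger0_norm ?addr_ge0.
Qed.

(** The lattice is normalized to w1 = 1. The first coordinate multiplies tau, so that a row of fixed
    p.1 is an inner sum of Eisenstein's summation. *)
Definition latpt (tau : R[i]) (p : int * int) : R[i] :=
  p.1%:~R * tau + p.2%:~R.

Lemma Re_latpt tau p :
  complex.Re (latpt tau p) = p.1%:~R * complex.Re tau + p.2%:~R.
Proof.
case: p tau => m n [x y]; rewrite /latpt /=.
rewrite -!(rmorph_int (real_complex R)) /=.
by rewrite mul0r subr0.
Qed.

Lemma Im_latpt tau p : complex.Im (latpt tau p) = p.1%:~R * complex.Im tau.
Proof.
case: p tau => m n [x y]; rewrite /latpt /=.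
rewrite -!(rmorph_int (real_complex R)) /=.
by rewrite mul0r !addr0.
Qed.

(** Im w = m Im(tau) controls m, and then Re w = m Re(tau) + n controls n. *)
Lemma latpt_ge (tau : R[i]) : 0 < complex.Im tau -> exists2 K : R, 0 < K &
  forall p, `|p.1%:~R| + `|p.2%:~R| <= K * nc (latpt tau p).
Proof.
case: tau => x y /= y0.
have iy : 0 <= y^-1 by rewrite invr_ge0 ltW.
exists (y^-1 + (1 + `|x| / y)).
  by rewrite ltr_wpDl// ltr_wpDr// divr_ge0// ltW.
move=> p; rewrite mulrDl; set w := latpt _ p.
have h1 : `|p.1%:~R| <= y^-1 * nc w.
  rewrite mulrC ler_pdivlMr// -[X in _ * X](gtr0_norm y0) -normrM.
  by have := normc_Im w; rewrite Im_latpt.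
apply: lerD => //.
have h2 : `|p.2%:~R| <= nc w + `|p.1%:~R| * `|x|.
  have := normc_Re w; rewrite Re_latpt /= => h.
  rewrite -normrM -[p.2%:~R](addKr (p.1%:~R * x)) addrC.
  by apply: le_trans (ler_normB _ _) _; rewrite lerD2r.
apply: le_trans h2 _; rewrite mulrDl mul1r lerD2l mulrC -mulrA.
by rewrite ler_wpM2l.
Qed.

Lemma latpt_eq0 (tau : R[i]) p : 0 < complex.Im tau ->
  (latpt tau p == 0) = (p == (0, 0)).
Proof.
move=> /latpt_ge[K K0 H]; apply/eqP/eqP => [w0|->]; last first.
  by rewrite /latpt mul0r addr0.
have := H p; rewrite w0 Normc.normc0 mulr0 => h.
have : `|p.1%:~R : R| == 0 by rewrite eq_le normr_ge0 andbT (le_trans _ h)// lerDl.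
have : `|p.2%:~R : R| == 0 by rewrite eq_le normr_ge0 andbT (le_trans _ h)// lerDr.
by rewrite !normr_eq0 !intr_eq0; case: (p) => a b /= /eqP-> /eqP->.
Qed.

Lemma bounded_sums_latpt (tau : R[i]) : 0 < complex.Im tau ->
  bounded_sums (fun p => ((1 + nc (latpt tau p)) ^+ 3)^-1).
Proof.
move=> /latpt_ge[K K0 H].
apply: bounded_sums_le (bounded_sumsZ (c := (2 + K) ^+ 3) _ bounded_sums_decay2);
  last by rewrite exprn_ge0// addr_ge0// ltW.
move=> p; set w := latpt _ p; have w0 := normc_ge0 w.
rewrite invr_ge0 exprn_ge0 ?addr_ge0//= /decay2.
set a := `|_|; set b := `|_|.
have a0 : 0 <= a := normr_ge0 _; have b0 : 0 <= b := normr_ge0 _.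
rewrite ler_pdivlMr; last by rewrite exprn_gt0// ltr_wpDr// ltr_wpDr.
rewrite mulrC ler_pdivrMr; last by rewrite exprn_gt0// ltr_wpDr.
rewrite -exprMn lerXn2r ?nnegrE ?mulr_ge0 ?addr_ge0 ?(ltW K0)//.
have := H p; rewrite -/a -/b -/w; nra.
Qed.

Lemma expR_gauss_bound (a b : R) (k : nat) : 0 < a -> exists2 C : R, 0 < C &
  forall u, 0 <= u -> (1 + u) ^+ k * expR (- a * u ^+ 2 + b * u) <= C.
Proof.
(* [D] is the maximum of (b + 1) u - a u^2, so the Gaussian is at most e^D e^(-u), and e^(-u)
   absorbs the power of 1 + u up to a constant. *)
move=> a0; pose D := (b + 1) ^+ 2 / (4 * a).
exists (expR D * (k.+1`!%:R * expR 1)).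
  by rewrite !mulr_gt0 ?expR_gt0// ltr0n fact_gt0.
move=> u u0.
have e1 : expR (- a * u ^+ 2 + b * u) <= expR D * expR (- u).
  rewrite -expRD ler_expR -subr_ge0.
  have -> : D + - u - (- a * u ^+ 2 + b * u) = (2 * a * u - (b + 1)) ^+ 2 / (4 * a).
    by rewrite /D; field; rewrite gt_eqF.
  by rewrite divr_ge0 ?sqr_ge0// mulr_ge0// ltW.
have e2 : (1 + u) ^+ k <= k.+1`!%:R * expR (1 + u).
  apply: le_trans (_ : (1 + u) ^+ k.+1 <= _).
    by apply: ler_weXn2l => //; rewrite lerDl.
  have := @expR_ge1Dxn R (1 + u) k (addr_ge0 ler01 u0).
  have : 0 < k.+1`!%:R :> R by rewrite ltr0n fact_gt0.
  move: (k.+1`!%:R) (expR (1 + u)) ((1 + u) ^+ k.+1) => f e x f0 h.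
  rewrite mulrC -ler_pdivrMr//; lra.
apply: (@le_trans _ _ ((k.+1`!%:R * expR (1 + u)) * (expR D * expR (- u)))).
  by apply: ler_pM; rewrite ?exprn_ge0 ?addr_ge0 ?expR_ge0.
rewrite [expR (1 + u)]expRD.
rewrite [leLHS](_ : _ = expR D * (k.+1`!%:R * expR 1) * (expR u * expR (- u))).
  by rewrite expRxMexpNx_1 mulr1.
by ring.
Qed.
End SummableBounds.

(** * Poisson summation for Gaussians *)

Section Reindexing.
Variables (R : realType) (I J : choiceType) (h : I -> J) (h' : J -> I).
Hypothesis hK : cancel h h'.
Variable f : J -> R[i].
Hypothesis f0 : forall j, h (h' j) != j -> f j = 0.

(** As [h'] is a left inverse of [h], the condition [h (h' j) != j] says exactly that j is outside
    the image of [h], so only zero terms are added. *)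
Lemma has_sum_extend s : has_sum (f \o h) s -> has_sum f s.
Proof.
move=> fs e e0; have [A HA] := fs e e0.
exists [fset h i | i in A]%fset => B AB.
pose B' := [fset j in B | h (h' j) == j]%fset.
pose C := [fset h' j | j in B']%fset.
have -> : \sum_(j <- B) f j = \sum_(i <- C) (f \o h) i.
  have -> : \sum_(i <- C) (f \o h) i = \sum_(j <- B') f j.
    rewrite /C big_imfset /=; last first.
      move=> x y; rewrite !inE => /andP[_ /eqP xE] /andP[_ /eqP yE] xy.
      by rewrite -xE -yE xy.
    rewrite big_seq [RHS]big_seq; apply: eq_bigr => j.
    by rewrite !inE => /andP[_ /eqP ->].
  apply/esym/big_fset_incl; first by apply/fsubsetP => j; rewrite !inE => /andP[].
  move=> j jB; rewrite !inE jB /= => /f0; exact.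
apply: HA; apply/fsubsetP => i iA; apply/imfsetP; exists (h i); rewrite ?hK//=.
rewrite !inE hK eqxx andbT; apply: (fsubsetP AB).
by apply/imfsetP; exists i.
Qed.

Lemma has_sum_restrict s : has_sum f s -> has_sum (f \o h) s.
Proof.
move=> fs e e0; have [A HA] := fs e e0.
exists [fset h' j | j in A]%fset => B AB.
pose C := ([fset h i | i in B] `|` A)%fset.
suff -> : \sum_(i <- B) (f \o h) i = \sum_(j <- C) f j.
  by apply: HA; exact: fsubsetUr.
transitivity (\sum_(j <- [fset h i | i in B]%fset) f j).
  rewrite big_imfset//= => x y _ _; exact: (can_inj hK).
apply: big_fset_incl; first exact: fsubsetUl.
move=> j; rewrite in_fsetU => /orP[-> //|jA] jB; apply: f0.
apply: contra jB => /eqP jE; apply/imfsetP; exists (h' j); rewrite ?jE//=.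
by apply: (fsubsetP AB); apply/imfsetP; exists j.
Qed.

End Reindexing.

(** * Central binomial coefficients *)

Section CentralBinomial.
Variable R : realType.

(** The constant coefficient of ((2 + Z + 1/Z) / 4)^m, of size C0 / sqrt(m). *)
Definition cbin (m : nat) : R := 'C(m.*2, m)%:R / 4 ^+ m.

Lemma cbin_gt0 m : 0 < cbin m.
Proof. by rewrite divr_gt0 ?exprn_gt0// ltr0n bin_gt0 -addnn leq_addr. Qed.

Lemma cbinS m : cbin m.+1 = cbin m * ((m.*2.+1)%:R / (m.*2.+2)%:R).
Proof.
have h1 := mul_bin_diag m.*2.+2 m; have h2 := mul_bin_down m.*2.+1 m.
have e : (m.*2.+1 - m = m.+1)%N by rewrite -addnn; lia.
rewrite /= e in h1 h2; rewrite /cbin doubleS.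
have {}h1 : (m.*2.+2)%:R * 'C(m.*2.+1, m)%:R = m.+1%:R * 'C(m.*2.+2, m.+1)%:R :> R.
  by rewrite -!natrM h1.
have {}h2 : (m.*2.+1)%:R * 'C(m.*2, m)%:R = m.+1%:R * 'C(m.*2.+1, m)%:R :> R.
  by rewrite -!natrM h2.
have m1 : m.+1%:R != 0 :> R by rewrite pnatr_eq0.
have e2 : m.*2.+2%:R = 2 * m.+1%:R :> R.
  by rewrite -natrM mul2n doubleS.
have {h1} -> : 'C(m.*2.+2, m.+1)%:R = m.*2.+2%:R * 'C(m.*2.+1, m)%:R / m.+1%:R :> R.
  by rewrite h1 mulrAC divff ?mul1r.
have -> : 'C(m.*2.+1, m)%:R = m.*2.+1%:R * 'C(m.*2, m)%:R / m.+1%:R :> R.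
  by rewrite h2 mulrAC divff ?mul1r.
by rewrite e2 exprS; field; rewrite nat1r m1 expf_neq0.
Qed.

(* m cbin(m)^2 increases while (m + 1/2) cbin(m)^2 decreases. *)
Lemma cbin_sqrt_cvg : exists2 C0 : R, 0 < C0 &
  Num.sqrt m%:R * cbin m @[m --> \oo] --> C0.
Proof.
pose u m : R := Num.sqrt m%:R * cbin m.
have u2 m : u m ^+ 2 = m%:R * cbin m ^+ 2 by rewrite exprMn sqr_sqrtr.
have u0 m : 0 <= u m by rewrite mulr_ge0 ?sqrtr_ge0// ltW// cbin_gt0.
have r2 m : m.*2%:R = 2 * m%:R :> R by rewrite -natrM mul2n.
have rS m : m.+1%:R = m%:R + 1 :> R by rewrite -natr1.
have nd : nondecreasing_seq u.
  apply/nondecreasing_seqP => m; rewrite -(ler_pXn2r (ltn0Sn 1)) ?nnegrE//.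
  rewrite !u2 cbinS [(cbin m * _) ^+ 2]exprMn [leRHS]mulrCA [leLHS]mulrC ler_pM2l ?exprn_gt0 ?cbin_gt0//.
  rewrite -[m.*2.+2]/(m.+1.*2) r2 rS [m.*2.+1%:R]rS r2.
  have m0 : 0 <= m%:R :> R by [].
  rewrite expr_div_n mulrA ler_pdivlMr; last by rewrite exprn_gt0// mulr_gt0// ltr_wpDl.
  by rewrite -subr_ge0 [X in 0 <= X](_ : _ = m%:R + 1) ?addr_ge0//; ring.
have dec m : (m%:R + 2^-1) * cbin m ^+ 2 <= 2^-1.
  elim: m => [|m IH]; first by rewrite add0r /cbin bin0 expr0 divr1 expr1n mulr1.
  apply: le_trans IH; rewrite cbinS [(cbin m * _) ^+ 2]exprMn [leLHS]mulrCA [leRHS]mulrC.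
  rewrite ler_pM2l ?exprn_gt0 ?cbin_gt0//.
  rewrite -[m.*2.+2]/(m.+1.*2) r2 rS [m.*2.+1%:R]rS r2.
  have m0 : 0 <= m%:R :> R by [].
  rewrite expr_div_n mulrA ler_pdivrMr; last by rewrite exprn_gt0// mulr_gt0// ltr_wpDl.
  rewrite -subr_ge0 [X in 0 <= X](_ : _ = m%:R + 2^-1) ?addr_ge0//; by field.
have ub m : u m <= 1.
  rewrite -(ler_pXn2r (ltn0Sn 1)) ?nnegrE// u2 expr1n.
  have := dec m; have : 0 <= cbin m ^+ 2 by rewrite sqr_ge0.
  by move: (cbin m ^+ 2) (m%:R : R) => x y; lra.
have cv : cvgn u.
  by apply: nondecreasing_is_cvgn => //; exists 1 => _ [m _ <-].
exists (limn u) => //.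
apply: lt_le_trans (_ : u 1%N <= _); last exact: nondecreasing_cvgn_le.
by rewrite mulr_gt0 ?sqrtr_gt0// cbin_gt0.
Qed.

Definition cbin_ratio (m k : nat) : R := 'C(m.*2, m + k)%:R / 'C(m.*2, m)%:R.

Lemma cbin_ratio0 m : cbin_ratio m 0 = 1.
Proof.
by rewrite /cbin_ratio addn0 divff// pnatr_eq0 -lt0n bin_gt0 -addnn leq_addr.
Qed.

Lemma cbin_ratio_ge0 m k : 0 <= cbin_ratio m k.
Proof. by rewrite divr_ge0. Qed.

Lemma cbin_ratioS m k : (k < m)%N ->
  cbin_ratio m k.+1 = cbin_ratio m k * ((m%:R - k%:R) / (m + k).+1%:R).
Proof.
move=> km; rewrite /cbin_ratio.
have := mul_bin_left m.*2 (m + k); rewrite addnS.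
have -> : (m.*2 - (m + k) = m - k)%N by rewrite -addnn; lia.
move=> h; have {}h : (m + k).+1%:R * 'C(m.*2, (m + k).+1)%:R
    = (m%:R - k%:R) * 'C(m.*2, m + k)%:R :> R.
  by rewrite -natrB 1?ltnW// -!natrM h.
have mk : (m + k).+1%:R != 0 :> R by rewrite pnatr_eq0.
have -> : 'C(m.*2, (m + k).+1)%:R
    = (m%:R - k%:R) * 'C(m.*2, m + k)%:R / (m + k).+1%:R :> R.
  by rewrite -h mulrAC divff ?mul1r.
by ring.
Qed.

Lemma cbin_ratio_gt m k : (m < k)%N -> cbin_ratio m k = 0.
Proof. by move=> mk; rewrite /cbin_ratio bin_small ?mul0r// -addnn ltn_add2l. Qed.

(** The ratio is the product over j < k of (m - j) / (m + j + 1) = 1 - (2 j + 1) / (m + j + 1).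
    Freezing the denominator at m + k weakens each factor e^(- (2 j + 1) / (m + k)) and lets the
    exponents add up, as 1 + 3 + ... + (2 k - 1) = k^2. *)
Lemma cbin_ratio_le m k : (k <= m)%N ->
  cbin_ratio m k <= expR (- (k%:R ^+ 2 / (m + k)%:R)).
Proof.
have [->|k0] := eqVneq k 0%N; first by rewrite cbin_ratio0 expr0n mul0r oppr0 expR0.
move=> km; have mk : 0 < (m + k)%:R :> R by rewrite ltr0n; lia.
suff gen j : (j <= k)%N -> cbin_ratio m j <= expR (- (j%:R ^+ 2 / (m + k)%:R)).
  exact: gen.
elim: j => [|j IH] jk.
  by rewrite cbin_ratio0 expr0n mul0r oppr0 expR0.
rewrite cbin_ratioS; last by lia.
have -> : - (j.+1%:R ^+ 2 / (m + k)%:R)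
    = - (j%:R ^+ 2 / (m + k)%:R) - (2 * j%:R + 1) / (m + k)%:R :> R.
  by rewrite -natr1; ring.
have jm : 0 <= m%:R - j%:R :> R by rewrite subr_ge0 ler_nat; lia.
rewrite expRD; apply: ler_pM; rewrite ?cbin_ratio_ge0 ?divr_ge0//; first by apply: IH; lia.
apply: le_trans (expR_ge1Dx _).
have mj : 0 < (m + j).+1%:R :> R by [].
have -> : (m%:R - j%:R) / (m + j).+1%:R = 1 - (2 * j%:R + 1) / (m + j).+1%:R :> R.
  by rewrite -natr1 natrD; field; rewrite gt_eqF//; have := ler0n R m; have := ler0n R j; lra.
rewrite lerD2l lerN2 ler_pM2l ?ltr_wpDl ?mulr_ge0//.
by rewrite lef_pV2 ?posrE// ler_nat; lia.
Qed.

(** The inverse factors are 1 + (2 j + 1) / (m - j), at most e^((2 j + 1) / (m - k)); here the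
    denominator is frozen at m - k. *)
Lemma cbin_ratio_ge m k : (k < m)%N ->
  expR (- (k%:R ^+ 2 / (m - k)%:R)) <= cbin_ratio m k.
Proof.
move=> km; have mk : 0 < (m - k)%:R :> R by rewrite ltr0n; lia.
suff gen j : (j <= k)%N -> expR (- (j%:R ^+ 2 / (m - k)%:R)) <= cbin_ratio m j.
  exact: gen.
elim: j => [|j IH] jk.
  by rewrite cbin_ratio0 expr0n mul0r oppr0 expR0.
rewrite cbin_ratioS; last by lia.
have -> : - (j.+1%:R ^+ 2 / (m - k)%:R)
    = - (j%:R ^+ 2 / (m - k)%:R) - (2 * j%:R + 1) / (m - k)%:R :> R.
  by rewrite -natr1; ring.
rewrite expRD; apply: ler_pM; rewrite ?expR_ge0//; first by apply: IH; lia.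
have jm : 0 < m%:R - j%:R :> R by rewrite subr_gt0 ltr_nat; lia.
rewrite expRN invf_ple ?posrE ?expR_gt0// ?divr_gt0// invf_div.
apply: le_trans (expR_ge1Dx _).
have -> : (m + j).+1%:R / (m%:R - j%:R) = 1 + (2 * j%:R + 1) / (m%:R - j%:R) :> R.
  by rewrite -natr1 natrD; field; rewrite gt_eqF.
rewrite lerD2l ler_pM2l ?ltr_wpDl ?mulr_ge0//.
rewrite lef_pV2 ?posrE// natrB ?lerD2l ?lerN2 ?ler_nat//; lia.
Qed.

End CentralBinomial.

(** * Roots of unity and the discrete Poisson formula *)

Section Characters.
Variable R : realType.
Implicit Types (x y s : R[i]).

(** The character e^(2 pi i x), for complex x because the shifts in the theta functions need not be
    real. *)
Definition ei x : R[i] := cexp ((0 +i* (2 * pi)) * x).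

Lemma eiD x y : ei (x + y) = ei x * ei y.
Proof. by rewrite /ei mulrDr cexpD. Qed.

Lemma eiN x : ei (- x) = (ei x)^-1.
Proof. by rewrite /ei mulrN cexpN. Qed.

Lemma ei_neq0 x : ei x != 0.
Proof. exact: cexp_neq0. Qed.

Lemma eiMn n x : ei (n%:R * x) = ei x ^+ n.
Proof. by rewrite /ei mulrCA cexpMn. Qed.

Lemma ei1 : ei 1 = 1.
Proof.
by rewrite /ei mulr1 /cexp /= expR0 !mul1r mulr_natl cos2pi sin2pi.
Qed.

Lemma ei_int (k : int) : ei k%:~R = 1.
Proof.
have N (n : nat) : ei n%:R = 1 by rewrite -[n%:R]mulr1 eiMn ei1 expr1n.
by case: k => n; rewrite ?NegzE ?mulrNz ?eiN N// invr1.
Qed.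

Lemma normc_ei x : nc (ei x) = expR (- (2 * pi * complex.Im x)).
Proof.
by rewrite /ei normc_cexp; case: x => a b /=; rewrite mul0r sub0r.
Qed.

(** With t = d / l the real part is cos(2 pi t) = 1 - 2 sin(pi t)^2, and sin is positive on (0,
    pi). *)
Lemma ei_frac_neq1 (d l : nat) : (0 < d < l)%N -> ei (d%:R / l%:R) != 1.
Proof.
move=> /andP[d0 dl]; apply/eqP => h.
have l0 : 0 < l%:R :> R by rewrite ltr0n (ltn_trans d0).
have xE : d%:R / l%:R = (d%:R / l%:R : R)%:C :> R[i].
  by rewrite rmorphM fmorphV !rmorph_nat.
set t : R := d%:R / l%:R in xE.
have t0 : 0 < t by rewrite divr_gt0// ltr0n.
have t1 : t < 1 by rewrite ltr_pdivrMr// mul1r ltr_nat.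
have : complex.Re (ei (d%:R / l%:R)) = 1 by rewrite h.
rewrite xE /ei /cexp /= !(mul0r, mulr0) subr0 expR0 mul1r add0r.
have -> : 2 * pi * t = (pi * t) *+ 2 by rewrite [RHS]mulr2n; ring.
rewrite cos_mulr2n cos2sin2 => {}h.
have : 0 < sin (pi * t).
  by rewrite sin_gt0_pi// mulr_gt0 ?pi_gt0//= gtr_pMr// pi_gt0.
by move=> /(exprn_gt0 2); move: h; rewrite mulr2n; lra.
Qed.

Lemma sum_ei_frac (l : nat) (d : int) : (0 < l)%N ->
  \sum_(i < l) ei (i%:R * (d%:~R / l%:R)) = if (l%:Z %| d)%Z then l%:R else 0.
Proof.
move=> l0; have lC : l%:R != 0 :> R[i] by rewrite pnatr_eq0 -lt0n.
set z := ei (d%:~R / l%:R).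
have zl : z ^+ l = 1 by rewrite -eiMn mulrCA divff// mulr1 ei_int.
under eq_bigr do rewrite eiMn -/z.
case: ifPn => [/dvdzP[k kE]|ndiv].
  have -> : z = 1 by rewrite /z kE intrM mulfK// ei_int.
  by under eq_bigr do rewrite expr1n; rewrite sumr_const card_ord.
have z1 : z != 1.
  have lz : l%:Z != 0 by rewrite -lt0n.
  rewrite /z (divz_eq d l) intrD intrM mulrDl mulfK// eiD ei_int mul1r.
  have m0 : (0 <= (d %% l)%Z) := modz_ge0 d lz.
  have ml : ((d %% l)%Z < l%:Z) by rewrite ltz_pmod// -lt0n.
  have mn : (d %% l)%Z != 0 by apply: contra ndiv => /eqP/dvdz_mod0P.
  case: (d %% l)%Z m0 ml mn => // n _ nl n0.
  by apply: ei_frac_neq1; rewrite lt0n n0.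
apply/eqP; have : (z - 1) * (\sum_(i < l) z ^+ i) == 0.
  by rewrite -subrX1 zl subrr.
by rewrite mulf_eq0 subr_eq0 (negbTE z1).
Qed.

(** Since 2 + Z + 1/Z = (1 + Z)^2 / Z, the power is (1 + Z)^(2 m) / Z^m. By symmetry its coefficient
    at Z^d is C(2 m, m + |d|), which vanishes for |d| > m. *)
Lemma has_sum_binomial m x :
  has_sum (fun d : int => 'C(m.*2, m + `|d|)%:R * ei (d%:~R * x))
    ((2 + ei x + (ei x)^-1) ^+ m).
Proof.
apply: (@has_sum_extend R nat int (fun k : nat => k%:Z - m%:Z)
  (fun d : int => absz (d + m%:Z)%R)).
- by move=> k; rewrite subrK absz_nat.
- move=> d dm; rewrite bin_small ?mul0r//.
  have : d + m%:Z < 0.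
    by rewrite ltNge; apply: contra dm => h; rewrite gez0_abs// addrK.
  rewrite -addnn; lia.
have -> : (2 + ei x + (ei x)^-1) ^+ m =
    \sum_(k <- [fset k in iota 0 m.*2.+1]%fset)
      'C(m.*2, m + `|k%:Z - m%:Z|)%:R * ei ((k%:Z - m%:Z)%:~R * x).
  rewrite (perm_big (iota 0 m.*2.+1)); last first.
    by apply: uniq_perm => [||i]; [exact: fset_uniq|exact: iota_uniq|rewrite !inE].
  have -> : 2 + ei x + (ei x)^-1 = (1 + ei x) ^+ 2 * (ei x)^-1.
    by field; exact: ei_neq0.
  rewrite exprMn -exprM mul2n exprDn mulr_suml.
  have -> : iota 0 m.*2.+1 = index_iota 0 m.*2.+1 by rewrite /index_iota subn0.
  rewrite big_mkord.
  apply: eq_bigr => -[k /= km] _; rewrite expr1n mul1r -mulr_natl -mulrA.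
  have -> : 'C(m.*2, m + `|k%:Z - m%:Z|) = 'C(m.*2, k).
    have [mk|/ltnW kl] := leqP m k.
      by rewrite distnEl// subnKC.
    rewrite distnEr// -bin_sub; last by rewrite -addnn; lia.
    by congr ('C(_, _)); rewrite -addnn; lia.
  by rewrite intrD rmorphN mulrDl mulNr eiD eiN !eiMn exprVn.
apply: has_sum_finite => k; rewrite !inE mem_iota => km.
by rewrite /= bin_small ?mul0r//; move: km; rewrite -addnn; lia.
Qed.

(* The discrete Poisson formula: summing over a full period of (shifted) l-th
   roots of unity kills the frequencies that are not multiples of l. *)
Lemma has_sum_binomial_period m p s : let l := p.*2.+1 in
  has_sum (fun r : int => l%:R * ('C(m.*2, m + `|r| * l)%:R * ei (r%:~R * s)))
   (\sum_(i < l) (2 + ei ((i%:R - p%:R + s) / l%:R)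
      + (ei ((i%:R - p%:R + s) / l%:R))^-1) ^+ m).
Proof.
move=> l; have lC : l%:R != 0 :> R[i] by rewrite pnatr_eq0.
have H := @has_sum_sum R _ _ (index_enum 'I_l) xpredT _ _
  (fun i _ => has_sum_binomial m ((i%:R - p%:R + s) / l%:R)).
have step (d : int) : \sum_(i < l) 'C(m.*2, m + `|d|)%:R *
    ei (d%:~R * ((i%:R - p%:R + s) / l%:R)) =
   'C(m.*2, m + `|d|)%:R * ei (d%:~R * (s - p%:R) / l%:R) *
   (if (l%:Z %| d)%Z then l%:R else 0).
  rewrite -sum_ei_frac// mulr_sumr; apply: eq_bigr => i _.
  by rewrite -mulrA -eiD; congr (_ * ei _); field.
have -> : (fun r : int => l%:R * ('C(m.*2, m + `|r| * l)%:R * ei (r%:~R * s)))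
  = (fun d : int => \sum_(i < l) 'C(m.*2, m + `|d|)%:R *
    ei (d%:~R * ((i%:R - p%:R + s) / l%:R))) \o (fun r => r * l%:Z).
  apply/funext => r /=; rewrite step dvdz_mull// abszM absz_nat.
  rewrite [RHS]mulrC; congr (_ * (_ * _)).
  rewrite intrM mulrAC mulfK//.
  rewrite mulrBr eiD -{1}[ei (_ * s)]mulr1; congr (_ * _).
  (* The shift by p, which centres the period at 0, is invisible because r p is an integer. *)
  by rewrite eiN -[p%:R]/(p%:Z%:~R) -intrM ei_int invr1.
apply: (has_sum_restrict (h' := fun d => (d %/ l)%Z)) H => [r|d].
  by rewrite mulzK.
rewrite step; case: ifPn => [/divzK->|]; first by rewrite eqxx.
by rewrite mulr0.
Qed.

End Characters.

Section PowerLimit.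
Variable R : realType.
Implicit Types (x y : R[i]).

Lemma ccvg_norm (u : nat -> R[i]) l :
  ccvg u l -> nc (u k) @[k --> \oo] --> nc l.
Proof.
move=> /ccvgP H; apply/cvgrPdist_le => e /H[N HN].
exists N => // k /= /HN h; rewrite ler_distl.
have h1 := ler_normcB (u k) l 0; have h2 := ler_normcB l (u k) 0.
rewrite !subr0 in h1 h2; rewrite normcB in h2.
by apply/andP; split; lra.
Qed.

Lemma normc_subX x y M n : 1 <= M -> nc x <= M -> nc y <= M ->
  nc (x ^+ n - y ^+ n) <= n%:R * nc (x - y) * M ^+ n.
Proof.
move=> M1 xM yM; elim: n => [|n IH].
  by rewrite !expr0 subrr Normc.normc0 !mul0r.
have M0 : 0 <= M := le_trans ler01 M1.
have -> : x ^+ n.+1 - y ^+ n.+1 = x * (x ^+ n - y ^+ n) + (x - y) * y ^+ n.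
  by rewrite !exprS; ring.
apply: le_trans (ler_normcD _ _) _; rewrite !Normc.normcM normcX.
have h1 : nc x * nc (x ^+ n - y ^+ n) <= M * (n%:R * nc (x - y) * M ^+ n).
  by apply: ler_pM; rewrite ?normc_ge0.
have h2 : nc (x - y) * nc y ^+ n <= nc (x - y) * M ^+ n.+1.
  apply: ler_wpM2l; first exact: normc_ge0.
  apply: le_trans (_ : M ^+ n <= _).
    by rewrite lerXn2r ?nnegrE ?normc_ge0.
  by rewrite ler_weXn2l.
apply: le_trans (lerD h1 h2) _.
by rewrite -natr1 [in leLHS]exprS exprS le_eqVlt; apply/orP; left; apply/eqP; ring.
Qed.

(** The comparison is with (e^x)^m, which avoids a complex logarithm: 1 + x and e^x both have
    modulus at most e^|x|, so their m-th powers differ by at most m |x|^2 e^|x| e^(m |x|), where m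
    |x| stays bounded. *)
Lemma ccvg_pow (x : nat -> R[i]) (m : nat -> nat) L :
  ccvg (fun k => (m k)%:R * x k) L -> ccvg x 0 ->
  ccvg (fun k => (1 + x k) ^+ m k) (cexp L).
Proof.
move=> mxL x0; pose a k := nc ((m k)%:R * x k).
pose b k := nc (x k).
have aL : a k @[k --> \oo] --> nc L by exact: ccvg_norm.
have b0 : b k @[k --> \oo] --> (0 : R).
  by rewrite -(Normc.normc0 R); exact: ccvg_norm.
suff H : ccvg (fun k => (1 + x k) ^+ m k - cexp ((m k)%:R * x k)) 0.
  have := ccvgD H (ccvg_cexp mxL); rewrite add0r.
  by under eq_fun do rewrite subrK.
apply: (@ccvg_le _ _ _ (fun k => a k * b k * expR (b k) * expR (a k))).
  apply: nearW => k; rewrite subr0 cexpMn.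
  have M1 : 1 <= expR (b k) by rewrite -expR0 ler_expR normc_ge0.
  have h1 : nc (1 + x k) <= expR (b k).
    apply: le_trans (ler_normcD _ _) _; rewrite Normc.normc1.
    exact: expR_ge1Dx.
  apply: le_trans (normc_subX _ M1 h1 (normc_cexp_le _)) _.
  rewrite -expRM_natl /a Normc.normcM normc_nat -/(b k).
  rewrite ler_wpM2r ?expR_ge0//.
  have := cexp_taylor2 (x k); rewrite normcB -/(b k) => h.
  rewrite -!mulrA ler_wpM2l//.
  by apply: le_trans h _; rewrite expr2 mulrA.
have -> : 0 = nc L * 0 * expR 0 * expR (nc L) by rewrite mulr0 !mul0r.
apply: cvgM; last by apply: continuous_cvg => //; exact: continuous_expR.
apply: cvgM; first exact: cvgM.
by apply: continuous_cvg => //; exact: continuous_expR.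
Qed.

End PowerLimit.

Section CosineBounds.
Variable R : realType.

Lemma norm_sin_le (x : R) : 0 <= x -> `|sin x| <= x.
Proof.
move=> x0; have [c _] := MVT_segment x0 (fun t _ => is_derive_sin t)
  (continuous_subspaceT (@continuous_sin R)).
rewrite sin0 !subr0 => ->; rewrite normrM (ger0_norm x0).
by rewrite ler_piMl// cos_max.
Qed.

Lemma cos_ge (x : R) : 0 <= x -> 1 - x ^+ 2 / 2 <= cos x.
Proof.
move=> x0; have -> : cos x = 1 - 2 * sin (x / 2) ^+ 2.
  have {1}-> : x = (x / 2) *+ 2 by rewrite -mulr_natr mulfVK.
  by rewrite cos_mulr2n cos2sin2 mulr2n; ring.
have x2 : 0 <= x / 2 by rewrite divr_ge0.
have : sin (x / 2) ^+ 2 <= (x / 2) ^+ 2.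
  by rewrite -(real_normK (num_real (sin _))) lerXn2r ?nnegrE// norm_sin_le.
rewrite expr_div_n; lra.
Qed.

Lemma sin_ge (x : R) : 0 <= x -> x - x ^+ 3 / 6 <= sin x.
Proof.
move=> x0; pose f (t : R) := sin t + (- t + 6^-1 * t ^+ 3).
have fD (t : R) : is_derive t (1 : R) f (cos t - 1 + t ^+ 2 / 2).
  rewrite /f; apply: is_derive_eq; by rewrite /GRing.scale /=; field.
have [c] := MVT_segment x0 (fun t _ => fD t)
  (derivable_within_continuous (fun t _ => @ex_derive _ _ _ _ _ _ _ (fD t))).
rewrite in_itv /= => /andP[c0 cx].
rewrite /f sin0 oppr0 expr0n mulr0 !addr0 !subr0 => e.
have : 0 <= (cos c - 1 + c ^+ 2 / 2) * x.
  by apply: mulr_ge0 => //; have := cos_ge c0; lra.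
by rewrite -e; lra.
Qed.

(* As pi / 2 < 2, this leaves room for arguments beyond the half-period. *)
Lemma sin2_ge (x : R) : `|x| <= 2 -> x ^+ 2 / 9 <= sin x ^+ 2.
Proof.
have H (y : R) : 0 <= y -> y <= 2 -> y ^+ 2 / 9 <= sin y ^+ 2.
  move=> y0 y2; have h : y / 3 <= sin y.
    apply: le_trans (sin_ge y0).
    have : y * y ^+ 2 <= y * 4.
      by apply: ler_wpM2l => //; rewrite -[4]/(2 * 2)%:R natrM -expr2 lerXn2r ?nnegrE.
    by rewrite -exprS; lra.
  have -> : y ^+ 2 / 9 = (y / 3) ^+ 2 by field.
  by rewrite lerXn2r ?nnegrE ?divr_ge0// (le_trans _ h)// divr_ge0.
have [x0|x0] := leP 0 x; first by rewrite ger0_norm//; exact: H.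
rewrite ltr0_norm// => x2; rewrite -sqrrN -[in leRHS]sqrrN -sinN.
by apply: H => //; rewrite oppr_ge0 ltW.
Qed.

End CosineBounds.

(** * Estimates and limits for Polya's sums *)

Section Polya.
Variable R : realType.

Lemma expR_quadratic_decay1 (a b : R) : 0 < a -> exists2 C : R, 0 < C &
  forall j : int, expR (- a * `|j%:~R| ^+ 2 + b * `|j%:~R|) <= C * decay1 R j.
Proof.
move=> a0; have [C C0 H] := expR_gauss_bound b 2 a0.
(* From (2 + u)^(3/2) <= (2 + u)^2 <= 4 (1 + u)^2. *)
exists (4 * C); first by rewrite mulr_gt0.
move=> j; rewrite /decay1; set u : R := `|j%:~R|.
have u0 : 0 <= u := normr_ge0 _.
have u1' : 0 < 1 + u by rewrite ltr_wpDr.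
have u1 : 0 < (1 + u) ^+ 2 by rewrite exprn_gt0.
have u2 : 0 < 2 + u by rewrite ltr_wpDr.
have := H u u0; rewrite mulrC -ler_pdivlMr// => /le_trans; apply.
rewrite -mulrA mulrCA ler_pM2l// -[X in _ <= X * _]invrK -invfM.
rewrite lef_pV2 ?posrE ?mulr_gt0 ?invr_gt0 ?sqrtr_gt0//.
have : Num.sqrt (2 + u) <= 2 + u.
  rewrite -{2}[2 + u](sqr_sqrtr (ltW u2)) expr2 ler_peMr ?sqrtr_ge0//.
  by rewrite -[leLHS]sqrtr1 ler_wsqrtr//; lra.
move=> h; have : (2 + u) * Num.sqrt (2 + u) <= (2 + u) * (2 + u).
  by rewrite ler_pM2l.
rewrite expr2; nra.
Qed.

(** This is cos(pi t / l)^(2 m), for complex t. *)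
Definition cos2pow (l m : nat) (t : R[i]) : R[i] :=
  ((2 + ei (t / l%:R) + (ei (t / l%:R))^-1) / 4) ^+ m.

(** With z = x + i y the modulus equals (cosh x + 1) / 2 - sin(y / 2)^2. The hypothesis puts y / 2
    in the range of [sin2_ge], whence 36 = 4 * 9, and 1 + q <= e^q concludes. *)
Lemma normc_cos2 (z : R[i]) : `|complex.Im z| <= 4 ->
  nc ((2 + cexp z + (cexp z)^-1) / 4) <=
  expR (complex.Re z ^+ 2 * expR `|complex.Re z| / 2 - complex.Im z ^+ 2 / 36).
Proof.
move=> z4; set E := cexp (z / 2).
have EE : cexp z = E ^+ 2 by rewrite -cexpMn mulrC mulfVK.
have -> : (2 + cexp z + (cexp z)^-1) / 4 = ((E + E^-1) / 2) ^+ 2.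
  by rewrite EE; field; rewrite cexp_neq0.
rewrite normcX Normc.normcM Normc.normcV normc_nat.
have EV : E = cexp (z / 2) by [].
case: z z4 E EV {EE} => x y /= y4 E EV.
have zE : (x +i* y) / 2 = (x / 2) +i* (y / 2).
  rewrite -[2]/(2%:R) -(rmorph_nat (real_complex R)) -fmorphV /=.
  by simpc; congr (_ +i* _); ring.
have -> : (nc (E + E^-1) / 2) ^+ 2 =
    (expR x + expR (- x) + 2) / 4 - sin (y / 2) ^+ 2.
  rewrite expr_div_n EV -cexpN zE /cexp /= cosN sinN.
  rewrite sqr_sqrtr ?addr_ge0 ?sqr_ge0//.
  have e1 : expR x = expR (x / 2) ^+ 2 by rewrite -expRM_natl mulrC mulfVK.
  have e2 : expR (- x) = expR (- (x / 2)) ^+ 2.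
    by rewrite -expRM_natl mulrN mulrC mulfVK.
  have e3 : expR (- (x / 2)) * expR (x / 2) = 1.
    by rewrite mulrC expRxMexpNx_1.
  rewrite e1 e2; move: (expR _) (expR _) e3 (cos2Dsin2 (y / 2)) => u v.
  move: (cos _) (sin _) => c s vu cs.
  have e : c ^+ 2 = 1 - s ^+ 2 by rewrite -cs addrK.
  transitivity (((u ^+ 2 + v ^+ 2) * (c ^+ 2 + s ^+ 2)
    + 2 * (v * u) * (c ^+ 2 - s ^+ 2)) / 4); first by field.
  by rewrite cs vu e; field.
have s2 : y ^+ 2 / 36 <= sin (y / 2) ^+ 2.
  have : `|y / 2| <= 2 by rewrite normrM [X in _ * X]ger0_norm//; lra.
  by move=> /sin2_ge; rewrite expr_div_n; lra.
have ex : expR x + expR (- x) - 2 <= 2 * (x ^+ 2 * expR `|x|).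
  have h (w : R) : expR w - (1 + w) <= w ^+ 2 * expR `|w|.
    have := cexp_taylor2 w%:C; rewrite cexp_real -[1]/(1%:C) -!rmorphD -rmorphB.
    rewrite !normc_real real_normK ?num_real//.
    by apply: le_trans; exact: ler_norm.
  have := h x; have := h (- x); rewrite normrN sqrrN; lra.
apply: le_trans (expR_ge1Dx _); lra.
Qed.

End Polya.

Section PoissonGaussian.
Variable R : realType.

Let lp (p : nat) : nat := p.*2.+1.

Lemma inv_period_cvg : (lp p)%:R^-1 @[p --> \oo] --> (0 : R).
Proof.
apply: (squeeze_cvgr _ (cvg_cst (0 : R)) (@cvg_harmonic R)).
apply: nearW => p; rewrite invr_ge0 ler0n /= lef_pV2 ?posrE//.
by rewrite ler_nat ltnS -addnn leq_addr.
Qed.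

Variables (kappa : R).
Hypothesis kappa0 : 0 < kappa.

Let mp (p : nat) : nat := Num.trunc (kappa * (lp p)%:R ^+ 2).

Lemma exponent_le p : (mp p)%:R <= kappa * (lp p)%:R ^+ 2.
Proof.
by have /truncn_itv/andP[] : 0 <= kappa * (lp p)%:R ^+ 2
  by rewrite mulr_ge0 ?exprn_ge0// ltW.
Qed.

Lemma exponent_gt p : kappa * (lp p)%:R ^+ 2 < (mp p)%:R + 1.
Proof.
have /truncn_itv/andP[_] : 0 <= kappa * (lp p)%:R ^+ 2.
  by rewrite mulr_ge0 ?exprn_ge0// ltW.
by rewrite natr1.
Qed.

Lemma exponent_ratio_cvg : (mp p)%:R / (lp p)%:R ^+ 2 @[p --> \oo] --> kappa.
Proof.
have H : kappa - (lp p)%:R^-1 @[p --> \oo] --> kappa.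
  rewrite -[X in _ --> X]subr0; apply: cvgB; first exact: cvg_cst.
  exact: inv_period_cvg.
apply: (squeeze_cvgr _ H (cvg_cst kappa)); apply: nearW => p.
have l0 : 0 < (lp p)%:R ^+ 2 :> R by rewrite exprn_gt0.
apply/andP; split; last by rewrite ler_pdivrMr// exponent_le.
rewrite ler_pdivlMr// mulrBl expr2 [_^-1 * _]mulrA mulVf ?mul1r ?pnatr_eq0//.
have : (1 : R) <= (lp p)%:R by rewrite ler1n.
have := exponent_gt p; rewrite expr2; lra.
Qed.

Lemma exponent_cvg : mp p @[p --> \oo] --> \oo.
Proof.
apply/cvgnyPge => A.
have := inv_period_cvg => /cvgrPdist_lt /(_ (kappa / (A%:R + 1))).
move=> /(_ (divr_gt0 kappa0 _)) [|N _ HN]; first by rewrite ltr_wpDl.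
exists N => // p /= /HN /=; rewrite sub0r normrN ger0_norm//.
have l1 : (1 : R) <= (lp p)%:R by rewrite ler1n.
have l0 : (0 : R) < (lp p)%:R by [].
have A1 : 0 < A%:R + 1 :> R by rewrite ltr_wpDl.
rewrite -[_ / _]invrK ltf_pV2 ?posrE ?invr_gt0 ?divr_gt0//.
rewrite invf_div ltr_pdivrMr// => h.
have h2 : (A%:R + 1 : R) <= kappa * (lp p)%:R ^+ 2.
  apply: le_trans (ltW h) _; rewrite mulrC ler_pM2l// expr2.
  by rewrite ler_peMl.
have := exponent_gt p; rewrite -(ler_nat R); lra.
Qed.

(** With q = 2 pi i t, the first-order terms at q / l and - q / l cancel, so l^2 (cos(pi t / l)^2 -
    1) tends to q^2 / 4 = - pi^2 t^2 with error O(1 / l). Then [ccvg_pow] applies, since m / l^2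
    tends to kappa. *)
Lemma cos2pow_cvg (t : R[i]) :
  ccvg (fun p => cos2pow (lp p) (mp p) t) (cexp (- (pi ^+ 2 * kappa)%:C * t ^+ 2)).
Proof.
pose x p : R[i] := (2 + ei (t / (lp p)%:R) + (ei (t / (lp p)%:R))^-1) / 4 - 1.
have -> : (fun p => cos2pow (lp p) (mp p) t) = (fun p => (1 + x p) ^+ mp p).
  by apply/funext => p; rewrite /cos2pow /x [1 + _]addrC subrK.
pose q : R[i] := (0 +i* (2 * pi)) * t.
have lx : ccvg (fun p => (lp p)%:R ^+ 2 * x p) (q ^+ 2 / 4).
  apply: (@ccvg_le _ _ _ (fun p => nc q ^+ 3 * expR (nc q) * (lp p)%:R^-1)).
    apply: nearW => p; set l : R[i] := (lp p)%:R.
    have l0 : l != 0 by rewrite pnatr_eq0.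
    have nl : nc l = (lp p)%:R by rewrite normc_nat.
    have l1 : (1 : R) <= (lp p)%:R by rewrite ler1n.
    pose z := q / l.
    have zE : (0 +i* (2 * pi)) * (t / l) = z by rewrite /z mulrA.
    have nz : nc z <= nc q.
      rewrite /z Normc.normcM Normc.normcV nl ler_pdivrMr ?ltr0n//.
      by rewrite ler_peMr ?normc_ge0.
    have h1 := cexp_taylor3 z; have := cexp_taylor3 (- z).
    rewrite normcN sqrrN => h2.
    have -> : l ^+ 2 * x p - q ^+ 2 / 4 = l ^+ 2 / 4 *
        ((cexp z - (1 + z + z ^+ 2 / 2)) + (cexp (- z) - (1 + - z + z ^+ 2 / 2))).
      rewrite /x /ei zE -cexpN.
      have -> : q ^+ 2 = l ^+ 2 * z ^+ 2 by rewrite -exprMn /z mulrC divfK.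
      by field.
    rewrite Normc.normcM Normc.normcM Normc.normcV normcX nl normc_nat.
    apply: le_trans (_ : (lp p)%:R ^+ 2 / 4 * (2 * (nc z ^+ 3 * expR (nc q))) <= _).
      rewrite ler_wpM2l ?divr_ge0 ?exprn_ge0//.
      apply: le_trans (ler_normcD _ _) _.
      have : expR (nc z) <= expR (nc q) by rewrite ler_expR.
      move=> /(ler_wpM2l (exprn_ge0 3 (normc_ge0 z))); lra.
    have -> : nc z = nc q / (lp p)%:R.
      by rewrite /z Normc.normcM Normc.normcV nl.
    rewrite [leLHS](_ : _ = nc q ^+ 3 * expR (nc q) * (lp p)%:R^-1 / 2); last first.
      by field; rewrite pnatr_eq0.
    rewrite ler_pdivrMr// ler_peMr//; last by lra.
    by rewrite !mulr_ge0 ?expR_ge0 ?exprn_ge0 ?normc_ge0.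
  rewrite -[X in _ --> X](mulr0 (nc q ^+ 3 * expR (nc q))).
  by apply: cvgM; [exact: cvg_cst|exact: inv_period_cvg].
have il : ccvg (fun p => ((lp p)%:R^-1 : R)%:C ^+ 2) 0.
  by have := ccvgX 2 (ccvg_real inv_period_cvg); rewrite expr0n.
have lC p : ((lp p)%:R : R)%:C = (lp p)%:R :> R[i] by rewrite rmorph_nat.
apply: ccvg_pow.
  have -> : - (pi ^+ 2 * kappa)%:C * t ^+ 2 = kappa%:C * (q ^+ 2 / 4).
    rewrite /q exprMn.
    have -> : (0 +i* (2 * pi) : R[i]) ^+ 2 = - (4 * pi ^+ 2)%:C.
      apply/eqP; rewrite expr2 eq_complex /=.
      by apply/andP; split; apply/eqP; ring.
    by rewrite !rmorphM /= rmorph_nat; field.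
  have := ccvgM (ccvg_real exponent_ratio_cvg) lx; congr ccvg.
  apply/funext => p; rewrite rmorphM rmorph_nat fmorphV rmorphXn /= lC.
  by field; rewrite pnatr_eq0.
have := ccvgM il lx; rewrite mul0r; congr ccvg; apply/funext => p.
by rewrite fmorphV /= lC; field; rewrite pnatr_eq0.
Qed.

(** At distance k l from the centre the lower and upper bounds have exponents (k l)^2 / (m - k l)
    and (k l)^2 / (m + k l); dividing through by l^2 shows that both tend to k^2 / kappa. *)
Lemma cbin_ratio_cvg (k : nat) :
  cbin_ratio R (mp p) (k * lp p) @[p --> \oo] --> expR (- (k%:R ^+ 2 / kappa)).
Proof.
have kl : k%:R / (lp p)%:R @[p --> \oo] --> (0 : R).
  rewrite -[X in _ --> X](mulr0 (k%:R : R)).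
  by apply: cvgM; [exact: cvg_cst|exact: inv_period_cvg].
have E (c : nat -> R) : c p @[p --> \oo] --> kappa ->
    expR (- (k%:R ^+ 2 / c p)) @[p --> \oo] --> expR (- (k%:R ^+ 2 / kappa)).
  move=> ck; apply: continuous_cvg; first exact: continuous_expR.
  apply: cvgN; apply: cvgM; first exact: cvg_cst.
  by apply: cvgV => //; rewrite gt_eqF.
have c1 : (mp p)%:R / (lp p)%:R ^+ 2 - k%:R / (lp p)%:R @[p --> \oo] --> kappa.
  by rewrite -[X in _ --> X]subr0; apply: cvgB => //; exact: exponent_ratio_cvg.
have c2 : (mp p)%:R / (lp p)%:R ^+ 2 + k%:R / (lp p)%:R @[p --> \oo] --> kappa.
  by rewrite -[X in _ --> X]addr0; apply: cvgD => //; exact: exponent_ratio_cvg.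
apply: (squeeze_cvgr _ (E _ c1) (E _ c2)).
have [N _ HN] := (cvgrPdist_lt _ _).1 c1 kappa kappa0.
exists N => // p /= /HN /=; set l := lp p; set m := mp p => h.
have l0 : 0 < l%:R :> R by rewrite ltr0n.
have km : (k * l < m)%N.
  have : 0 < m%:R / l%:R ^+ 2 - k%:R / l%:R :> R.
    by move: h; rewrite ltr_distl => /andP[_]; lra.
  have -> : m%:R / l%:R ^+ 2 - k%:R / l%:R = (m%:R - (k * l)%:R) / l%:R ^+ 2 :> R.
    by rewrite natrM; field; rewrite gt_eqF.
  by rewrite pmulr_lgt0 ?invr_gt0 ?exprn_gt0// subr_gt0 ltr_nat.
have d1 : k%:R ^+ 2 / (m%:R / l%:R ^+ 2 - k%:R / l%:R)
    = (k * l)%:R ^+ 2 / (m - k * l)%:R :> R.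
  rewrite (natrB _ (ltnW km)) natrM.
  have : m%:R - k%:R * l%:R != 0 :> R by rewrite -natrM subr_eq0 gt_eqF// ltr_nat.
  by move=> h0; field; rewrite h0 gt_eqF.
have d2 : k%:R ^+ 2 / (m%:R / l%:R ^+ 2 + k%:R / l%:R)
    = (k * l)%:R ^+ 2 / (m + k * l)%:R :> R.
  rewrite natrD natrM.
  have : m%:R + k%:R * l%:R != 0 :> R.
    by rewrite gt_eqF// ltr_wpDr ?mulr_ge0// ltr0n; lia.
  by move=> h0; field; rewrite h0 gt_eqF.
by rewrite d1 d2 cbin_ratio_ge// cbin_ratio_le// ltnW.
Qed.

End PoissonGaussian.

Section PoissonGaussianSum.
Variable R : realType.

Let lp (p : nat) : nat := p.*2.+1.

Variable kappa : R.
Hypothesis kappa0 : 0 < kappa.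

Let mp (p : nat) : nat := Num.trunc (kappa * (lp p)%:R ^+ 2).

(** For |j| <= p the number y = 2 pi (j + Re s) / l exceeds pi in modulus by at most O(1 / l), so it
    stays below 4 for large p and [normc_cos2] applies. Im s contributes a bounded factor only. *)
Lemma normc_cos2pow_le (s : R[i]) : exists2 C : R, 0 < C &
  exists K, forall p (j : int), (K <= p)%N -> (`|j| <= p)%N ->
    nc (cos2pow (lp p) (mp p) (j%:~R + s)) <= C * decay1 R j.
Proof.
case: s => sg om.
(* For large p, m / l^2 >= kappa / 2, while m y^2 / 36 = (m / l^2) (pi^2 / 9) (j + sg)^2. *)
pose al : R := kappa * pi ^+ 2 / 18.
have al0 : 0 < al by rewrite divr_gt0// mulr_gt0// exprn_gt0// pi_gt0.
have [C C0 HC] := expR_quadratic_decay1 (2 * al * `|sg|) al0.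
pose D : R := kappa * (2 * pi * om) ^+ 2 * expR `|2 * pi * om| / 2.
exists (expR D * C); first by rewrite mulr_gt0 ?expR_gt0.
have [K1 _ HK1] := (cvgrPdist_lt _ _).1 (exponent_ratio_cvg kappa0) _ (divr_gt0 kappa0 (ltr0Sn R 1)).
have pi4 : 0 < (4 - pi : R) by have := @pihalf_lt2 R; lra.
(* This threshold gives 2 pi |sg| <= (4 - pi) l, so that 2 pi (p + |sg|) <= pi l + (4 - pi) l = 4
   l. *)
have [K2 _ HK2] := (cvgrPdist_lt _ _).1 (@inv_period_cvg R) ((4 - pi) / (2 * pi * `|sg| + 1))
  (divr_gt0 pi4 (ltr_wpDl (mulr_ge0 (mulr_ge0 (ler0n R 2) (pi_ge0 R)) (normr_ge0 sg)) ltr01)).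
exists (maxn K1 K2) => p j; rewrite geq_max => /andP[/HK1 h1 /HK2 h2] jp.
have l0 : 0 < (lp p)%:R :> R by [].
have l1 : (1 : R) <= (lp p)%:R by rewrite ler1n.
pose x : R := - (2 * pi * om) / (lp p)%:R.
pose y : R := 2 * pi * (j%:~R + sg) / (lp p)%:R.
have zE : (0 +i* (2 * pi)) * ((j%:~R + (sg +i* om)) / (lp p)%:R) = x +i* y.
  rewrite -(rmorph_int (real_complex R)) -(rmorph_nat (real_complex R)) -fmorphV /=.
  by simpc; rewrite /x /y; congr (_ +i* _); ring.
have y4 : `|y| <= 4.
  have jR : `|j%:~R| <= p%:R :> R by rewrite -intr_norm -natr_absz ler_nat.
  have h3 : `|j%:~R + sg| <= p%:R + `|sg|.
    by apply: le_trans (ler_normD _ _) _; rewrite lerD2r.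
  rewrite /y normrM [ `|_^-1| ]ger0_norm ?invr_ge0// normrM.
  rewrite [ `|2 * pi| ]ger0_norm ?mulr_ge0 ?pi_ge0// ler_pdivrMr//.
  apply: le_trans (_ : 2 * pi * (p%:R + `|sg|) <= _).
    by rewrite ler_wpM2l// mulr_ge0// pi_ge0.
  move: h2; rewrite /= sub0r normrN ger0_norm ?invr_ge0//.
  have d0 : 0 < 2 * pi * `|sg| + 1 :> R.
    by rewrite ltr_wpDl// mulr_ge0// mulr_ge0// pi_ge0.
  rewrite ltr_pdivlMr// mulrC ltr_pdivrMr// => h4.
  have -> : (lp p)%:R = 2 * p%:R + 1 :> R by rewrite /lp -natr1 -mul2n natrM.
  have lE : (lp p)%:R = 2 * p%:R + 1 :> R by rewrite /lp -natr1 -mul2n natrM.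
  rewrite lE in h4; have p0 : 0 <= p%:R :> R by [].
  have := @pi_gt0 R; nra.
rewrite /cos2pow /ei zE normcX.
have := @normc_cos2 R (x +i* y) y4; rewrite /= => h3.
apply: le_trans (_ : expR (x ^+ 2 * expR `|x| / 2 - y ^+ 2 / 36) ^+ mp p <= _).
  by rewrite lerXn2r ?nnegrE ?expR_ge0 ?normc_ge0.
rewrite -expRM_natl -[leRHS]mulrA; apply: (le_trans _ (ler_wpM2l (expR_ge0 _) (HC j))).
rewrite -expRD ler_expR.
have m0 : 0 <= (mp p)%:R :> R by [].
set a : R := (mp p)%:R / (lp p)%:R ^+ 2.
have ma : (mp p)%:R = a * (lp p)%:R ^+ 2 by rewrite /a divfK// expf_neq0// gt_eqF.
have a1 : a <= kappa by rewrite ler_pdivrMr ?exprn_gt0//; exact: exponent_le.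
have a2 : kappa / 2 <= a.
  by move: h1; rewrite /= -/a ltr_distl => /andP[_]; lra.
have e1 : (mp p)%:R * (x ^+ 2 * expR `|x| / 2) <= D.
  have -> : (mp p)%:R * (x ^+ 2 * expR `|x| / 2)
      = a * (2 * pi * om) ^+ 2 * expR `|x| / 2.
    by rewrite ma /x; field; rewrite gt_eqF.
  have a0 : 0 <= a by rewrite divr_ge0// exprn_ge0.
  rewrite /D ler_pM2r//; apply: ler_pM.
  - exact: mulr_ge0 a0 (sqr_ge0 _).
  - exact: expR_ge0.
  - by rewrite ler_wpM2r ?sqr_ge0.
  rewrite ler_expR /x normrM normrN [ `|_^-1| ]ger0_norm ?invr_ge0//.
  by rewrite ler_pdivrMr// ler_peMr.
have e2 : al * (j%:~R + sg) ^+ 2 <= (mp p)%:R * (y ^+ 2 / 36).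
  have -> : (mp p)%:R * (y ^+ 2 / 36) = a * (pi ^+ 2 / 9 * (j%:~R + sg) ^+ 2).
    by rewrite ma /y; field; rewrite gt_eqF.
  have -> : al * (j%:~R + sg) ^+ 2 = kappa / 2 * (pi ^+ 2 / 9 * (j%:~R + sg) ^+ 2).
    by rewrite /al; field.
  by rewrite ler_wpM2r// mulr_ge0 ?sqr_ge0// divr_ge0 ?sqr_ge0.
rewrite mulrBr; apply: le_trans (lerB e1 e2) _.
rewrite lerD2l sqrrD -[X in - (al * (X + _ + _))]real_normK ?num_real//.
have : - (j%:~R * sg) <= `|j%:~R| * `|sg|.
  by rewrite -normrM -normrN ler_norm.
move=> /(ler_wpM2l (ltW al0)).
have : 0 <= al * sg ^+ 2 by rewrite mulr_ge0 ?sqr_ge0 ?ltW.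
rewrite -[_ *+ 2]mulr_natr; move: (_ ^+ 2) (sg ^+ 2) => u v; lra.
Qed.

(** The ratio is 0 when |r| l > m. Otherwise m + |r| l <= 2 m <= 2 kappa l^2, which bounds it by
    e^(- r^2 / (2 kappa)) for every p; the character grows at most like e^(2 pi |r Im s|). *)
Lemma cbin_ratio_char_le (s : R[i]) : exists2 C : R, 0 < C &
  forall p (r : int),
    nc ((cbin_ratio R (mp p) (`|r| * lp p))%:C * ei (r%:~R * s)) <= C * decay1 R r.
Proof.
case: s => sg om.
have al0 : 0 < (2 * kappa)^-1 by rewrite invr_gt0 mulr_gt0.
have [C C0 HC] := expR_quadratic_decay1 (2 * pi * `|om|) al0.
exists C => // p r; apply: (le_trans _ (HC r)).
rewrite Normc.normcM normc_real ger0_norm ?cbin_ratio_ge0// normc_ei expRD.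
apply: ler_pM; rewrite ?cbin_ratio_ge0 ?expR_ge0//; last first.
  rewrite ler_expR -(rmorph_int (real_complex R)) /= mul0r addr0 -mulrN -mulrA.
  rewrite mulrA -[leRHS]mulrA ler_wpM2l ?mulr_ge0 ?pi_ge0// -normrM mulrC -normrN.
  by rewrite [om * _]mulrC ler_norm.
have [h|h] := ltnP (mp p) (`|r| * lp p); first by rewrite cbin_ratio_gt ?expR_ge0.
apply: le_trans (cbin_ratio_le _ h) _; rewrite ler_expR mulNr lerN2.
have [->|r0] := eqVneq r 0; first by rewrite mulr0z normr0 expr0n mulr0 divr_ge0 ?sqr_ge0.
have rl : 0 < (`|r| * lp p)%:R :> R by rewrite ltr0n muln_gt0 absz_gt0 r0.
have m0 : 0 < (mp p)%:R :> R by apply: lt_le_trans rl _; rewrite ler_nat.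
apply: le_trans (_ : (`|r| * lp p)%:R ^+ 2 / (2 * (mp p)%:R) <= _); last first.
  rewrite ler_wpM2l ?sqr_ge0// lef_pV2 ?posrE ?mulr_gt0//; last first.
    by rewrite natrD ltr_wpDl.
  by rewrite natrD mulr_natl mulr2n lerD2l ler_nat.
rewrite ler_pdivlMr ?mulr_gt0// mulrC natrM exprMn natr_absz -intr_norm.
rewrite mulrCA mulrA -mulrA ler_pdivrMl ?mulr_gt0//.
have : (mp p)%:R <= kappa * (lp p)%:R ^+ 2 := exponent_le kappa0 p.
move=> /(ler_wpM2l (sqr_ge0 (`|r|%:~R : R))); lra.
Qed.

Lemma has_sum_cos2pow (s : R[i]) p :
  has_sum (fun j : int => if (`|j| <= p)%N
     then cos2pow (lp p) (mp p) (j%:~R + s) else 0)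
    (\sum_(i < lp p) cos2pow (lp p) (mp p) (i%:R - p%:R + s)).
Proof.
apply: (@has_sum_extend R nat int (fun i : nat => i%:Z - p%:Z)
  (fun j : int => absz (j + p%:Z)%R)).
- by move=> i; rewrite subrK absz_nat.
- move=> j jp; case: ifP => // jp'; move: jp.
  by rewrite gez0_abs ?addrK ?eqxx//; lia.
have -> : \sum_(i < lp p) cos2pow (lp p) (mp p) (i%:R - p%:R + s) =
    \sum_(k <- [fset k in iota 0 (lp p)]%fset)
     (if (absz (k%:Z - p%:Z)%R <= p)%N
      then cos2pow (lp p) (mp p) ((k%:Z - p%:Z)%:~R + s) else 0).
  rewrite (perm_big (iota 0 (lp p))); last first.
    by apply: uniq_perm => [||i]; [exact: fset_uniq|exact: iota_uniq|rewrite !inE].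
  have -> : iota 0 (lp p) = index_iota 0 (lp p) by rewrite /index_iota subn0.
  rewrite big_mkord; apply: eq_bigr => -[k /= kl] _.
  rewrite ifT; last by move: kl; rewrite /lp -addnn; lia.
  by rewrite rmorphB.
apply: has_sum_finite => k; rewrite !inE mem_iota => kp /=.
by rewrite ifF//; move: kp; rewrite /lp -addnn; lia.
Qed.

Lemma has_sum_cbin_ratio (s : R[i]) p :
  has_sum (fun r : int => (cbin_ratio R (mp p) (`|r| * lp p))%:C * ei (r%:~R * s))
    (((lp p)%:R * cbin R (mp p))^-1%:C *
     \sum_(i < lp p) cos2pow (lp p) (mp p) (i%:R - p%:R + s)).
Proof.
set m := mp p; set l := lp p.
have lC : (l%:R : R[i]) != 0 by rewrite pnatr_eq0.
have bC : ('C(m.*2, m)%:R : R[i]) != 0.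
  by rewrite pnatr_eq0 -lt0n bin_gt0 -addnn leq_addr.
have C4 : ((4 : R[i]) ^+ m) != 0 by rewrite expf_neq0.
have := has_sumZ ((l%:R * 'C(m.*2, m)%:R)^-1) (has_sum_binomial_period m p s).
rewrite -[p.*2.+1]/l; congr has_sum.
  apply/funext => r; rewrite /cbin_ratio rmorphM fmorphV !rmorph_nat.
  by field; rewrite bC lC.
rewrite /cbin /cos2pow; under [in RHS]eq_bigr do rewrite expr_div_n.
rewrite -mulr_suml fmorphV !rmorphM fmorphV rmorphXn !rmorph_nat /=.
by field; rewrite bC lC C4.
Qed.

End PoissonGaussianSum.

(** The sums [S p] over one period have two limits: termwise they tend to [S1], and the discrete
    Poisson formula shows that their quotients by l cbin(m) tend to [S2], where l cbin(m) = sqrt(m)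
    cbin(m) / sqrt(m / l^2) tends to C0 / sqrt(kappa). [C0] is chosen before kappa and s, so that it
    cancels between two instances. *)
Theorem poisson_gaussian (R : realType) : exists2 C0 : R, 0 < C0 &
  forall (kappa : R) (s S1 S2 : R[i]), 0 < kappa ->
  has_sum (fun j : int => cexp (- (pi ^+ 2 * kappa)%:C * (j%:~R + s) ^+ 2)) S1 ->
  has_sum (fun r : int =>
    (expR (- (`|r|%:R ^+ 2 / kappa)))%:C * ei (r%:~R * s)) S2 ->
  S1 = (C0 / Num.sqrt kappa)%:C * S2.
Proof.
have [C0 C00 HC0] := cbin_sqrt_cvg R; exists C0 => // kappa s S1 S2 k0 H1 H2.
pose lp p : nat := p.*2.+1.
pose mp p : nat := Num.trunc (kappa * (lp p)%:R ^+ 2).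
pose S p := \sum_(i < lp p) cos2pow (lp p) (mp p) (i%:R - p%:R + s).
have SS1 : ccvg S S1.
  have [C C1 [K HK]] := normc_cos2pow_le k0 s.
  apply: (has_sum_tannery (bounded_sumsZ (ltW C1) (bounded_sums_decay1 R)) _ _
    (has_sum_cos2pow k0 s) H1).
    exists K => p j Kp; case: ifP => jp; first exact: HK.
    rewrite Normc.normc0 mulr_ge0 ?(ltW C1)//.
    by have [-> _] := bounded_sums_decay1 R.
  move=> j; apply: ccvg_near (cos2pow_cvg k0 (j%:~R + s)).
  by exists `|j|%N => // p /= ->.
have SS2 : ccvg (fun p => ((lp p)%:R * cbin R (mp p))^-1%:C * S p) S2.
  have [C C1 HC] := cbin_ratio_char_le k0 s.
  apply: (has_sum_tannery (bounded_sumsZ (ltW C1) (bounded_sums_decay1 R)) _ _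
    (has_sum_cbin_ratio kappa s) H2); first by exists 0%N => p r _; exact: HC.
  move=> r; apply: ccvgM; last exact: ccvg_cst.
  exact: (ccvg_real (cbin_ratio_cvg k0 (k := absz r))).
have lim : (lp p)%:R * cbin R (mp p) @[p --> \oo] --> C0 / Num.sqrt kappa.
  have c1 : Num.sqrt (mp p)%:R * cbin R (mp p) @[p --> \oo] --> C0.
    exact: cvg_comp (exponent_cvg k0) HC0.
  have c2 : (Num.sqrt ((mp p)%:R / (lp p)%:R ^+ 2))^-1 @[p --> \oo]
      --> (Num.sqrt kappa)^-1.
    apply: cvgV; first by rewrite sqrtr_eq0 -ltNge.
    by apply: continuous_cvg; [exact: sqrt_continuous|exact: exponent_ratio_cvg].
  apply: cvg_trans (cvgM c1 c2); apply: near_eq_cvg.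
  have /cvgnyPge/(_ 1%N) [N _ HN] := exponent_cvg k0.
  exists N => // p /= /HN /= m1.
  have m0 : 0 < (mp p)%:R :> R by rewrite ltr0n.
  have l0 : 0 < (lp p)%:R :> R by [].
  rewrite sqrtrM ?ler0n// sqrtrV ?sqr_ge0// sqrtr_sqr ger0_norm ?ler0n//.
  by field; rewrite !gt_eqF ?sqrtr_gt0.
apply: ccvg_uniq SS1 _.
have := ccvgM (ccvg_real lim) SS2; congr ccvg; apply/funext => p.
rewrite mulrA -rmorphM divff ?rmorph1 ?mul1r//.
by rewrite mulf_neq0 ?pnatr_eq0// gt_eqF ?cbin_gt0.
Qed.

(** * Theta functions of a lattice *)

Section RowPoisson.
Variable R : realType.

(** A Gaussian on the plane restricts to a row as a one-dimensional Gaussian times a factor [E m]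
    left by completing the square. This factor is divided out to apply the formula, and Fubini
    reassembles the rows on both sides. *)
Lemma poisson_gaussian_rows : exists2 C0 : R, 0 < C0 &
  forall (kappa : R) (E s : int -> R[i]) (F G : R[i]), 0 < kappa ->
  (forall m, E m != 0) ->
  let f (p : int * int) :=
    E p.1 * cexp (- (pi ^+ 2 * kappa)%:C * (p.2%:~R + s p.1) ^+ 2) in
  let g (p : int * int) :=
    E p.1 * ((expR (- (`|p.2|%:R ^+ 2 / kappa)))%:C * ei (p.2%:~R * s p.1)) in
  abs_summable f -> abs_summable g -> has_sum f F -> has_sum g G ->
  F = (C0 / Num.sqrt kappa)%:C * G.
Proof.
have [C0 C00 H] := poisson_gaussian R; exists C0 => // kappa E s F G k0 E0 f g.
move=> fs gs fF gG.
have rows (h : int * int -> R[i]) : abs_summable h ->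
    exists r, forall m, has_sum (fun n => h (m, n)) (r m).
  move=> hs; have row m := abs_summable_has_sum (abs_summable_row m hs).
  by have [r Hr] := choice row; exists r.
have [rf Hf] := rows _ fs; have [rg Hg] := rows _ gs.
have FF := has_sum_fubini fF Hf; have GG := has_sum_fubini gG Hg.
have e m : rf m = (C0 / Num.sqrt kappa)%:C * rg m.
  have div (u : int -> R[i]) v : has_sum (fun n => E m * u n) v ->
      has_sum u (v / E m).
    move=> /(has_sumZ (E m)^-1); rewrite mulrC; congr has_sum.
    by apply/funext => n; rewrite mulrA mulVf ?mul1r.
  have := H kappa (s m) _ _ k0 (div _ _ (Hf m)) (div _ _ (Hg m)).
  by rewrite mulrA => /(divIf (E0 m)).
apply: has_sum_uniq FF _.
have := has_sumZ (C0 / Num.sqrt kappa)%:C GG; congr has_sum.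
by apply/funext => m; rewrite e.
Qed.

End RowPoisson.

Section LatticeGaussians.
Variables (R : realType) (tau : R[i]).
Hypothesis tau_gt0 : 0 < complex.Im tau.
Local Notation w := (latpt tau).
Local Notation c := (pi / complex.Im tau).

Lemma gauss_le (a b : R) k : 0 < a -> exists2 C : R, 0 < C & forall u, 0 <= u ->
  (1 + u) ^+ k * expR (- a * u ^+ 2 + b * u) <= C * ((1 + u) ^+ 3)^-1.
Proof.
move=> a0; have [C C0 H] := expR_gauss_bound b (k + 3) a0.
exists C => // u u0; rewrite ler_pdivlMr ?exprn_gt0 ?ltr_wpDr//.
by rewrite mulrAC -exprD; exact: H.
Qed.

Lemma abs_summable_latpt (f : int * int -> R[i]) (C : R) : 0 <= C ->
  (forall p, nc (f p) <= C * ((1 + nc (w p)) ^+ 3)^-1) -> abs_summable f.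
Proof.
move=> C0 H; apply: bounded_sums_le (bounded_sumsZ C0 (bounded_sums_latpt tau_gt0)).
by move=> p; rewrite normc_ge0 H.
Qed.

Lemma abs_summable_gauss (f : int * int -> R[i]) (a b : R) k K : 0 < a -> 0 <= K ->
  (forall p, nc (f p) <= K * ((1 + nc (w p)) ^+ k *
     expR (- a * nc (w p) ^+ 2 + b * nc (w p)))) -> abs_summable f.
Proof.
move=> a0 K0 H; have [C C0 HC] := gauss_le b k a0.
apply: (abs_summable_latpt (C := K * C)); first by rewrite mulr_ge0// ltW.
move=> p; apply: le_trans (H p) _; rewrite -mulrA ler_wpM2l//.
by apply: HC; exact: normc_ge0.
Qed.

Lemma latptE p : w p =
  (p.2%:~R + p.1%:~R * (complex.Re tau)%:C) + 'i%C * (p.1%:~R * (complex.Im tau)%:C).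
Proof.
by rewrite /latpt {1}(complexE tau); ring.
Qed.

Lemma conj_latpt p : conjc (w p) =
  (p.2%:~R + p.1%:~R * (complex.Re tau)%:C) - 'i%C * (p.1%:~R * (complex.Im tau)%:C).
Proof.
have -> (z : R[i]) : conjc z = (complex.Re z)%:C - 'i%C * (complex.Im z)%:C.
  by case: z => a b; simpc.
rewrite Re_latpt Im_latpt !(rmorphD, rmorphM, rmorph_int) /=.
by rewrite [_ * _%:C + _]addrC.
Qed.

Lemma sqr_normc_latpt p : (nc (w p) ^+ 2)%:C =
  (p.2%:~R + p.1%:~R * (complex.Re tau)%:C) ^+ 2
  + (p.1%:~R * (complex.Im tau)%:C) ^+ 2.
Proof.
rewrite -sqr_normc_conj conj_latpt latptE mulrC -subr_sqr [('i%C * _) ^+ 2]exprMn.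
by rewrite sqr_i mulN1r opprK.
Qed.

(** The factor e^(z conj(w)) makes the sum a generating function in z of the moments sum_w conj(w)^j
    e^(- a |w|^2). *)
Definition theta_term (a : R) (z : R[i]) (p : int * int) : R[i] :=
  cexp (- (a * nc (w p) ^+ 2)%:C + z * conjc (w p)).

Lemma normc_theta_term_le a z p :
  nc (theta_term a z p) <= expR (- a * nc (w p) ^+ 2 + nc z * nc (w p)).
Proof.
rewrite normc_cexp ler_expR raddfD /= mulNr lerD2l.
apply: le_trans (ler_norm _) _; apply: le_trans (normc_Re _) _.
by rewrite Normc.normcM normc_conj.
Qed.

Lemma abs_summable_theta_term a z : 0 < a -> abs_summable (theta_term a z).
Proof.
move=> a0; apply: (@abs_summable_gauss _ a (nc z) 0 1) => // p.
by rewrite expr0 !mul1r normc_theta_term_le.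
Qed.

End LatticeGaussians.

Section ThetaInversion.
Variables (R : realType) (tau : R[i]).
Hypothesis tau_gt0 : 0 < complex.Im tau.
Local Notation c := (pi / complex.Im tau).

Lemma twopi_i : (0 +i* (2 * pi) : R[i]) = 2 * pi%:C * 'i%C.
Proof.
rewrite -[2]/(2%:R) -(rmorph_nat (real_complex R)) -rmorphM.
by simpc.
Qed.

(** Poisson summation along the rows turns both sides into one double series. With y = Im tau, the
    left side becomes Gaussian with weights pi t y on m and pi y / t on the dual variable k; on the
    right the weights are exchanged, and (m, k) |-> (- k, - m) matches the terms. *)
Theorem theta_inversion (t : R) (z SA SB : R[i]) : 0 < t ->
  has_sum (theta_term tau (c * t) ((c * t)%:C * z)) SA ->
  has_sum (theta_term tau (c / t) (- (c%:C * z))) SB ->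
  SA = (t^-1)%:C * SB.
Proof.
move=> t0 hA hB; have [C0 C00 H] := poisson_gaussian_rows R.
pose y := complex.Im tau; pose x := complex.Re tau.
have y0 : 0 < y := tau_gt0.
have p0 := @pi_gt0 R.
have [Y YE] : exists Y, Y = y%:C by exists y%:C.
have [X XE] : exists X, X = x%:C by exists x%:C.
have [T TE] : exists T, T = t%:C by exists t%:C.
have [P PE] : exists P, P = (pi : R)%:C by exists (pi : R)%:C.
have real_neq0 (a : R) : 0 < a -> a%:C != 0.
  by rewrite -(rmorph0 (real_complex R)) (inj_eq (@complexI R)) => /gt_eqF->.
have yC : Y != 0 by rewrite YE; exact: real_neq0.
have tC : T != 0 by rewrite TE; exact: real_neq0.
have pC : P != 0 by rewrite PE; exact: real_neq0.
(* The coefficients of n^2 are c t = pi^2 k1 and c / t = pi^2 k2; [E1], [E2], [s1], [s2] come from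
   completing the square in n. *)
pose k1 : R := t / (pi * y); pose k2 : R := (pi * (t * y))^-1.
have k10 : 0 < k1 by rewrite divr_gt0// mulr_gt0.
have k20 : 0 < k2 by rewrite invr_gt0 !mulr_gt0.
pose E1 (m : int) := cexp (P / Y * T * z ^+ 2 / 4 - P * T * Y * m%:~R ^+ 2
   - 'i%C * P * T * z * m%:~R).
pose E2 (m : int) := cexp (P / Y * T * z ^+ 2 / 4 - P / T * Y * m%:~R ^+ 2
   + 'i%C * P * z * m%:~R).
pose s1 (m : int) : R[i] := m%:~R * X - z / 2.
pose s2 (m : int) : R[i] := m%:~R * X + T * z / 2.
have sqN (k : int) : ((`|k|%:R : R) ^+ 2)%:C = k%:~R ^+ 2 :> R[i].
  by rewrite natr_absz intr_norm real_normK ?num_real// rmorphXn rmorph_int.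
have ek (k : int) (a : R) : (expR (- (`|k|%:R ^+ 2 / a)))%:C
    = cexp (- (k%:~R ^+ 2 / a%:C)).
  by rewrite -cexp_real rmorphN rmorphM /= sqN fmorphV.
have k1E : k1%:C = T / (P * Y) by rewrite fmorph_div rmorphM TE PE YE.
have k2E : k2%:C = (P * (T * Y))^-1 by rewrite fmorphV !rmorphM TE PE YE.
pose D (p : int * int) := E1 p.1 *
  ((expR (- (`|p.2|%:R ^+ 2 / k1)))%:C * ei (p.2%:~R * s1 p.1)).
pose D' (p : int * int) := E2 p.1 *
  ((expR (- (`|p.2|%:R ^+ 2 / k2)))%:C * ei (p.2%:~R * s2 p.1)).
have DD' p : D' p = D (- p.2, - p.1).
  case: p => m n; rewrite /D /D' !ek /ei -!cexpD; congr cexp.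
  rewrite k1E k2E /s1 /s2 twopi_i -PE !rmorphN /=.
  by field; rewrite pC tC yC.
have hAE p : theta_term tau (c * t) ((c * t)%:C * z) p =
    E1 p.1 * cexp (- (pi ^+ 2 * k1)%:C * (p.2%:~R + s1 p.1) ^+ 2).
  case: p => m n; rewrite /theta_term -cexpD; congr cexp.
  have ctE : (c * t)%:C = P / Y * T by rewrite !rmorphM fmorphV PE YE TE.
  have pkE : (pi ^+ 2 * k1)%:C = P ^+ 2 * (T / (P * Y)).
    by rewrite rmorphM rmorphXn /= k1E PE.
  rewrite rmorphM /= sqr_normc_latpt conj_latpt pkE ctE -/y -YE -/x -XE /s1.
  by field; rewrite pC yC.
have hBE p : theta_term tau (c / t) (- (c%:C * z)) p =
    E2 p.1 * cexp (- (pi ^+ 2 * k2)%:C * (p.2%:~R + s2 p.1) ^+ 2).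
  case: p => m n; rewrite /theta_term -cexpD; congr cexp.
  have ctE : (c / t)%:C = P / Y / T by rewrite !rmorphM !fmorphV PE YE TE.
  have cE : c%:C = P / Y by rewrite !rmorphM !fmorphV PE YE.
  have pkE : (pi ^+ 2 * k2)%:C = P ^+ 2 * (P * (T * Y))^-1.
    by rewrite rmorphM rmorphXn /= k2E PE.
  rewrite rmorphM /= sqr_normc_latpt conj_latpt pkE ctE cE -/y -YE -/x -XE /s2.
  by field; rewrite pC tC yC.
have Ds : abs_summable D.
  have [A1 A10 HA1] := expR_quadratic_decay1 (pi * `|complex.Im z|)
    (divr_gt0 (mulr_gt0 p0 y0) t0).
  have [A2 A20 HA2] := expR_quadratic_decay1 (pi * t * `|complex.Im z|)
    (mulr_gt0 (mulr_gt0 p0 t0) y0).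
  have [z0 z0E] : exists z0, z0 = P / Y * T * z ^+ 2 / 4 by exists (P / Y * T * z ^+ 2 / 4).
  have [A3 A3E] : exists A3, A3 = nc (cexp z0) by exists (nc (cexp z0)).
  have A30 : 0 <= A3 by rewrite A3E normc_ge0.
  apply: bounded_sums_le (bounded_sumsZ (c := A3 * A2 * A1) _
    (bounded_sums_prod (bounded_sums_decay1 R) (bounded_sums_decay1 R))).
    case=> m k; rewrite normc_ge0 andTb.
    (* Re tau occurs only in the phase e(k m Re tau), of modulus 1, so the modulus splits into a
       Gaussian in m times a Gaussian in k, with linear terms from Im z. *)
    have -> : D (m, k) = cexp z0 *
        cexp (- (pi * t * y * m%:~R ^+ 2)%:C - 'i%C * (pi * t * m%:~R)%:C * z) *
        cexp (- (pi * y / t * k%:~R ^+ 2)%:C - 'i%C * (pi * k%:~R)%:C * z) *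
        cexp (- 0%:C - 'i%C * (- (2 * pi * k%:~R * m%:~R))%:C * x%:C).
      rewrite /D /E1 ek /ei -!cexpD -z0E; congr cexp.
      rewrite k1E /s1 twopi_i -PE.
      rewrite !(rmorphN, rmorphM, rmorphXn, fmorphV, rmorph_int, rmorph0) /=.
      rewrite rmorph_nat -PE -TE -YE -XE.
      by field; rewrite pC tC yC.
    have NE (a b : R) (v : R[i]) :
        nc (cexp (- a%:C - 'i%C * b%:C * v)) = expR (- a + b * complex.Im v).
      rewrite normc_cexp; congr expR.
      by case: v => v1 v2; simpc; rewrite /=; ring.
    rewrite Normc.normcM Normc.normcM Normc.normcM -A3E !NE.
    rewrite [complex.Im x%:C]/= mulr0 oppr0 addr0.
    rewrite expR0 mulr1 -(mulrA A3) -(mulrA (A3 * _)) -(mulrA A3) ler_wpM2l//.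
    apply: le_trans (ler_pM (expR_ge0 _) (expR_ge0 _) (_ : _ <= A2 * decay1 R m)
      (_ : _ <= A1 * decay1 R k)) _; last 1 first.
    - by rewrite le_eqVlt; apply/orP; left; apply/eqP; ring.
    - apply: (le_trans _ (HA2 m)); rewrite ler_expR real_normK ?num_real//.
      rewrite mulNr lerD2l; apply: le_trans (ler_norm _) _.
      rewrite !normrM (gtr0_norm p0) (gtr0_norm t0).
      by rewrite le_eqVlt; apply/orP; left; apply/eqP; ring.
    - apply: (le_trans _ (HA1 k)); rewrite ler_expR real_normK ?num_real//.
      rewrite mulNr lerD2l; apply: le_trans (ler_norm _) _.
      rewrite !normrM (gtr0_norm p0).
      by rewrite le_eqVlt; apply/orP; left; apply/eqP; ring.
  by rewrite mulr_ge0 ?(ltW A10)// mulr_ge0 ?(ltW A20).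
have Bs : abs_summable (theta_term tau (c / t) (- (c%:C * z))).
  by apply: abs_summable_theta_term => //; rewrite divr_gt0// divr_gt0.
have As : abs_summable (theta_term tau (c * t) ((c * t)%:C * z)).
  by apply: abs_summable_theta_term => //; rewrite mulr_gt0// divr_gt0.
have [G HG] := abs_summable_has_sum Ds.
have HG' : has_sum D' G.
  rewrite (_ : D' = D \o (fun p => (- p.2, - p.1))).
    apply: (has_sum_reindex (h' := fun p => (- p.2, - p.1))) HG => -[m n];
    by rewrite /= !opprK.
  by apply/funext => p; rewrite DD'.
have Ds' : abs_summable D'.
  rewrite /abs_summable (_ : (fun i => nc (D' i)) = (fun p => nc (D p)) \o (fun p => (- p.2, - p.1))).
    apply: bounded_sums_reindex Ds => -[m n] [m' n'] /= [/oppr_inj-> /oppr_inj->].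
    by [].
  by apply/funext => p; rewrite DD'.
move: hA hB As Bs; rewrite (funext hAE) (funext hBE) => hA hB As Bs.
have -> := H k1 E1 s1 SA G k10 (fun m => cexp_neq0 _) As Ds hA HG.
have -> := H k2 E2 s2 SB G k20 (fun m => cexp_neq0 _) Bs Ds' hB HG'.
rewrite mulrA -rmorphM; congr (_%:C * _).
(* As k2 = k1 / t^2, the constants C0 / sqrt(k1) and C0 / sqrt(k2) of the two sides differ by the
   factor 1/t. *)
have k1k2 : Num.sqrt k2 = t^-1 * Num.sqrt k1.
  have -> : t^-1 = Num.sqrt (t ^- 2).
    by rewrite sqrtrV ?sqr_ge0// sqrtr_sqr gtr0_norm.
  rewrite -sqrtrM ?invr_ge0 ?sqr_ge0//; congr Num.sqrt.
  rewrite /k1 /k2; move: (pi : R) p0 (y) y0 => q q0 v v0.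
  by field; rewrite (gt_eqF q0) (gt_eqF v0) (gt_eqF t0).
have : 0 < Num.sqrt k1 by rewrite sqrtr_gt0.
rewrite k1k2; move: (Num.sqrt k1) => r r0.
by field; rewrite (gt_eqF r0) (gt_eqF t0).
Qed.
End ThetaInversion.

(** * Comparison of Taylor coefficients *)

Section VanishingPolynomial.
Variable R : realType.

(** Letting h tend to 0 gives d 0 = 0, and dividing by h lowers n by one. Coefficients are thus
    identified from small positive real arguments. *)
Lemma small_polynomial_eq0 (n : nat) (d : nat -> R[i]) (M h0 : R) :
  0 < h0 -> 0 <= M -> (forall h : R, 0 < h <= h0 ->
    nc (\sum_(j < n) d j * (h%:C) ^+ j) <= M * h ^+ n) ->
  forall j, (j < n)%N -> d j = 0.
Proof.
move=> h00 M0; elim: n d => [|n IH] d H j // jn.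
have d0 : d 0%N = 0.
  apply/eqP; rewrite -normc_eq0 eq_le normc_ge0 andbT.
  apply/ler_addgt0Pl => e e0; rewrite addr0.
  pose K : R := M + \sum_(j < n) nc (d j.+1).
  have K0 : 0 <= K by rewrite addr_ge0// sumr_ge0// => i _; exact: normc_ge0.
  (* For h <= 1 the error and the terms of positive degree add up to at most K h, and h (K + 1) <=
     e. *)
  pose h : R := Num.min (Num.min h0 1) (e / (K + 1)).
  have hpos : 0 < h by rewrite !lt_min h00 ltr01 divr_gt0// ltr_wpDl.
  have hh0 : h <= h0 by rewrite !ge_min lexx.
  have h1 : h <= 1 by rewrite !ge_min lexx orbT.
  have hK : h * (K + 1) <= e by rewrite -ler_pdivlMr ?ltr_wpDl// ge_min lexx orbT.
  have := H h; rewrite hpos hh0 => /(_ isT).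
  rewrite big_ord_recl expr0 mulr1 => h2.
  have h3 : nc (\sum_(i < n) d (lift ord0 i) * h%:C ^+ (lift ord0 i)) <=
      h * \sum_(j < n) nc (d j.+1).
    apply: le_trans (ler_normc_sum _ _ _) _; rewrite mulr_sumr.
    apply: ler_sum => i _; rewrite Normc.normcM mulrC normcX normc_real.
    rewrite gtr0_norm// /= ler_wpM2r ?normc_ge0// /bump /= add1n exprS.
    by rewrite ler_piMr ?(ltW hpos)// exprn_ile1 ?(ltW hpos).
  have h4 : M * h ^+ n.+1 <= h * M.
    by rewrite mulrC exprS -mulrA ler_wpM2l ?(ltW hpos)// ler_piMl// exprn_ile1 ?(ltW hpos).
  set S : R[i] := \sum_(i < n) d (lift ord0 i) * _ in h2 h3.
  have h5 : nc (d 0%N) <= nc (d (@ord0 n) + S) + nc S.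
    rewrite -[nc S]normcN; apply: le_trans (ler_normcD _ _).
    by rewrite addrK.
  rewrite /K in hK; lra.
case: j jn => // j jn.
apply: (IH (fun j => d j.+1)) => // h hh.
have h0' : 0 < h by case/andP: hh.
have := H h hh; rewrite big_ord_recl d0 mul0r add0r.
have -> : \sum_(i < n) d (lift ord0 i) * h%:C ^+ (lift ord0 i) =
    h%:C * \sum_(i < n) d i.+1 * h%:C ^+ i.
  rewrite mulr_sumr; apply: eq_bigr => i _.
  by rewrite mulrCA -exprS.
by rewrite Normc.normcM normc_real gtr0_norm// exprS mulrCA ler_pM2l.
Qed.

End VanishingPolynomial.

Section ThetaMoments.
Variables (R : realType) (tau : R[i]).
Hypothesis tau_gt0 : 0 < complex.Im tau.
Local Notation w := (latpt tau).
Local Notation c := (pi / complex.Im tau).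

Definition moment_term (a : R) (n : nat) (p : int * int) : R[i] :=
  conjc (w p) ^+ n * (expR (- (a * nc (w p) ^+ 2)))%:C.

Lemma theta_termE a z p :
  theta_term tau a z p = (expR (- (a * nc (w p) ^+ 2)))%:C * cexp (z * conjc (w p)).
Proof. by rewrite /theta_term cexpD -rmorphN cexp_real. Qed.

Lemma normc_moment_term a n p :
  nc (moment_term a n p) = nc (w p) ^+ n * expR (- a * nc (w p) ^+ 2).
Proof.
by rewrite /moment_term Normc.normcM normcX normc_conj normc_real
  ger0_norm ?expR_ge0// mulNr.
Qed.

Lemma abs_summable_moment a n : 0 < a -> abs_summable (moment_term a n).
Proof.
move=> a0; apply: (@abs_summable_gauss _ _ tau_gt0 _ a 0 n 1) => // p.
rewrite normc_moment_term mul1r mul0r addr0 ler_wpM2r ?expR_ge0//.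
by rewrite lerXn2r ?nnegrE ?addr_ge0 ?normc_ge0// lerDr.
Qed.

(** Termwise, [cexp_taylor] at z conj(w) gives |z|^n times a majorant that is independent of z on
    the unit disc, where e^(|z| |w|) <= e^|w|. *)
Lemma theta_taylor a n (T : nat -> R[i]) : 0 < a ->
  (forall j, has_sum (moment_term a j) (T j)) ->
  exists2 M : R, 0 <= M & forall z S, nc z <= 1 -> has_sum (theta_term tau a z) S ->
   nc (S - \sum_(j < n) T j * z ^+ j / j`!%:R) <= M * nc z ^+ n.
Proof.
move=> a0 HT; pose g p := nc (w p) ^+ n * expR (- a * nc (w p) ^+ 2 + 1 * nc (w p)).
have [g0 [M HM]] : bounded_sums g.
  have [C C0 HC] := gauss_le 1 n a0.
  apply: bounded_sums_le (bounded_sumsZ (ltW C0) (bounded_sums_latpt tau_gt0)).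
  move=> p; have w0 := normc_ge0 (w p).
  rewrite mulr_ge0 ?exprn_ge0 ?expR_ge0//=; apply: le_trans (HC _ w0).
  by rewrite ler_wpM2r ?expR_ge0// lerXn2r ?nnegrE ?addr_ge0// lerDr.
have M0 : 0 <= M by have := HM fset0%fset; rewrite big_seq_fset0.
exists M => // z S z1 HS.
have HP : has_sum (fun p => \sum_(j < n) (z ^+ j / j`!%:R) * moment_term a j p)
    (\sum_(j < n) (z ^+ j / j`!%:R) * T j).
  by apply: has_sum_sum => j _; exact: has_sumZ.
have := has_sumB HS HP.
have -> : \sum_(j < n) (z ^+ j / j`!%:R) * T j = \sum_(j < n) T j * z ^+ j / j`!%:R.
  by apply: eq_bigr => j _; rewrite mulrC mulrA.
move=> /has_sum_norm_le; apply => A.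
apply: (@le_trans _ _ (\sum_(p <- A) g p * nc z ^+ n)); last first.
  by rewrite -mulr_suml ler_wpM2r ?exprn_ge0 ?normc_ge0.
apply: ler_sum => p _; rewrite theta_termE.
set e := expR _; set v := conjc (w p).
have -> : \sum_(j < n) (z ^+ j / j`!%:R) * moment_term a j p =
    e%:C * exp_trunc n (z * v).
  rewrite /exp_trunc mulr_sumr; apply: eq_bigr => j _.
  by rewrite /moment_term -/e -/v exprMn; ring.
rewrite -mulrBr Normc.normcM normc_real ger0_norm ?expR_ge0//.
apply: le_trans (ler_wpM2l (expR_ge0 _) (cexp_taylor n (z * v))) _.
rewrite Normc.normcM normc_conj exprMn /g expRD /e mulNr mul1r.
rewrite [leRHS](_ : _ = expR (- (a * nc (w p) ^+ 2)) *
  (nc z ^+ n * nc (w p) ^+ n * expR (nc (w p)))); last by ring.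
rewrite ler_wpM2l ?expR_ge0// ler_wpM2l ?mulr_ge0 ?exprn_ge0 ?normc_ge0//.
by rewrite ler_expR ler_piMl ?normc_ge0.
Qed.

(** Both sides of [theta_inversion] are expanded at z = h real. The arguments c t h and - c h
    contribute (c t)^n and (- c)^n to the coefficients of h^n, whence t^n and (-1)^n. *)
Lemma moment_inversion (t : R) n (SA SB : R[i]) : 0 < t ->
  has_sum (moment_term (c * t) n) SA -> has_sum (moment_term (c / t) n) SB ->
  (t ^+ n)%:C * SA = (t^-1)%:C * (-1) ^+ n * SB.
Proof.
move=> t0 hA hB.
have c0 : 0 < c by rewrite divr_gt0// pi_gt0.
have [cc ccE] : exists cc : R, cc = c by exists c.
rewrite -ccE in c0.
have ct0 : 0 < cc * t by rewrite mulr_gt0.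
have ct0' : 0 < cc / t by rewrite divr_gt0.
have [T HT] := choice (fun j => abs_summable_has_sum (abs_summable_moment j ct0)).
have [T' HT'] := choice (fun j => abs_summable_has_sum (abs_summable_moment j ct0')).
have [M M0 HM] := theta_taylor n.+1 ct0 HT.
have [M' M0' HM'] := theta_taylor n.+1 ct0' HT'.
rewrite -ccE in hA hB.
have -> : SA = T n by exact: has_sum_uniq hA (HT n).
have -> : SB = T' n by exact: has_sum_uniq hB (HT' n).
pose d j : R[i] := (T j * ((cc * t)%:C) ^+ j - (t^-1)%:C * (T' j * (- cc%:C) ^+ j)) / j`!%:R.
suff : d n = 0.
  move=> /eqP; rewrite mulf_eq0 invr_eq0 pnatr_eq0 -[_ == 0%N]negbK -lt0n fact_gt0.
  rewrite orbF subr_eq0 => /eqP e.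
  have ccC : cc%:C ^+ n != 0.
    by rewrite expf_neq0// -(rmorph0 (real_complex R)) (inj_eq (@complexI R)) gt_eqF.
  apply: (mulfI ccC); transitivity (T n * (cc * t)%:C ^+ n).
    by rewrite rmorphM rmorphXn exprMn /=; ring.
  rewrite e (exprNn cc%:C); ring.
(* [h0] keeps c t h and - c h in the unit disc, where [theta_taylor] holds. *)
pose h0 : R := Num.min (cc * t)^-1 cc^-1.
apply: (@small_polynomial_eq0 _ n.+1 d
  (M * (cc * t) ^+ n.+1 + t^-1 * (M' * cc ^+ n.+1)) h0).
- by rewrite lt_min !invr_gt0 ct0.
- by rewrite addr_ge0 ?mulr_ge0 ?exprn_ge0 ?invr_ge0 ?(ltW c0) ?(ltW ct0) ?(ltW t0).
- move=> h /andP[hp hle].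
  have [S HS] := abs_summable_has_sum
    (abs_summable_theta_term tau_gt0 ((cc * t)%:C * h%:C) ct0).
  have [S' HS'] := abs_summable_has_sum
    (abs_summable_theta_term tau_gt0 (- (cc%:C * h%:C)) ct0').
  have SS' : S = (t^-1)%:C * S'.
    by apply: (@theta_inversion _ _ tau_gt0 t h%:C) => //; rewrite -ccE.
  have z1 : nc ((cc * t)%:C * h%:C) <= 1.
    rewrite -rmorphM normc_real gtr0_norm ?mulr_gt0// mulrC -ler_pdivlMr// mul1r.
    by apply: le_trans hle _; rewrite ge_min lexx.
  have z1' : nc (- (cc%:C * h%:C)) <= 1.
    rewrite normcN -rmorphM normc_real gtr0_norm ?mulr_gt0// mulrC -ler_pdivlMr// mul1r.
    by apply: le_trans hle _; rewrite ge_min lexx orbT.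
  have h1 := HM _ _ z1 HS; have h2 := HM' _ _ z1' HS'.
  set P := \sum_(j < n.+1) _ in h1; set P' := \sum_(j < n.+1) _ in h2.
  have -> : \sum_(j < n.+1) d j * h%:C ^+ j = P - (t^-1)%:C * P'.
    rewrite /P /P' mulr_sumr -sumrB; apply: eq_bigr => j _.
    by rewrite /d -[- (cc%:C * h%:C)]mulNr [((cc * t)%:C * _) ^+ _]exprMn [(- cc%:C * _) ^+ _]exprMn; ring.
  rewrite [X in nc X](_ : _ = (t^-1)%:C * (S' - P') - (S - P)); last first.
    by rewrite SS'; ring.
  apply: le_trans (ler_normcD _ _) _; rewrite normcN Normc.normcM normc_real.
  rewrite gtr0_norm ?invr_gt0// mulrDl addrC; apply: lerD.
    apply: le_trans h1 _.
    by rewrite -rmorphM normc_real gtr0_norm ?mulr_gt0// exprMn mulrA.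
  rewrite -mulrA ler_wpM2l ?invr_ge0 ?(ltW t0)//; apply: le_trans h2 _.
  by rewrite normcN -rmorphM normc_real gtr0_norm ?mulr_gt0// exprMn mulrA.
- exact: ltnSn.
Qed.
End ThetaMoments.

(** * Interpolation by incomplete gamma functions *)

Section SecondOrderTaylor.
Variable R : realType.

Lemma norm_sub_le_derive (f df : R -> R) (L a b : R) : a <= b ->
  (forall x : R, is_derive x (1 : R) f (df x)) ->
  (forall x, a <= x <= b -> `|df x| <= L) -> `|f b - f a| <= L * (b - a).
Proof.
move=> ab fD H; have [x] := MVT_segment ab (fun x _ => fD x)
  (derivable_within_continuous (fun x _ => @ex_derive _ _ _ _ _ _ _ (fD x))).
rewrite in_itv /= => xab ->; rewrite normrM [X in _ * X]ger0_norm ?subr_ge0//.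
by rewrite ler_wpM2r ?subr_ge0// H.
Qed.

Lemma taylor2_le (f df ddf : R -> R) (L a b : R) : 0 <= L -> a <= b ->
  (forall x : R, is_derive x (1 : R) f (df x)) ->
  (forall x : R, is_derive x (1 : R) df (ddf x)) ->
  (forall x, a <= x <= b -> `|ddf x| <= L) ->
  `|f b - f a - (b - a) * df a| <= L * (b - a) ^+ 2.
Proof.
move=> L0 ab fD dfD H; have [x] := MVT_segment ab (fun x _ => fD x)
  (derivable_within_continuous (fun x _ => @ex_derive _ _ _ _ _ _ _ (fD x))).
rewrite in_itv /= => /andP[ax xb] ->; rewrite [_ * df a]mulrC -mulrBl normrM.
rewrite [X in _ * X]ger0_norm ?subr_ge0// expr2 mulrA ler_wpM2r ?subr_ge0//.
apply: le_trans (_ : L * (x - a) <= _).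
  apply: norm_sub_le_derive dfD _ => // y /andP[ay yx].
  by apply: H; rewrite ay (le_trans yx).
by rewrite ler_wpM2l// lerD2r.
Qed.

(** N equal steps contribute at most N M (U / N)^2 = M U^2 / N, which is arbitrarily small. *)
Lemma quadratic_increments_cst (K : R -> R[i]) (M U : R) : 0 <= U -> 0 <= M ->
  (forall u v, - U <= u -> u <= v -> v <= 0 -> nc (K v - K u) <= M * (v - u) ^+ 2) ->
  K (- U) = K 0.
Proof.
move=> U0 M0 H; apply/eqP; rewrite eq_sym -subr_eq0 -normc_eq0 eq_le normc_ge0 andbT.
apply/ler_addgt0Pl => e e0; rewrite addr0.
pose N := (Num.trunc (M * U ^+ 2 / e)).+1.
have N0 : 0 < N%:R :> R by [].
have HN : M * U ^+ 2 / e < N%:R.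
  have /truncn_itv/andP[] // : 0 <= M * U ^+ 2 / e.
  by rewrite divr_ge0 ?mulr_ge0 ?sqr_ge0// ltW.
have step k : (k <= N)%N ->
    nc (K (- U + k%:R * (U / N%:R)) - K (- U)) <= k%:R * (M * (U / N%:R) ^+ 2).
  elim: k => [|k IH] kN; first by rewrite !mul0r addr0 subrr Normc.normc0.
  apply: le_trans (ler_normcB _ (K (- U + k%:R * (U / N%:R))) _) _.
  rewrite -natr1 [leRHS]mulrDl mul1r addrC; apply: lerD; first by apply: IH; exact: ltnW.
  have d0 : 0 <= U / N%:R by rewrite divr_ge0.
  apply: le_trans (H _ _ _ _ _) _.
  - by rewrite lerDl mulr_ge0.
  - by rewrite lerD2l mulrDl mul1r lerDl.
  - rewrite addrC subr_le0 natr1 mulrA ler_pdivrMr// mulrC ler_wpM2l//.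
    by rewrite ler_nat.
  - by rewrite mulrDl mul1r [_ - _](_ : _ = U / N%:R)//; ring.
have := step N (leqnn N); rewrite [N%:R * (U / N%:R)]mulrC divfK ?gt_eqF// addNr.
move=> /le_trans; apply; rewrite [leLHS](_ : _ = M * U ^+ 2 / N%:R); last first.
  by field; rewrite gt_eqF.
by rewrite ler_pdivrMr// [e * _]mulrC -ler_pdivrMr// ltW.
Qed.

End SecondOrderTaylor.

Section GammaQuotient.
Variable R : realType.

Definition expT (n : nat) : {poly R} := \poly_(j < n) (j`!%:R)^-1.

Lemma expTS n : expT n.+1 = expT n + (n`!%:R)^-1 *: 'X^n.
Proof.
apply/polyP => i; rewrite coefD coefZ coefXn !coef_poly ltnS leq_eqVlt.
by case: eqVneq => [->|_]; rewrite ?ltnn ?add0r ?mulr1//= mulr0 addr0.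
Qed.

Lemma deriv_expT n : (expT n.+1)^`() = expT n.
Proof.
apply/polyP => i; rewrite coef_deriv !coef_poly ltnS; case: ltnP => _; last by rewrite mul0rn.
by rewrite factS natrM invfM -[LHS]mulr_natr mulrAC mulVf ?mul1r// pnatr_eq0.
Qed.

(* The regularized incomplete gamma quotient Gamma(n + 1, x) / n!. *)
Definition gammaQ (n : nat) (x : R) : R := expR (- x) * (expT n.+1).[x].

Lemma is_derive_gammaQ n (x : R) :
  is_derive x (1 : R) (gammaQ n) (- (x ^+ n * expR (- x) / n`!%:R)).
Proof.
rewrite /gammaQ; apply: is_derive_eq.
rewrite deriv_expT expTS hornerD hornerZ hornerXn /GRing.scale /=; ring.
Qed.

Lemma gammaQ0 n : gammaQ n 0 = 1.
Proof.
by rewrite /gammaQ oppr0 expR0 mul1r horner_coef0 coef_poly /= invr1.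
Qed.

Lemma gammaQ_ge0 n x : 0 <= x -> 0 <= gammaQ n x.
Proof.
move=> x0; rewrite mulr_ge0 ?expR_ge0// horner_poly sumr_ge0// => j _.
by rewrite mulr_ge0 ?invr_ge0 ?exprn_ge0.
Qed.

Lemma gammaQ_le1 n x : 0 <= x -> gammaQ n x <= 1.
Proof.
move=> x0; have [y] := MVT_segment x0 (fun t _ => is_derive_gammaQ n t)
  (derivable_within_continuous (fun t _ => @ex_derive _ _ _ _ _ _ _ (is_derive_gammaQ n t))).
rewrite in_itv /= => /andP[y0 yx]; rewrite gammaQ0 subr0 => e.
rewrite -subr_le0 e mulNr oppr_le0 mulr_ge0// mulr_ge0 ?invr_ge0//.
by rewrite mulr_ge0 ?exprn_ge0 ?expR_ge0.
Qed.

(** With t = e^u, the derivatives of both halves of K are multiples of such functions, with b = 1 or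
    b = -1. Differentiation stays in the family and shifts a by b. *)
Definition expexp (a b X u : R) : R := expR (a * u) * expR (- (X * expR (b * u))).

Lemma is_derive_expexp (a b X u : R) : is_derive u (1 : R) (expexp a b X)
  (a * expexp a b X u - b * X * expexp (a + b) b X u).
Proof.
rewrite /expexp; apply: is_derive_eq.
by rewrite /GRing.scale /= [(a + b) * u]mulrDl expRD; ring.
Qed.

Lemma is_derive_gammaQ_exp n (X u : R) :
  is_derive u (1 : R) (fun u => gammaQ n (X * expR u))
  (- (X ^+ n.+1 / n`!%:R) * expexp n.+1%:R 1 X u).
Proof.
have H := is_derive_gammaQ n (X * expR u).
apply: is_derive_eq.
rewrite /expexp /GRing.scale /= mul1r expRM_natl exprMn !exprS; ring.
Qed.

Lemma is_derive_exp_exp (X u : R) :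
  is_derive u (1 : R) (fun u => expR (- (X * expR (- u)))) (X * expexp (-1) (-1) X u).
Proof.
apply: is_derive_eq; rewrite /expexp /GRing.scale /= !mulN1r; ring.
Qed.

(** The right-hand side is shared with [expexp_bound2], so that one majorant serves both halves of
    K. The factor e^(2 U) comes from the exponent a = -2 occurring there. *)
Lemma expexp_bound1 n (X U u : R) : 0 <= X -> - U <= u <= 0 ->
  `|n.+1%:R * expexp n.+1%:R 1 X u - 1 * X * expexp (n.+1%:R + 1) 1 X u| <=
  expR (2 * U) * (n.+1%:R + X) * expR (- (X * expR (- U))).
Proof.
move=> X0 /andP[Uu u0].
have n0 : 0 <= n.+1%:R :> R by [].
have e1 : expR (- (X * expR u)) <= expR (- (X * expR (- U))).
  by rewrite ler_expR lerN2 ler_wpM2l// ler_expR.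
have e2 (a : R) : 0 <= a -> `|expexp a 1 X u| <= expR (- (X * expR (- U))).
  move=> a0; rewrite /expexp mul1r normrM !ger0_norm ?expR_ge0//.
  apply: le_trans e1; rewrite ler_piMl ?expR_ge0// expR_le1.
  by rewrite mulr_ge0_le0.
have U1 : 1 <= expR (2 * U) by rewrite -expR0 ler_expR mulr_ge0//; lra.
apply: le_trans (ler_normB _ _) _.
rewrite mul1r (normrM n.+1%:R) (normrM X) (ger0_norm X0) (ger0_norm n0).
apply: le_trans (_ : (n.+1%:R + X) * expR (- (X * expR (- U))) <= _).
  by rewrite [leRHS](mulrDl n.+1%:R X); apply: lerD; apply: ler_wpM2l => //; apply: e2.
by rewrite ler_wpM2r ?expR_ge0// ler_peMl ?addr_ge0.
Qed.

Lemma expexp_bound2 n (X U u : R) : 0 <= X -> - U <= u <= 0 ->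
  `|-1 * expexp (-1) (-1) X u - -1 * X * expexp (-1 + -1) (-1) X u| <=
  expR (2 * U) * (n.+1%:R + X) * expR (- (X * expR (- U))).
Proof.
move=> X0 /andP[Uu u0].
have e1 : expR (- (X * expR (- u))) <= expR (- (X * expR (- U))).
  rewrite ler_expR lerN2 ler_wpM2l// ler_expR; lra.
have e2 (a : R) : 0 <= a <= 2 -> `|expexp (- a) (-1) X u| <=
    expR (2 * U) * expR (- (X * expR (- U))).
  move=> /andP[a0 a2]; rewrite /expexp mulN1r normrM !ger0_norm ?expR_ge0//.
  by apply: ler_pM; rewrite ?expR_ge0// ler_expR; nra.
apply: le_trans (ler_normB _ _) _.
rewrite (normrM (-1)) (normrM (-1 * X)) (normrM (-1)) normrN1 !mul1r (ger0_norm X0).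
rewrite mulrAC mulrDr; apply: lerD.
  apply: le_trans (e2 1 _) _; first by rewrite ler01 ler1n.
  by rewrite ler_peMr ?mulr_ge0 ?expR_ge0// ler1n.
rewrite mulrC; apply: ler_wpM2r => //.
by rewrite -opprD; apply: e2; lra.
Qed.

End GammaQuotient.

Section Interpolation.
Variables (R : realType) (tau : R[i]).
Hypothesis tau_gt0 : 0 < complex.Im tau.
Local Notation w := (latpt tau).
Local Notation c := (pi / complex.Im tau).

Lemma latpt_inv_le : exists2 K : R, 0 < K & forall p, nc (w p)^-1 <= K.
Proof.
have [K K0 H] := latpt_ge tau_gt0; exists K => // p.
have [p0|p0] := eqVneq (w p) 0; first by rewrite p0 invr0 Normc.normc0 ltW.
rewrite Normc.normcV -[leLHS]mul1r ler_pdivrMr ?normc_gt0//.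
apply: le_trans (H p); rewrite -!intr_norm -intrD.
rewrite -[1]/(1%:~R) ler_int.
have : p != (0, 0) by rewrite -(latpt_eq0 _ tau_gt0).
case: p {p0} => m k /= mk; have : (m != 0) || (k != 0).
  by apply: contraR mk; rewrite negb_or !negbK => /andP[/eqP-> /eqP->].
lia.
Qed.

Definition gauss_term (a : R) (i j : nat) (p : int * int) : R[i] :=
  conjc (w p) ^+ j / w p ^+ i * (expR (- (a * nc (w p) ^+ 2)))%:C.

Lemma abs_summable_gauss_term a i j : 0 < a -> abs_summable (gauss_term a i j).
Proof.
move=> a0; have [K K0 HK] := latpt_inv_le.
apply: (@abs_summable_gauss _ _ tau_gt0 _ a 0 j (K ^+ i)) => //.
  by rewrite exprn_ge0// ltW.
move=> p; rewrite /gauss_term Normc.normcM Normc.normcM -exprVn !normcX normc_conj.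
rewrite normc_real ger0_norm ?expR_ge0// mul0r addr0 mulNr mulrA.
rewrite ler_wpM2r ?expR_ge0// mulrC; apply: ler_pM; rewrite ?exprn_ge0 ?normc_ge0//.
  by rewrite lerXn2r ?nnegrE ?normc_ge0 ?(ltW K0).
by rewrite lerXn2r ?nnegrE ?addr_ge0 ?normc_ge0// lerDr.
Qed.

Variable n : nat.
Hypothesis odd_n : odd n.

Let X p : R := c * nc (w p) ^+ 2.

(** The term of K(t) for weight n + 1 and t = e^u; [gammaQ n] is Q(n + 1, x) in the notation of K.
    At the origin both summands are 0. *)
Definition split_term (u : R) (p : int * int) : R[i] :=
  (gammaQ n (c * nc (w p) ^+ 2 * expR u))%:C / w p ^+ n.+1
  + (c ^+ n / n`!%:R)%:C * (conjc (w p) ^+ n / w p)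
    * (expR (- (c * nc (w p) ^+ 2 * expR (- u))))%:C.

(** The derivative of [split_term] in u. The powers of c |w|^2 combine with those of w to the same
    factor c^(n+1) conj(w)^(n+1) / n! in both halves. *)
Let split_deriv (u : R) (p : int * int) : R[i] :=
  (c ^+ n.+1 / n`!%:R)%:C * conjc (w p) ^+ n.+1 *
  (expexp (-1) (-1) (X p) u - expexp n.+1%:R 1 (X p) u)%:C.

Lemma scaled_norm_ge0 p : 0 <= X p.
Proof. by rewrite mulr_ge0 ?sqr_ge0// divr_ge0 ?pi_ge0 ?ltW. Qed.

(** This is the inversion of the moment of order n + 1 at t = e^u; the sign (-1)^(n+1) is 1 because
    the weight is even. *)
Lemma has_sum_split_deriv u : has_sum (split_deriv u) 0.
Proof.
have c0 : 0 < c by rewrite divr_gt0// pi_gt0.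
have t0 := expR_gt0 u.
have [SA HA] := abs_summable_has_sum
  (abs_summable_moment tau_gt0 n.+1 (mulr_gt0 c0 t0)).
have [SB HB] := abs_summable_has_sum
  (abs_summable_moment tau_gt0 n.+1 (divr_gt0 c0 t0)).
have := moment_inversion tau_gt0 t0 HA HB.
rewrite -signr_odd /= odd_n expr0 mulr1 => e.
have := has_sumZ (c ^+ n.+1 / n`!%:R)%:C
  (has_sumB (has_sumZ ((expR u)^-1)%:C HB) (has_sumZ (expR u ^+ n.+1)%:C HA)).
rewrite e subrr mulr0; congr has_sum; apply/funext => p.
rewrite /split_deriv /moment_term -mulrA; congr (_ * _).
rewrite [(expR u)^-1%:C * _]mulrCA [(expR u ^+ n.+1)%:C * _]mulrCA -mulrBr.
congr (_ * _); rewrite -!rmorphM -rmorphB /expexp !mulN1r mul1r -expRN.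
rewrite expRM_natl; congr ((_ * expR (- _) - _ * expR (- _))%:C).
  by rewrite /X mulrAC.
by rewrite /X mulrAC.
Qed.

Let increment_bound (U : R) p : R := 2 * (c ^+ n.+1 / n`!%:R) * nc (w p) ^+ n.+1 *
  (expR (2 * U) * (n.+1%:R + X p) * expR (- (X p * expR (- U)))).

Lemma increment_bound_ge0 U p : 0 <= increment_bound U p.
Proof.
have X0 := scaled_norm_ge0 p; apply: mulr_ge0.
  apply: mulr_ge0; last by rewrite exprn_ge0// normc_ge0.
  by rewrite mulr_ge0// divr_ge0// exprn_ge0// divr_ge0 ?pi_ge0 ?ltW.
apply: mulr_ge0; last exact: expR_ge0.
by apply: mulr_ge0; [exact: expR_ge0|exact: addr_ge0].
Qed.

(** Each half is estimated by [taylor2_le]. Multiplied by its prefactor, either bound becomes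
    c^(n+1) / n! |w|^(n+1) times the common majorant, hence the factor 2 in [increment_bound]. *)
Lemma split_term_increment (U u v : R) p : - U <= u -> u <= v -> v <= 0 ->
  nc (split_term v p - split_term u p - (v - u)%:C * split_deriv u p) <= increment_bound U p * (v - u) ^+ 2.
Proof.
move=> Uu uv v0; have X0 := scaled_norm_ge0 p.
have cn0 : 0 <= c ^+ n.+1 / n`!%:R.
  by rewrite divr_ge0// exprn_ge0// divr_ge0 ?pi_ge0 ?ltW.
set L := expR (2 * U) * (n.+1%:R + X p) * expR (- (X p * expR (- U))).
have L0 : 0 <= L.
  apply: mulr_ge0; last exact: expR_ge0.
  by apply: mulr_ge0; [exact: expR_ge0|exact: addr_ge0].
have [w0|w0] := eqVneq (w p) 0.
  rewrite /split_term /split_deriv w0 rmorph0 expr0n /= invr0 !(mulr0, mul0r) !addr0 !subr0.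
  by rewrite Normc.normc0; exact: mulr_ge0 (increment_bound_ge0 _ _) (sqr_ge0 _).
have uvb x : u <= x <= v -> - U <= x <= 0.
  by move=> /andP[ux xv]; rewrite (le_trans Uu ux) (le_trans xv v0).
pose phi x := gammaQ n (X p * expR x); pose psi x := expR (- (X p * expR (- x))).
have h1 : `|phi v - phi u - (v - u) * (- (X p ^+ n.+1 / n`!%:R) * expexp n.+1%:R 1 (X p) u)|
    <= (X p ^+ n.+1 / n`!%:R) * L * (v - u) ^+ 2.
  apply: (@taylor2_le R phi
    (fun x => - (X p ^+ n.+1 / n`!%:R) * expexp n.+1%:R 1 (X p) x)
    (fun x => - (X p ^+ n.+1 / n`!%:R) * (n.+1%:R * expexp n.+1%:R 1 (X p) x
       - 1 * X p * expexp (n.+1%:R + 1) 1 (X p) x)) _ u v _ uv).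
  - by apply: mulr_ge0 => //; rewrite divr_ge0// exprn_ge0.
  - by move=> x; exact: is_derive_gammaQ_exp.
  - move=> x; have H := is_derive_expexp n.+1%:R 1 (X p) x.
    by apply: is_derive_eq; rewrite /GRing.scale.
  - move=> x /uvb xU; rewrite normrM normrN [ `|X p ^+ n.+1 / _| ]ger0_norm; last first.
      by rewrite divr_ge0// exprn_ge0.
    by rewrite ler_wpM2l ?divr_ge0 ?exprn_ge0//; exact: expexp_bound1.
have h2 : `|psi v - psi u - (v - u) * (X p * expexp (-1) (-1) (X p) u)|
    <= X p * L * (v - u) ^+ 2.
  apply: (@taylor2_le R psi (fun x => X p * expexp (-1) (-1) (X p) x)
    (fun x => X p * (-1 * expexp (-1) (-1) (X p) x -
     -1 * X p * expexp (-1 + -1) (-1) (X p) x)) _ u v _ uv).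
  - exact: mulr_ge0.
  - by move=> x; exact: is_derive_exp_exp.
  - move=> x; have H := is_derive_expexp (-1) (-1) (X p) x.
    by apply: is_derive_eq; rewrite /GRing.scale.
  - move=> x /uvb xU; rewrite normrM (ger0_norm X0).
    by rewrite ler_wpM2l//; exact: expexp_bound2.
have XC (q : R) : (q * nc (w p) ^+ 2)%:C = q%:C * (w p * conjc (w p)).
  by rewrite sqr_normc_conj -rmorphM.
pose D := (c ^+ n.+1 / n`!%:R)%:C * conjc (w p) ^+ n.+1.
pose B := (c ^+ n / n`!%:R)%:C * (conjc (w p) ^+ n / w p).
have D1 : (X p ^+ n.+1 / n`!%:R)%:C / w p ^+ n.+1 = D.
  rewrite /D /X; move: (c) => q.
  rewrite rmorphM rmorphXn /= XC rmorphM rmorphXn /=.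
  move: (_^-1%:C) => F; rewrite !exprMn.
  by field; rewrite expf_neq0.
have D2 : B * (X p)%:C = D.
  rewrite /D /B /X; move: (c) => q.
  rewrite XC rmorphM rmorphXn [(_ ^+ n.+1 / _)%:C]rmorphM rmorphXn /= !exprS.
  move: (_^-1%:C) => F.
  by field.
have nw0 : 0 < nc (w p) by rewrite normc_gt0.
move: h1 h2; set r1 := phi v - phi u - _; set r2 := psi v - psi u - _ => h1 h2.
have -> : split_term v p - split_term u p - (v - u)%:C * split_deriv u p =
    r1%:C / w p ^+ n.+1
    + (c ^+ n / n`!%:R)%:C * (conjc (w p) ^+ n / w p) * r2%:C.
  rewrite /split_term /split_deriv /r1 /r2 -/(X p) -/(phi v) -/(phi u) -/(psi v) -/(psi u) -/B -/D.
  move: (phi v) (phi u) (psi v) (psi u) (expexp _ _ _ _) (expexp _ _ _ _).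
  move: (w p ^+ n.+1) D1 D2 => W; move: (X p ^+ n.+1 / n`!%:R) => y.
  move: (X p) (B) (D) => x {}B {}D <-.
  move=> /eqP; rewrite -subr_eq0 => /eqP e0 a b d e f g.
  apply/eqP; rewrite -subr_eq0; apply/eqP.
  rewrite [LHS](_ : _ = (v - u)%:C * g%:C * (B * x%:C - y%:C / W)).
    by rewrite e0 mulr0.
  by rewrite !(rmorphB, rmorphM, rmorphN) /=; ring.
apply: le_trans (ler_normcD _ _) _.
rewrite Normc.normcM Normc.normcV normcX normc_real.
rewrite Normc.normcM Normc.normcM Normc.normcM Normc.normcV normcX normc_conj !normc_real.
have f0 : 0 < n`!%:R :> R by rewrite ltr0n fact_gt0.
have cn1 : 0 <= c ^+ n / n`!%:R.
  by rewrite divr_ge0// exprn_ge0// divr_ge0 ?pi_ge0 ?ltW.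
rewrite (ger0_norm cn1).
apply: le_trans (lerD (_ : _ <= (X p ^+ n.+1 / n`!%:R) * L * (v - u) ^+ 2 / nc (w p) ^+ n.+1)
  (_ : _ <= c ^+ n / n`!%:R * (nc (w p) ^+ n / nc (w p)) * (X p * L * (v - u) ^+ 2))) _.
- by rewrite ler_wpM2r// invr_ge0 exprn_ge0// ltW.
- by rewrite ler_wpM2l// mulr_ge0// divr_ge0 ?exprn_ge0 ?ltW.
rewrite /increment_bound -/L /X le_eqVlt; apply/orP; left; apply/eqP.
move: (L) (nc (w p)) nw0 (c) => L' q q0 C.
have e : (C * q ^+ 2) ^+ n.+1 = C ^+ n.+1 * (q ^+ n.+1 * q ^+ n.+1).
  by rewrite exprMn -exprM mul2n -addnn exprD.
rewrite e !exprS expr0 mulr1.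
by field; rewrite (gt_eqF q0) (gt_eqF f0) expf_neq0 ?gt_eqF.
Qed.

Lemma bounded_sums_increment_bound U : bounded_sums (increment_bound U).
Proof.
have c0 : 0 < c by rewrite divr_gt0// pi_gt0.
have a0 : 0 < c * expR (- U) by rewrite mulr_gt0 ?expR_gt0.
have [C C0 HC] := gauss_le 0 (n.+1 + 2) a0.
pose D : R := 2 * (c ^+ n.+1 / n`!%:R) * expR (2 * U) * (n.+1%:R + c).
have D0 : 0 <= D.
  by rewrite !mulr_ge0 ?expR_ge0 ?invr_ge0 ?exprn_ge0 ?addr_ge0 ?(ltW c0).
apply: bounded_sums_le (bounded_sumsZ (mulr_ge0 D0 (ltW C0)) (bounded_sums_latpt tau_gt0)).
move=> p; have q0 := normc_ge0 (w p); have X0 := scaled_norm_ge0 p.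
rewrite increment_bound_ge0 andTb.
rewrite -mulrA; apply: le_trans (ler_wpM2l D0 (HC _ q0)).
rewrite mul0r addr0 /D exprD.
have XE : X p * expR (- U) = c * expR (- U) * nc (w p) ^+ 2 by rewrite /X mulrAC.
rewrite /increment_bound XE mulNr.
have h1 : nc (w p) ^+ n.+1 <= (1 + nc (w p)) ^+ n.+1.
  by rewrite lerXn2r ?nnegrE ?addr_ge0// lerDr.
have h2 : n.+1%:R + X p <= (n.+1%:R + c) * (1 + nc (w p)) ^+ 2.
  have : 0 <= n.+1%:R * (2 * nc (w p) + nc (w p) ^+ 2) by rewrite mulr_ge0// addr_ge0 ?mulr_ge0 ?sqr_ge0.
  have : 0 <= c * (1 + 2 * nc (w p)) by rewrite mulr_ge0 ?(ltW c0)// addr_ge0 ?mulr_ge0.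
  by rewrite /X sqrrD expr1n mul1r -mulr_natr; move: (c) (_ ^+ 2) => ? ?; lra.
have h3 : nc (w p) ^+ n.+1 * (n.+1%:R + X p) <=
    (1 + nc (w p)) ^+ n.+1 * ((n.+1%:R + c) * (1 + nc (w p)) ^+ 2).
  by apply: ler_pM => //; rewrite ?exprn_ge0 ?addr_ge0.
rewrite [leLHS](_ : _ = 2 * (c ^+ n.+1 / n`!%:R) * expR (2 * U) *
  expR (- (c * expR (- U) * nc (w p) ^+ 2)) * (nc (w p) ^+ n.+1 * (n.+1%:R + X p)));
  last by move: (expR _) (c ^+ n.+1) => ? ?; ring.
rewrite [leRHS](_ : _ = 2 * (c ^+ n.+1 / n`!%:R) * expR (2 * U) *
  expR (- (c * expR (- U) * nc (w p) ^+ 2)) *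
  ((1 + nc (w p)) ^+ n.+1 * ((n.+1%:R + c) * (1 + nc (w p)) ^+ 2))); last first.
  move: (expR (- _)) (expR (2 * U)) (c ^+ n.+1) (c) ((1 + nc (w p)) ^+ n.+1)
    ((1 + nc (w p)) ^+ 2) => ? ? ? ? ? ?; ring.
apply: ler_wpM2l h3.
by rewrite !mulr_ge0 ?expR_ge0 ?invr_ge0 ?exprn_ge0 ?(ltW c0).
Qed.

(** Since the derivative series has sum 0, an increment of the sum is a sum of second-order
    remainders, at most M (v - u)^2. The same remark carries convergence from u = 0 to every u in
    [-U, 0]. *)
Lemma has_sum_split_term_cst (U : R) S : 0 <= U ->
  has_sum (split_term 0) S -> has_sum (split_term (- U)) S.
Proof.
move=> U0 HS.
have [Mb0 [M HM]] := bounded_sums_increment_bound U.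
have M0 : 0 <= M by have := HM fset0%fset; rewrite big_seq_fset0.
have inc u v : - U <= u -> u <= v -> v <= 0 ->
    abs_summable (fun p => split_term v p - split_term u p - (v - u)%:C * split_deriv u p).
  move=> Uu uv v0; apply: (@bounded_sums_le _ _ _ (fun p => (v - u) ^+ 2 * increment_bound U p)).
    by move=> p; rewrite normc_ge0 [leRHS]mulrC; exact: split_term_increment.
  by apply: bounded_sumsZ; [exact: sqr_ge0|exact: bounded_sums_increment_bound].
(* The bounds on u stand under the existential, so that [choice] yields a function on all of [R];
   outside [-U, 0] its value is arbitrary. *)
have ex u : exists s, - U <= u -> u <= 0 -> has_sum (split_term u) s.
  have [/andP[Uu u0]|h] := boolP ((- U <= u) && (u <= 0)); last first.
    by exists 0 => h1 h2; rewrite h1 h2 in h.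
  have [s Hs] := abs_summable_has_sum (inc u 0 Uu u0 (lexx 0)).
  exists (S - s) => _ _; have := has_sumB HS (has_sumD Hs (has_sumZ (0 - u)%:C (has_sum_split_deriv u))).
  rewrite mulr0 addr0; congr has_sum; apply/funext => p; ring.
have [K HK] := choice ex.
have KU := HK (- U) (lexx _); rewrite oppr_le0 in KU; have {}KU := KU U0.
have K0 := HK 0; rewrite oppr_le0 in K0; have {}K0 := K0 U0 (lexx 0).
suff e : K (- U) = K 0 by rewrite (has_sum_uniq HS K0) -e.
apply: (quadratic_increments_cst U0 M0) => u v Uu uv v0.
have := has_sumB (has_sumB (HK v (le_trans Uu uv) v0) (HK u Uu (le_trans uv v0)))
  (has_sumZ (v - u)%:C (has_sum_split_deriv u)).
rewrite mulr0 subr0 => /has_sum_norm_le; apply => A.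
apply: (@le_trans _ _ (\sum_(p <- A) increment_bound U p * (v - u) ^+ 2)).
  by apply: ler_sum => p _; exact: split_term_increment.
by rewrite -mulr_suml ler_wpM2r ?sqr_ge0.
Qed.

End Interpolation.

(** * The limit t -> 0 *)

Section Asymptotics.
Variables (R : realType) (tau : R[i]).
Hypothesis tau_gt0 : 0 < complex.Im tau.
Local Notation w := (latpt tau).
Local Notation c := (pi / complex.Im tau).

Lemma inv_latpt_le : exists2 K : R, 0 < K & forall p, nc (w p)^-1 <= K / (1 + nc (w p)).
Proof.
have [K K0 H] := latpt_inv_le tau_gt0; exists (K + 1); first by rewrite addr_gt0.
move=> p; have w1 : 0 < 1 + nc (w p) by rewrite ltr_wpDr ?normc_ge0.
rewrite ler_pdivlMr// mulrDr mulr1; apply: lerD => //.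
have [w0|w0] := eqVneq (w p) 0; first by rewrite w0 Normc.normc0 mulr0.
by rewrite Normc.normcV mulVf ?normc_eq0.
Qed.

Lemma expR_Nk_cvg0 (x : R) : 0 < x -> expR (- (x * expR k%:R)) @[k --> \oo] --> (0 : R).
Proof.
move=> x0.
have H : x^-1 * (k.+1%:R)^-1 @[k --> \oo] --> (0 : R).
  rewrite -[X in _ --> X](mulr0 x^-1); apply: cvgM; first exact: cvg_cst.
  exact: cvg_harmonic.
apply: (squeeze_cvgr _ (cvg_cst (0 : R)) H); apply: nearW => k.
rewrite expR_ge0 /= expRN -invfM lef_pV2 ?posrE ?expR_gt0 ?mulr_gt0//.
apply: le_trans (_ : x * expR k%:R <= _).
  by rewrite ler_wpM2l ?(ltW x0)// -natr1 addrC expR_ge1Dx.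
by apply: le_trans (expR_ge1Dx _); rewrite lerDr.
Qed.

Lemma gammaQ_cvg1 n (x : R) : gammaQ n (x * expR (- k%:R)) @[k --> \oo] --> (1 : R).
Proof.
rewrite -[X in _ --> X](gammaQ0 R n); apply: continuous_cvg.
  by apply: differentiable_continuous; apply/derivable1_diffP;
    exact: (@ex_derive _ _ _ _ _ _ _ (is_derive_gammaQ n 0)).
rewrite -[X in _ --> X](mulr0 x); apply: cvgM; first exact: cvg_cst.
exact: cvgn_expR.
Qed.

Lemma split_term_cvg n p : (0 < n)%N ->
  ccvg (fun k => split_term tau n (- k%:R) p) (w p ^+ n.+1)^-1.
Proof.
move=> n0; rewrite -[X in ccvg _ X]addr0; apply: ccvgD.
  rewrite -[X in ccvg _ X]mul1r; apply: ccvgM; last exact: ccvg_cst.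
  exact: (ccvg_real (gammaQ_cvg1 n _)).
have [w0|w0] := eqVneq (w p) 0.
  under eq_fun do rewrite w0 invr0 mulr0 mulr0 mul0r.
  exact: ccvg_cst.
rewrite -[X in ccvg _ X](mulr0 ((c ^+ n / n`!%:R)%:C * (conjc (w p) ^+ n / w p))).
apply: ccvgZ; apply: ccvg_real; under eq_fun do rewrite opprK.
apply: expR_Nk_cvg0; rewrite mulr_gt0 ?exprn_gt0 ?normc_gt0//.
by rewrite divr_gt0 ?pi_gt0.
Qed.

(** The bound is uniform in k because 0 <= [gammaQ] <= 1 and e^k >= 1. Its first part is summable
    over the lattice only for n >= 2, which leaves out weight 2. *)
Lemma split_term_le n k p : nc (split_term tau n (- k%:R) p) <=
  nc (w p)^-1 ^+ n.+1 + (c ^+ n / n`!%:R) * nc (gauss_term tau c 1 n p).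
Proof.
have c0 : 0 < c by rewrite divr_gt0 ?pi_gt0.
have x0 : 0 <= c * nc (w p) ^+ 2 by rewrite mulr_ge0 ?sqr_ge0 ?ltW.
apply: le_trans (ler_normcD _ _) _; apply: lerD.
  rewrite Normc.normcM normc_real -exprVn normcX.
  rewrite ler_piMl ?exprn_ge0 ?normc_ge0// ger0_norm ?gammaQ_ge0 ?gammaQ_le1//;
  by rewrite mulr_ge0 ?expR_ge0.
rewrite -(mulrA _%:C) Normc.normcM normc_real ger0_norm; last first.
  by rewrite divr_ge0// exprn_ge0// ltW.
apply: ler_wpM2l; first by rewrite divr_ge0// exprn_ge0// ltW.
rewrite /gauss_term expr1 Normc.normcM [leRHS]Normc.normcM ler_wpM2l ?normc_ge0//.
rewrite !normc_real !ger0_norm ?expR_ge0// ler_expR lerN2 opprK ler_peMr//.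
by rewrite -expR0 ler_expR.
Qed.

Lemma abs_summable_inv_latpt n : (2 < n)%N -> abs_summable (fun p => (w p ^+ n)^-1).
Proof.
move=> n2; have [K K0 HK] := inv_latpt_le; have [L L0 HL] := latpt_inv_le tau_gt0.
apply: (abs_summable_latpt tau_gt0 (C := K ^+ 3 * L ^+ (n - 3))).
  by rewrite mulr_ge0 ?exprn_ge0 ?ltW.
move=> p; rewrite -exprVn normcX -{1}(subnKC n2) exprD [leRHS]mulrAC.
have w1 : 0 <= 1 + nc (w p) by rewrite addr_ge0 ?normc_ge0.
have i0 := normc_ge0 (w p)^-1.
apply: ler_pM; [exact: exprn_ge0|exact: exprn_ge0| |].
  rewrite -exprVn -exprMn lerXn2r ?nnegrE ?normc_ge0//.
  by rewrite divr_ge0// ltW.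
by rewrite lerXn2r ?nnegrE ?normc_ge0// ltW.
Qed.

Lemma has_sum_eisenstein n S : (1 < n)%N -> odd n ->
  has_sum (split_term tau n 0) S -> has_sum (fun p => (w p ^+ n.+1)^-1) S.
Proof.
move=> n1 on HS; have inv := abs_summable_inv_latpt (n1 : (2 < n.+1)%N).
have [S' HS'] := abs_summable_has_sum inv.
suff -> : S = S' by [].
have c0 : 0 < c by rewrite divr_gt0 ?pi_gt0.
have HK k : has_sum (split_term tau n (- k%:R)) S by exact: has_sum_split_term_cst.
have dom : bounded_sums (fun p => nc (w p)^-1 ^+ n.+1 +
    (c ^+ n / n`!%:R) * nc (gauss_term tau c 1 n p)).
  apply: bounded_sumsD.
    by move: inv; congr bounded_sums; apply/funext => p; rewrite -exprVn normcX.
  apply: bounded_sumsZ; first by rewrite divr_ge0// exprn_ge0// ltW.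
  exact: abs_summable_gauss_term.
have := has_sum_tannery dom _ _ HK HS'.
move=> T; apply: ccvg_uniq (@ccvg_cst R S) (T _ _).
  by exists 0%N => k p _; exact: split_term_le.
by move=> p; apply: split_term_cvg; exact: ltnW.
Qed.

End Asymptotics.

Section ExpBounds.
Variable R : realType.

(** The second-order remainder is at most d^2 for d >= 0 and at most d^2 e^(-d) for d < 0; the sum
    covers both signs. *)
Lemma expR_taylor_le (d : R) :
  `|expR (- d) - 1 + d| <= d ^+ 2 * (1 + expR (- d)).
Proof.
have e0 := expR_ge0 (- d); have d20 := sqr_ge0 d.
have eD (x : R) : is_derive x (1 : R) (fun x => expR (- x)) (- expR (- x)).
  by apply: is_derive_eq; rewrite /GRing.scale /=; ring.
have eDD (x : R) : is_derive x (1 : R) (fun x => - expR (- x)) (expR (- x)).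
  by apply: is_derive_eq; rewrite /GRing.scale /=; ring.
have [d0|d0] := leP 0 d.
  have := @taylor2_le R _ _ _ 1 0 d ler01 d0 eD eDD _.
  rewrite !oppr0 expR0 !addr0 mulrN1 opprK mul1r => H.
  apply: le_trans (H _) _; last by rewrite ler_peMr// lerDl.
  by move=> x /andP[x0 _]; rewrite ger0_norm ?expR_ge0// -expR0 ler_expR oppr_le0.
have := cexp_taylor2 (- d)%:C; rewrite cexp_real.
rewrite -[1 + _]/(1%:C + _) -rmorphD -rmorphB !normc_real normrN real_normK ?num_real//.
rewrite opprD opprK addrA (ltr0_norm d0) => h; apply: le_trans h _.
by rewrite ler_wpM2l// lerDr.
Qed.

Lemma mul_expRN_le1 (x : R) : x * expR (- x) <= 1.
Proof.
rewrite expRN ler_pdivrMr ?expR_gt0// mul1r.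
by apply: le_trans (expR_ge1Dx x); rewrite lerDr.
Qed.

Lemma sqr_mul_expRN_le2 (x : R) : 0 <= x -> x ^+ 2 * expR (- x) <= 2.
Proof.
move=> x0; rewrite expRN ler_pdivrMr ?expR_gt0//.
have := expR_ge1Dxn 1 x0; rewrite (_ : 2`!%:R = 2)//; lra.
Qed.

Lemma gammaQ1 (x : R) : gammaQ 1 x = expR (- x) * (1 + x).
Proof.
rewrite /gammaQ horner_poly !big_ord_recl big_ord0 /= expr0 expr1 !invr1.
by rewrite !mul1r addr0.
Qed.

End ExpBounds.

(** * Weight two: regularization along the shift by 1 *)

Section WeightTwo.
Variables (R : realType) (tau : R[i]).
Hypothesis tau_gt0 : 0 < complex.Im tau.
Local Notation w := (latpt tau).
Local Notation c := (pi / complex.Im tau).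

Lemma latpt_shift p : w (p.1, p.2 + 1) = w p + 1.
Proof. by rewrite /latpt /= intrD addrA. Qed.

(* Adding [a e^(- a |w|^2)] and subtracting the difference of [e^(- a |w|^2) / w]
   along the shift [w |-> w + 1] makes the conditionally convergent series
   absolutely convergent uniformly in [a], because
   [- d/dx (e^(- a |w + x|^2) / (w + x))] at [x = 0] is
   [(1 + a |w|^2) e^(- a |w|^2) / w^2 + a e^(- a |w|^2)].
   Inverses at 0 being 0, the formula needs no exception. *)
Definition regularized_term (a : R) (p : int * int) : R[i] :=
  (gammaQ 1 (a * nc (w p) ^+ 2))%:C / w p ^+ 2
  + a%:C * (expR (- (a * nc (w p) ^+ 2)))%:C
  - (expR (- (a * nc (w p) ^+ 2)))%:C / w p
  + (expR (- (a * nc (w p + 1) ^+ 2)))%:C / (w p + 1).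

Lemma regularized_summand_le (a : R) (v : R[i]) K : 0 < a -> 0 < K ->
  v != 0 -> v + 1 != 0 -> 1 <= K * nc v -> 1 <= K * nc (v + 1) ->
  nc ((gammaQ 1 (a * nc v ^+ 2))%:C / v ^+ 2
     + a%:C * (expR (- (a * nc v ^+ 2)))%:C
     - (expR (- (a * nc v ^+ 2)))%:C / v
     + (expR (- (a * nc (v + 1) ^+ 2)))%:C / (v + 1)) <=
  (2 * (nc v)^-1 ^+ 2 + 2 * (2 + K) ^+ 2 * ((nc v)^-1 ^+ 2 + (nc (v + 1))^-1 ^+ 2))
    * (nc (v + 1))^-1.
Proof.
move=> a0 K0 v0 v1 Kv Kv1.
have nv : 0 < nc v by rewrite normc_gt0.
have nv1 : 0 < nc (v + 1) by rewrite normc_gt0.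
set x := a * nc v ^+ 2; set x' := a * nc (v + 1) ^+ 2.
have x0 : 0 <= x by rewrite mulr_ge0 ?sqr_ge0 ?ltW.
have x0' : 0 <= x' by rewrite mulr_ge0 ?sqr_ge0 ?ltW.
pose d := x' - x; pose e := expR (- x).
have e'E : expR (- x') = e * expR (- d).
  by rewrite /e /d -expRD; congr expR; ring.
have xC : x%:C = a%:C * (v * conjc v) by rewrite sqr_normc_conj -rmorphM.
have dC : d%:C = a%:C * (v + conjc v + 1).
  have x'C : x'%:C = a%:C * ((v + 1) * conjc (v + 1)) by rewrite sqr_normc_conj -rmorphM.
  have cj : conjc (v + 1) = conjc v + 1 by rewrite rmorphD rmorph1.
  rewrite rmorphB /= xC x'C cj.
  move: (conjc v) (a%:C) => ? ?; ring.
(* Because d = a (v + conj(v) + 1) and x = a v conj(v), the summand a e^(-x) cancels the part linear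
   in d; what remains has cubic decay. *)
have -> : (gammaQ 1 x)%:C / v ^+ 2 + a%:C * e%:C - e%:C / v + (expR (- x'))%:C / (v + 1)
  = e%:C / (v ^+ 2 * (v + 1)) + (x * e)%:C / (v ^+ 2 * (v + 1))
    + (e * (expR (- d) - 1 + d))%:C / (v + 1).
  rewrite gammaQ1 -/e e'E; move: (expR (- d)) => f.
  move: (e) (x) (d) xC dC => e' y d' yC dC'.
  rewrite !(rmorphD, rmorphM, rmorphB, rmorphN, rmorph1) /= yC dC'.
  move: (conjc v) (a%:C) (e'%:C) (f%:C) (v) v0 v1 => ? ? ? ? u v0 v1.
  by field; rewrite v0 v1.
have e0 : 0 <= e by exact: expR_ge0.
have e1 : e <= 1 by rewrite -expR0 ler_expR oppr_le0.
have i0 : 0 <= (nc (v + 1))^-1 by rewrite invr_ge0 ltW.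
rewrite mulrDl; apply: le_trans (ler_normcD _ _) _; apply: lerD.
  apply: le_trans (ler_normcD _ _) _.
  rewrite !(Normc.normcM _ (_^-1)) !Normc.normcV !(Normc.normcM (v ^+ 2)) !normcX.
  rewrite !normc_real (ger0_norm e0) (ger0_norm (mulr_ge0 x0 e0)).
  have xe := mul_expRN_le1 x; rewrite -/e in xe.
  have : 0 <= (nc v ^+ 2 * nc (v + 1))^-1 by rewrite invr_ge0 mulr_ge0 ?sqr_ge0 ?ltW.
  move=> q0; rewrite [leRHS](_ : _ = 2 * (nc v ^+ 2 * nc (v + 1))^-1); last first.
    by rewrite exprVn -mulrA -invfM.
  move: (_^-1) q0 => q q0; nra.
rewrite Normc.normcM Normc.normcV ler_wpM2r// normc_real normrM (ger0_norm e0).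
(* |d| is at most a constant times a |u|, and y^2 e^(-y) <= 2 at y = a |u|^2 removes a. Both u = v
   and u = v + 1 are needed, since e^(-x) (1 + e^(-d)) = e^(-x) + e^(-x'). *)
have dle (u : R[i]) : u != 0 -> 1 <= K * nc u ->
    `|d| <= a * (2 * nc u + 1) -> d ^+ 2 * expR (- (a * nc u ^+ 2)) <=
    2 * (2 + K) ^+ 2 * (nc u)^-1 ^+ 2.
  move=> u0 Ku du; have nu : 0 < nc u by rewrite normc_gt0.
  have au0 : 0 <= a * nc u ^+ 2 by rewrite mulr_ge0 ?sqr_ge0 ?ltW.
  have h : `|d| <= (2 + K) * (a * nc u ^+ 2) * (nc u)^-1.
    apply: le_trans du _; rewrite expr2 !mulrA mulfK ?gt_eqF//.
    rewrite [_ * a]mulrC -mulrA ler_pM2l// mulrDl; lra.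
  have : d ^+ 2 <= ((2 + K) * (a * nc u ^+ 2) * (nc u)^-1) ^+ 2.
    rewrite -[d ^+ 2]real_normK ?num_real// lerXn2r ?nnegrE//.
    exact: le_trans (normr_ge0 _) h.
  move=> /(ler_wpM2r (expR_ge0 (- (a * nc u ^+ 2)))) /le_trans; apply.
  have := sqr_mul_expRN_le2 au0; move: (a * nc u ^+ 2) => y h2.
  move: (expR _) ((nc u)^-1) h2 => f q h2.
  rewrite [leLHS](_ : _ = (y ^+ 2 * f) * ((2 + K) * q) ^+ 2); last by ring.
  rewrite [leRHS](_ : _ = 2 * ((2 + K) * q) ^+ 2); last by ring.
  by rewrite ler_wpM2r ?sqr_ge0.
have dv : `|d| <= a * (2 * nc v + 1).
  have -> : d = a * (2 * complex.Re v + 1).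
    apply: (@complexI R); rewrite dC; case: (v) => r s; simpc.
    by congr (_ +i* _); rewrite /=; ring.
  rewrite normrM gtr0_norm// ler_pM2l//; apply: le_trans (ler_normD _ _) _.
  by rewrite normr1 lerD2r normrM ger0_norm// ler_pM2l// normc_Re.
have dv1 : `|d| <= a * (2 * nc (v + 1) + 1).
  have -> : d = a * (2 * complex.Re (v + 1) - 1).
    apply: (@complexI R); rewrite dC; case: (v) => r s; simpc.
    by congr (_ +i* _); rewrite /=; ring.
  rewrite normrM gtr0_norm// ler_pM2l//; apply: le_trans (ler_normB _ _) _.
  by rewrite normr1 lerD2r normrM ger0_norm// ler_pM2l// normc_Re.
apply: le_trans (ler_wpM2l e0 (expR_taylor_le d)) _.
rewrite mulrCA mulrDr mulr1 -e'E mulrDr [leRHS]mulrDr.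
by apply: lerD; apply: dle.
Qed.

End WeightTwo.

Section WeightTwoLimit.
Variables (R : realType) (tau : R[i]).
Hypothesis tau_gt0 : 0 < complex.Im tau.
Local Notation w := (latpt tau).
Local Notation c := (pi / complex.Im tau).

Lemma covolume_scale_gt0 : 0 < c.
Proof. by rewrite divr_gt0 ?pi_gt0. Qed.

Lemma regularized_term_le : exists2 C : R, 0 <= C & forall a p, 0 < a <= c ->
  nc (regularized_term tau a p) <= C * ((1 + nc (w p)) ^+ 3)^-1.
Proof.
have c0 := covolume_scale_gt0.
have [K K0 HK] := latpt_inv_le tau_gt0; have [L L0 HL] := inv_latpt_le tau_gt0.
pose B : R := 2 * (2 + K) ^+ 2.
have B0 : 0 <= B by rewrite mulr_ge0 ?sqr_ge0.
(* [C1] serves the regular points, through 1/|w| <= L / (1 + |w|) and 1/|w + 1| <= 2 L / (1 + |w|).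
   [C2] serves w = 0 and w = -1, where (1 + |w|)^3 <= 8 and the four summands are bounded one by
   one. *)
pose C1 : R := (2 * L ^+ 2 + B * (L ^+ 2 + (2 * L) ^+ 2)) * (2 * L).
pose C2 : R := 8 * (K ^+ 2 + c + K + K).
have C10 : 0 <= C1.
  apply: mulr_ge0; last by rewrite mulr_ge0 ?ltW.
  by apply: addr_ge0; apply: mulr_ge0 => //; rewrite ?addr_ge0 ?sqr_ge0.
have C20 : 0 <= C2.
  by rewrite mulr_ge0// addr_ge0 ?(ltW K0)// addr_ge0 ?(ltW K0)// addr_ge0 ?sqr_ge0 ?(ltW c0).
exists (C1 + C2) => [|a p /andP[a0 ac]]; first exact: addr_ge0.
have w0 := normc_ge0 (w p).
have q0 : 0 < 1 + nc (w p) by rewrite ltr_wpDr.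
have w1E := latpt_shift tau p.
have inv_ge1 (v : R[i]) : v != 0 -> nc v^-1 <= K -> 1 <= K * nc v.
  move=> v0; rewrite Normc.normcV -[X in X <= _ -> _]mul1r ler_pdivrMr ?normc_gt0//.
have HK1 := HK (p.1, p.2 + 1); rewrite w1E in HK1.
have HL1 := HL (p.1, p.2 + 1); rewrite w1E in HL1.
have near1 : 1 + nc (w p) <= 2 * (1 + nc (w p + 1)).
  have := ler_normcD (w p + 1) (- 1); rewrite addrK normcN Normc.normc1.
  have := normc_ge0 (w p + 1); lra.
have [regular|] := boolP ((w p != 0) && (w p + 1 != 0)).
  have /andP[v0 v1] := regular.
  have h := regularized_summand_le a0 K0 v0 v1 (inv_ge1 _ v0 (HK p)) (inv_ge1 _ v1 HK1).
  rewrite /regularized_term; apply: le_trans h _.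
  have i0 : 0 <= (nc (w p))^-1 by rewrite invr_ge0.
  have i1 : 0 <= (nc (w p + 1))^-1 by rewrite invr_ge0 normc_ge0.
  set q := (1 + nc (w p))^-1.
  have qpos : 0 <= q by rewrite invr_ge0 ltW.
  have b0 : (nc (w p))^-1 <= L * q by rewrite -Normc.normcV; exact: HL.
  have b1 : (nc (w p + 1))^-1 <= 2 * L * q.
    rewrite -Normc.normcV; apply: le_trans HL1 _.
    rewrite [2 * L]mulrC -mulrA ler_pM2l// -[2]invrK -invfM.
    rewrite lef_pV2 ?posrE ?mulr_gt0 ?invr_gt0//; last by rewrite ltr_wpDr ?normc_ge0.
    by rewrite mulrC ler_pdivrMr// mulrC.
  have sq (x y : R) : 0 <= x -> x <= y -> x ^+ 2 <= y ^+ 2.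
    by move=> x0 xy; rewrite lerXn2r ?nnegrE// (le_trans x0).
  have s0 := sq _ _ i0 b0; have s1 := sq _ _ i1 b1.
  apply: le_trans (_ : C1 * q ^+ 3 <= _); last first.
    by rewrite -exprVn ler_wpM2r ?exprn_ge0// lerDl.
  rewrite [leRHS](_ : _ = (2 * (L * q) ^+ 2 + B * ((L * q) ^+ 2 + (2 * L * q) ^+ 2))
    * (2 * L * q)); last by rewrite /C1; move: (B) => ?; ring.
  apply: ler_pM => //.
    by apply: addr_ge0; apply: mulr_ge0; rewrite ?addr_ge0 ?sqr_ge0.
  apply: lerD; apply: ler_wpM2l => //; exact: lerD.
rewrite negb_and !negbK => exc.
have nw1 : nc (w p) <= 1.
  case/orP: exc => /eqP e; first by rewrite e Normc.normc0.
  have -> : w p = - 1 by apply/eqP; rewrite -addr_eq0 e.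
  by rewrite normcN Normc.normc1.
apply: le_trans (_ : K ^+ 2 + c + K + K <= _); last first.
  rewrite ler_pdivlMr ?exprn_gt0//.
  apply: le_trans (_ : (K ^+ 2 + c + K + K) * 8 <= _).
    apply: ler_wpM2l; first by have := C20; rewrite pmulr_rge0.
    have -> : 8 = 2 ^+ 3 :> R by rewrite -natrX.
    by rewrite lerXn2r ?nnegrE ?(ltW q0)//; lra.
  by rewrite [leLHS]mulrC -/C2 lerDr.
have eb (x : R) : 0 <= x -> nc (expR (- x))%:C <= 1.
  by move=> x0; rewrite normc_real ger0_norm ?expR_ge0// -expR0 ler_expR oppr_le0.
have x0 (v : R[i]) : 0 <= a * nc v ^+ 2 by rewrite mulr_ge0 ?sqr_ge0 ?ltW.
rewrite /regularized_term; apply: le_trans (ler_normcD _ _) _; apply: lerD; last first.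
  rewrite Normc.normcM -[leRHS]mul1r; apply: ler_pM; rewrite ?normc_ge0//.
  exact: eb.
apply: le_trans (ler_normcD _ _) _; apply: lerD; last first.
  rewrite normcN Normc.normcM -[leRHS]mul1r; apply: ler_pM; rewrite ?normc_ge0//.
  exact: eb.
apply: le_trans (ler_normcD _ _) _; apply: lerD.
  rewrite Normc.normcM -[leRHS]mul1r; apply: ler_pM; rewrite ?normc_ge0//.
    by rewrite normc_real ger0_norm ?gammaQ_ge0 ?gammaQ_le1.
  by rewrite -exprVn normcX lerXn2r ?nnegrE ?normc_ge0 ?(ltW K0).
rewrite Normc.normcM -[leRHS]mulr1; apply: ler_pM; rewrite ?normc_ge0//.
  by rewrite normc_real gtr0_norm.
exact: eb.
Qed.

(** The limit of the regularized term for a -> 0: w^(-2) plus the difference of 1/w along the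
    shift. *)
Let r0 p : R[i] := (w p ^+ 2)^-1 - (w p)^-1 + (w p + 1)^-1.

Lemma regularized_term_cvg p : ccvg (fun k => regularized_term tau (c * expR (- k%:R)) p) (r0 p).
Proof.
have ak : c * expR (- k%:R) @[k --> \oo] --> (0 : R).
  rewrite -[X in _ --> X](mulr0 c); apply: cvgM; first exact: cvg_cst.
  exact: cvgn_expR.
have ek (x : R) : ccvg (fun k => (expR (- (c * expR (- k%:R) * x)))%:C) 1.
  apply: (ccvg_real (c := 1)).
  rewrite -[X in _ --> X](@expR0 R) -oppr0 -(mul0r x).
  apply: continuous_cvg; first exact: continuous_expR.
  by apply: cvgN; apply: cvgM; [exact: ak|exact: cvg_cst].
rewrite /regularized_term /r0; apply: ccvgD; last first.
  by rewrite -[X in ccvg _ X]mul1r; apply: ccvgM; [exact: ek|exact: ccvg_cst].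
apply: ccvgB; last first.
  by rewrite -[X in ccvg _ X]mul1r; apply: ccvgM; [exact: ek|exact: ccvg_cst].
rewrite -[X in ccvg _ X]addr0; apply: ccvgD.
  rewrite -[X in ccvg _ X]mul1r; apply: ccvgM; last exact: ccvg_cst.
  apply: (ccvg_real (c := 1)).
  under eq_fun do rewrite mulrAC.
  exact: gammaQ_cvg1.
rewrite -(mul0r (1 : R[i])); apply: ccvgM; last exact: ek.
exact: (ccvg_real ak).
Qed.

(** All terms but the one at the origin tend to 0, and they decrease in modulus as k grows, so k = 0
    dominates. *)
Lemma theta_cvg1 (T : nat -> R[i]) :
  (forall k, has_sum (moment_term tau (c / expR (- k%:R)) 0) (T k)) -> ccvg T 1.
Proof.
move=> HT; have c0 := covolume_scale_gt0.
apply: (has_sum_tannery (abs_summable_moment tau_gt0 0 c0) _ _ HT (has_sum1 (0, 0) 1)).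
  exists 0%N => k p _; rewrite !normc_moment_term !expr0 !mul1r ler_expR !mulNr lerN2.
  apply: ler_wpM2r; first exact: sqr_ge0.
  by rewrite -expRN opprK ler_peMr ?(ltW c0)// -expR0 ler_expR.
move=> p; rewrite /moment_term; under eq_fun do rewrite expr0 mul1r.
case: eqVneq => [->|p0].
  rewrite (_ : w (0, 0) = 0); last by apply/eqP; rewrite latpt_eq0.
  rewrite Normc.normc0; under eq_fun do rewrite expr2 !mulr0 oppr0 expR0.
  exact: ccvg_cst.
apply: (ccvg_real (c := 0)).
under eq_fun do rewrite -expRN opprK mulrAC.
apply: expR_Nk_cvg0; rewrite mulr_gt0 ?exprn_gt0// normc_gt0.
by rewrite latpt_eq0.
Qed.

(** For t = e^(-k) the series regularized at a = c t, plus the second half of K, has sum S + c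
    theta_0(1/t). This tends to S + c, while the terms tend to those of [r0] under a common
    majorant. *)
Lemma has_sum_weight2_regularized S :
  has_sum (split_term tau 1 0) S -> abs_summable r0 /\ has_sum r0 (S + c%:C).
Proof.
move=> HS; have c0 := covolume_scale_gt0; have [C C0 HC] := regularized_term_le.
have a0 k : 0 < c * expR (- k%:R) by rewrite mulr_gt0 ?expR_gt0.
have ac k : c * expR (- k%:R) <= c.
  by rewrite ler_piMr ?(ltW c0)// -expR0 ler_expR oppr_le0.
have t0 k : 0 < c / expR (- k%:R) by rewrite divr_gt0 ?expR_gt0.
have HK k : has_sum (split_term tau 1 (- k%:R)) S by exact: has_sum_split_term_cst.
have [SA HA] := choice (fun k => abs_summable_has_sum (abs_summable_moment tau_gt0 0 (a0 k))).
have [SB HB] := choice (fun k => abs_summable_has_sum (abs_summable_moment tau_gt0 0 (t0 k))).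
have SAB k : (c * expR (- k%:R))%:C * SA k = c%:C * SB k.
  have := moment_inversion tau_gt0 (expR_gt0 (- k%:R)) (HA k) (HB k).
  rewrite expr0 mul1r expr0 mulr1 => ->.
  rewrite mulrA -rmorphM mulfK//; by rewrite expR_eq0.
pose V k p := (c ^+ 1 / 1`!%:R)%:C * (conjc (w p) ^+ 1 / w p)
    * (expR (- (c * nc (w p) ^+ 2 * expR (k%:R))))%:C.
(* The shift w |-> w + 1 permutes the lattice, so e^(- a |w|^2) / w and its translate have the same
   sum. *)
have HR k : has_sum (fun p => regularized_term tau (c * expR (- k%:R)) p + V k p) (S + c%:C * SB k).
  have [H HH] := abs_summable_has_sum (abs_summable_gauss_term tau_gt0 1 0 (a0 k)).
  have HH' := has_sum_reindex (h := fun p : int * int => (p.1, p.2 + 1))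
    (h' := fun p => (p.1, p.2 - 1)) _ _ HH.
  have {}HH' : has_sum (gauss_term tau (c * expR (- k%:R)) 1 0 \o
      (fun p : int * int => (p.1, p.2 + 1))) H.
    by apply: HH' => -[m n] /=; rewrite ?addrK ?subrK.
  have := has_sumD (has_sumD (HK k) (has_sumZ (c * expR (- k%:R))%:C (HA k)))
    (has_sumB HH' HH).
  rewrite subrr addr0 SAB; congr has_sum; apply/funext => p.
  rewrite /split_term /regularized_term /V /moment_term /gauss_term /= latpt_shift opprK.
  rewrite !expr0 !expr1 mulrAC; move: (expR (- (c * expR (- k%:R) * _))) => e.
  move: (gammaQ 1 _)%:C (expR (- (c * expR (- k%:R) * nc (w p + 1) ^+ 2)))%:C.
  move: (expR (- (c * nc (w p) ^+ 2 * expR k%:R)))%:C (c / 1`!%:R)%:C.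
  by move: (c * expR (- k%:R))%:C (e%:C) => *; ring.
have cv : ccvg (fun k => S + c%:C * SB k) (S + c%:C).
  apply: ccvgD; first exact: ccvg_cst.
  by rewrite -[X in ccvg _ X]mulr1; apply: ccvgZ; exact: theta_cvg1.
have r0s : abs_summable r0.
  apply: (abs_summable_latpt tau_gt0 C0) => p.
  apply/ler_addgt0Pl => e e0; have /ccvgP/(_ _ e0) [N HN] := regularized_term_cvg p.
  have := HN N (leqnn N); rewrite normcB => h.
  rewrite -[r0 p](subrK (regularized_term tau (c * expR (- N%:R)) p)).
  by apply: le_trans (ler_normcD _ _) _; rewrite lerD// HC// a0 ac.
have [S' HS'] := abs_summable_has_sum r0s.
suff -> : S + c%:C = S' by [].
apply: ccvg_uniq cv _.
have dom : bounded_sums (fun p => C * ((1 + nc (w p)) ^+ 3)^-1 +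
    (c ^+ 1 / 1`!%:R) * nc (gauss_term tau c 1 1 p)).
  apply: bounded_sumsD; first exact: bounded_sumsZ C0 (bounded_sums_latpt tau_gt0).
  apply: bounded_sumsZ; first by rewrite divr_ge0// exprn_ge0// ltW.
  exact: abs_summable_gauss_term.
apply: (has_sum_tannery dom _ _ HR HS').
  exists 0%N => k p _; apply: le_trans (ler_normcD _ _) _; apply: lerD.
    by apply: HC; rewrite a0 ac.
  rewrite /V -(mulrA _%:C) Normc.normcM normc_real ger0_norm; last first.
    by rewrite divr_ge0// exprn_ge0// ltW.
  apply: ler_wpM2l; first by rewrite divr_ge0// exprn_ge0// ltW.
  rewrite /gauss_term expr1 Normc.normcM [leRHS]Normc.normcM ler_wpM2l ?normc_ge0//.
  rewrite !normc_real !ger0_norm ?expR_ge0// ler_expR lerN2 ler_peMr//.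
    by rewrite mulr_ge0 ?sqr_ge0 ?(ltW c0).
  by rewrite -expR0 ler_expR.
move=> p; rewrite -[X in ccvg _ X]addr0; apply: ccvgD; first exact: regularized_term_cvg.
have [w0|w0] := eqVneq (w p) 0.
  rewrite /V; under eq_fun do rewrite w0 invr0 mulr0 mulr0 mul0r.
  exact: ccvg_cst.
rewrite -[X in ccvg _ X](mulr0 ((c ^+ 1 / 1`!%:R)%:C * (conjc (w p) ^+ 1 / w p))).
apply: ccvgZ; apply: (ccvg_real (c := 0)).
by apply: expR_Nk_cvg0; rewrite mulr_gt0 ?exprn_gt0 ?normc_gt0.
Qed.

End WeightTwoLimit.

(** * Eisenstein summation by rows *)

Section EisensteinRows.
Variables (R : realType) (tau : R[i]).
Hypothesis tau_gt0 : 0 < complex.Im tau.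
Local Notation w := (latpt tau).
Local Notation c := (pi / complex.Im tau).

(** Over a window [-N, N) the sum is f(N) - f(-N), which the decay of f makes small. *)
Lemma has_sum_telescope_int (f : int -> R[i]) (C : R) D :
  (forall n, nc (f n) <= C / (1 + `|n%:~R|)) ->
  has_sum (fun n : int => f (n + 1) - f n) D -> D = 0.
Proof.
move=> fC HD; apply/eqP; rewrite -normc_eq0 eq_le normc_ge0 andbT.
apply/ler_addgt0Pl => e e0; rewrite addr0.
have e2 : 0 < e / 2 by rewrite divr_gt0.
have [A HA] := HD _ e2.
have C0 : 0 <= C.
  have := fC 0; rewrite mulr0z normr0 addr0 divr1; exact: le_trans (normc_ge0 _).
have [N0 AN] : exists N, forall i, i \in A -> (`|i| < N)%N.
  exists (\max_(i <- A) `|i|%N).+1 => i iA.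
  by rewrite ltnS; exact: leq_bigmax_seq.
(* [N0] makes the window contain [A]; the other summand makes f(N) and f(-N) at most e / 4. *)
pose N := (N0 + (Num.trunc (4 * C / e)).+1)%N.
have NC : 4 * C / e < N%:R.
  have /truncn_itv/andP[_] : 0 <= 4 * C / e.
    by apply: divr_ge0 (ltW e0); exact: mulr_ge0.
  by move=> /lt_le_trans; apply; rewrite ler_nat /N leq_addl.
pose B := [fset k%:Z - N%:Z | k in iota 0 N.*2]%fset.
have AB : (A `<=` B)%fset.
  apply/fsubsetP => i /AN iN; apply/imfsetP; exists (absz (i + N%:Z)%R).
    by rewrite /= mem_iota /N -addnn; lia.
  rewrite /N; lia.
have := HA _ AB; rewrite big_imfset /=; last by move=> x y _ _; lia.
have -> : undup (iota 0 N.*2) = index_iota 0 N.*2.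
  by rewrite undup_id ?iota_uniq// /index_iota subn0.
have -> : \sum_(0 <= k < N.*2) (f (k%:Z - N%:Z + 1) - f (k%:Z - N%:Z)) =
    f N%:Z - f (- N%:Z).
  rewrite (eq_bigr (fun k => f (k.+1%:Z - N%:Z) - f (k%:Z - N%:Z))); last first.
    by move=> k _; congr (f _ - _); lia.
  rewrite telescope_sumr// sub0r; congr (f _ - _); rewrite -addnn; lia.
move=> h; have fN (i : int) : `|i|%N = N -> nc (f i) <= e / 4.
  move=> iN; apply: le_trans (fC i) _; rewrite -intr_norm -natr_absz iN.
  rewrite ler_pdivrMr ?ltr_wpDr//; move: NC; rewrite ltr_pdivrMr//; lra.
have h1 := fN N%:Z erefl; have h2 := fN (- N%:Z) (abszN _).
have h3 : nc (f N%:Z - f (- N%:Z)) <= e / 2.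
  by apply: le_trans (ler_normcD _ _) _; rewrite normcN; lra.
rewrite -[D](subKr (f N%:Z - f (- N%:Z))).
apply: le_trans (ler_normcD _ _) _; rewrite normcN; lra.
Qed.

(** Within a row the differences of 1/w telescope to 0, so [r0] and w^(-2) have the same row sums.
    Fubini for the summable family [r0] then yields the sum in Eisenstein's order. *)
Lemma has_sum_weight2_rows S : has_sum (split_term tau 1 0) S ->
  exists q : int -> R[i], (forall m, has_sum (fun n => (w (m, n) ^+ 2)^-1) (q m)) /\
    has_sum q (S + c%:C).
Proof.
move=> /(has_sum_weight2_regularized tau_gt0)[r0s Hr].
have [K K0 HK] := inv_latpt_le tau_gt0; have [L L0 HL] := latpt_ge tau_gt0.
have inv_row m n : nc (w (m, n))^-1 <= K * (1 + L) / (1 + `|n%:~R|).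
  apply: le_trans (HK (m, n)) _; rewrite -mulrA ler_pM2l// ler_pdivlMr ?ltr_wpDr//.
  rewrite mulrC ler_pdivrMr ?ltr_wpDr ?normc_ge0//.
  have := HL (m, n); rewrite /=; have := normc_ge0 (w (m, n)).
  have : 0 <= `|m%:~R : R| by [].
  move: (nc _) (`|m%:~R|) (`|n%:~R|) => x y z y0 x0; nra.
have row m : exists s, has_sum (fun n => (w (m, n) ^+ 2)^-1) s.
  apply: abs_summable_has_sum.
  apply: (bounded_sums_le _ (bounded_sumsZ (c := 4 * (K * (1 + L)) ^+ 2) _
    (bounded_sums_decay1 R))); last by rewrite mulr_ge0 ?sqr_ge0.
  move=> n; rewrite normc_ge0 -exprVn normcX /=.
  have h := inv_row m n; set u : R := `|n%:~R| in h *.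
  have u0 : 0 <= u := normr_ge0 _.
  have u1 : 0 < 1 + u by rewrite ltr_wpDr.
  have u2 : 0 < 2 + u by rewrite ltr_wpDr.
  apply: le_trans (_ : (K * (1 + L) / (1 + u)) ^+ 2 <= _).
    by rewrite lerXn2r ?nnegrE ?normc_ge0// (le_trans _ h)// normc_ge0.
  rewrite expr_div_n [leRHS]mulrAC [leRHS]mulrC ler_wpM2l ?sqr_ge0// /decay1 -/u.
  have su : Num.sqrt (2 + u) <= 2 + u.
    have s1 : 1 <= Num.sqrt (2 + u) by rewrite -[leLHS]sqrtr1 ler_wsqrtr//; lra.
    by rewrite -[leRHS](sqr_sqrtr (ltW u2)) expr2 ler_peMr ?sqrtr_ge0.
  have s0 : 0 < Num.sqrt (2 + u) by rewrite sqrtr_gt0.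
  rewrite -[4]invrK -invfM lef_pV2 ?posrE ?exprn_gt0 ?mulr_gt0 ?invr_gt0//.
  have : (2 + u) * Num.sqrt (2 + u) <= (2 + u) * (2 + u) by rewrite ler_pM2l.
  rewrite expr2; nra.
have [q Hq] := choice row; exists q; split=> //.
apply: has_sum_fubini Hr _ => m.
have [s Hs] : exists s, has_sum (fun n => (w (m, n + 1))^-1 - (w (m, n))^-1) s.
  have [t Ht] := abs_summable_has_sum (abs_summable_row m r0s).
  exists (t - q m); have := has_sumB Ht (Hq m); congr has_sum; apply/funext => n.
  by rewrite (latpt_shift tau (m, n)); ring.
have s0 : s = 0.
  by apply: has_sum_telescope_int Hs => n; exact: inv_row.
have := has_sumD (Hq m) Hs; rewrite s0 addr0; congr has_sum; apply/funext => n.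
by rewrite (latpt_shift tau (m, n)); ring.
Qed.

End EisensteinRows.

(** * Assembly *)

Section LatticeReduction.
Variables (R : realType) (w1 w2 : R[i]).
Hypothesis hw : oriented_basis w1 w2.
Local Notation tau := (w2 / w1).
Local Notation l := (latpt tau).

Lemma areaE : area w1 w2 =
  complex.Re w1 * complex.Im w2 - complex.Im w1 * complex.Re w2.
Proof. by rewrite /area; case: w1 w2 => a b [a' b'] /=; ring. Qed.

Lemma w1_neq0 : w1 != 0.
Proof.
apply/eqP => w10; move: hw; rewrite /oriented_basis w10 /=.
by rewrite !mul0r subr0 ltxx.
Qed.

Lemma area_tau : area w1 w2 = nc w1 ^+ 2 * complex.Im tau.
Proof.
have -> : complex.Im tau = complex.Im (conjc w1 * w2) / nc w1 ^+ 2.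
  have -> : tau = ((nc w1 ^+ 2)^-1)%:C * (conjc w1 * w2).
    have cw0 : conjc w1 != 0 by rewrite conjc_eq0 w1_neq0.
    by rewrite fmorphV /= -sqr_normc_conj; field; rewrite cw0 w1_neq0.
  by case: (conjc w1 * w2) => a b /=; rewrite mul0r addr0 mulrC.
by rewrite mulrC divfK// expf_neq0// gt_eqF// normc_gt0 w1_neq0.
Qed.

Lemma Im_tau_gt0 : 0 < complex.Im tau.
Proof.
have : 0 < area w1 w2 by rewrite areaE.
by rewrite area_tau pmulr_rgt0// exprn_gt0// normc_gt0 w1_neq0.
Qed.

Lemma pi_div_area : pi / area w1 w2 = pi / complex.Im tau / nc w1 ^+ 2.
Proof. by rewrite area_tau invfM mulrA mulrAC. Qed.

Lemma latpt_basis (m n : int) : m%:~R * w1 + n%:~R * w2 = w1 * l (n, m).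
Proof. by rewrite /latpt /=; field; exact: w1_neq0. Qed.

(** Im tau > 0 makes Z^2 -> L injective, and f 0 = 0 allows the origin to be included. *)
Lemma lattice_sum_latpt (f : R[i] -> R[i]) S : f 0 = 0 ->
  has_sum (fun p => f (w1 * l p)) S -> lattice_sum w1 w2 f = S.
Proof.
move=> f0 HS; apply: csum_has_sum.
pose h (p : int * int) := w1 * l p.
have lin (p q : int * int) : l p - l q = l (p.1 - q.1, p.2 - q.2).
  by rewrite /latpt /= !intrB; ring.
have hI : injective h.
  move=> p q /(mulfI w1_neq0)/eqP; rewrite -subr_eq0 lin latpt_eq0 ?Im_tau_gt0//.
  case: p q => [a b] [a' b'] /= /eqP[/eqP + /eqP].
  by rewrite !subr_eq0 => /eqP-> /eqP->.
have [h' hh'] : exists h' : R[i] -> int * int, forall v, (exists p, h p = v) -> h (h' v) = v.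
  have ex v : exists q, (exists p, h p = v) -> h q = v.
    have [[p pv]|nv] := pselect (exists p, h p = v); first by exists p.
    by exists (0, 0) => /nv.
  by have [h' hh'] := choice ex; exists h'.
have hK : cancel h h' by move=> p; apply: hI; apply: hh'; exists p.
apply: (has_sum_extend hK) => [v hv|].
  rewrite patchE; case: ifPn => // /set_mem[[m [n vE]] _].
  by move: hv; rewrite hh' ?eqxx//; exists (n, m); rewrite vE /h latpt_basis.
move: HS; congr has_sum; apply/funext => p /=; rewrite patchE -/(h p).
have [->|p0] := eqVneq (h p) 0; first by rewrite f0; case: ifP.
case: ifPn => //; rewrite notin_setE => ninL; exfalso; apply: ninL.
split; last by move/eqP; rewrite (negbTE p0).
by exists p.2, p.1; rewrite latpt_basis; case: (p).
Qed.

Lemma e2_rows (q : int -> R[i]) S :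
  (forall m, has_sum (fun n => (l (m, n) ^+ 2)^-1) (q m)) ->
  has_sum q S -> e2 w1 w2 = S / w1 ^+ 2.
Proof.
move=> Hq HS; rewrite /e2; apply: csum_has_sum; rewrite patch_setT.
rewrite mulrC; have := has_sumZ (w1 ^+ 2)^-1 HS; congr has_sum; apply/funext => m.
apply/esym/csum_has_sum; have := has_sumZ (w1 ^+ 2)^-1 (Hq m).
congr has_sum; apply/funext => n.
rewrite patchE -invfM -exprMn -latpt_basis addrC; case: ifPn => //.
(* The only pair left out of the sums in [e2] is (0, 0), where 1/0 = 0. *)
rewrite notin_setE => h; have [m0 n0] : m = 0 /\ n = 0.
  have [m0|/eqP m0] := eqVneq m 0; last by exfalso; apply: h => /m0.
  by split=> //; apply: contrapT => n0; apply: h.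
by rewrite m0 n0 !mul0r addr0 expr0n /= invr0.
Qed.

Lemma norm_scaling p :
  pi / area w1 w2 * nc (w1 * l p) ^+ 2 = pi / complex.Im tau * nc (l p) ^+ 2.
Proof.
rewrite pi_div_area Normc.normcM exprMn mulrA divfK// expf_neq0//.
by rewrite gt_eqF// normc_gt0 w1_neq0.
Qed.

(** Homogeneity: |w1|^(-2 a) conj(w1)^a / w1^b = w1^(-a-b). *)
Lemma f_latpt (a b : nat) G : (0 < b)%N ->
  has_sum (gauss_term tau (pi / complex.Im tau) b a) G ->
  f_ w1 w2 a b = (pi / complex.Im tau)%:C ^+ a * G / w1 ^+ (a + b).
Proof.
move=> b0 HG.
have -> : f_ w1 w2 a b = (pi / area w1 w2)%:C ^+ a * lattice_sum w1 w2 (fun w =>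
    conjc w ^+ a / w ^+ b * (expR (- (pi / area w1 w2 * nc w ^+ 2)))%:C) by [].
rewrite (@lattice_sum_latpt _ (conjc w1 ^+ a / w1 ^+ b * G)).
- rewrite pi_div_area; move: (pi / complex.Im tau) => q.
  rewrite fmorph_div /= -sqr_normc_conj; have w0 := w1_neq0.
  have cw0 : conjc w1 != 0 by rewrite conjc_eq0.
  rewrite exprMn exprVn exprMn exprD.
  by field; rewrite !expf_neq0.
- by rewrite /= [0 ^+ b]expr0n eqn0Ngt b0 invr0 mulr0 mul0r.
have := has_sumZ (conjc w1 ^+ a / w1 ^+ b) HG; congr has_sum; apply/funext => p.
rewrite /gauss_term norm_scaling rmorphM /= !exprMn invfM mulrA; congr (_ * _).
by rewrite mulrACA.
Qed.

End LatticeReduction.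

Section Assembly.
Variable R : realType.

Lemma horner_P (N : nat) (x : R) : (P_ R N).[x] =
  2 / N`!%:R * x ^+ N + \sum_(2 <= m < N.+2) (N.+1 - m)`!%:R^-1 * x ^+ (N.+1 - m).
Proof.
rewrite /P_ hornerD hornerZ hornerXn horner_sum; congr (_ + _).
by apply: eq_bigr => m _; rewrite hornerZ hornerXn.
Qed.

(** This explains the doubled top coefficient of [P_]: one copy completes the truncated exponential
    to [gammaQ N], the other is the second half of K(1). The sum over m is the truncated exponential
    read backwards, with j = N + 1 - m. *)
Lemma expR_horner_P (N : nat) (x : R) : (0 < N)%N ->
  expR (- x) * (P_ R N).[x] = gammaQ N x + x ^+ N / N`!%:R * expR (- x).
Proof.
move=> N0; rewrite /gammaQ [X in _ + X]mulrC -mulrDr; congr (_ * _).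
rewrite horner_P expTS hornerD hornerZ hornerXn.
have -> : \sum_(2 <= m < N.+2) (N.+1 - m)`!%:R^-1 * x ^+ (N.+1 - m) = (expT R N).[x].
  rewrite horner_poly -(big_mkord xpredT (fun j => (j`!%:R)^-1 * x ^+ j)).
  rewrite [RHS]big_nat_rev /= -{1}[2%N]add0n big_addn.
  have -> : (N.+2 - 2 = N)%N by lia.
  rewrite big_nat [RHS]big_nat; apply: eq_bigr => m /andP[_ mN].
  by have -> : (N.+1 - (m + 2) = 0 + N - m.+1)%N by lia.
by ring.
Qed.

End Assembly.

Theorem theorem1p2p1 (R : realType) (n : nat) (hn : (2 <= n)%N)
    (even_n : ~~ odd n) (w1 w2 : R[i]) (hw : oriented_basis w1 w2) :
  estar w1 w2 n =
    2 / (n.-1)`!%:R * f_ w1 w2 (n%:Z - 1) 1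
    + \sum_(2 <= m < n.+1) ((n - m)`!%:R)^-1 * f_ w1 w2 (n%:Z - m%:Z) m%:Z
  /\
  2 / (n.-1)`!%:R * f_ w1 w2 (n%:Z - 1) 1
    + \sum_(2 <= m < n.+1) ((n - m)`!%:R)^-1 * f_ w1 w2 (n%:Z - m%:Z) m%:Z =
  lattice_sum w1 w2 (fun w =>
    ((P_ R n.-1).[pi / area w1 w2 * Normc.normc w ^+ 2])%:C / w ^+ n *
    (expR (- (pi / area w1 w2 * Normc.normc w ^+ 2)))%:C).
Proof.
pose tau := w2 / w1; have tau0 : 0 < complex.Im tau := Im_tau_gt0 hw.
have w10 := w1_neq0 hw.
case: n hn even_n => [|N] // N0; rewrite /= negbK => oddN.
have {}N0 : (0 < N)%N by [].
have [c cE] : exists c, c = pi / complex.Im tau by exists (pi / complex.Im tau).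
have c0 : 0 < c by rewrite cE divr_gt0 ?pi_gt0.
have ex b a := abs_summable_has_sum (abs_summable_gauss_term tau0 b a c0).
have ex2 b : exists g, forall a, has_sum (gauss_term tau c b a) (g a).
  by have [g Hg] := choice (ex b); exists g.
have [G HG] := choice ex2.
pose T p : R[i] := ((P_ R N).[c * nc (latpt tau p) ^+ 2])%:C / latpt tau p ^+ N.+1 *
  (expR (- (c * nc (latpt tau p) ^+ 2)))%:C.
pose S : R[i] := 2 / N`!%:R * (c%:C ^+ N * G 1%N N) +
  \sum_(2 <= m < N.+2) (N.+1 - m)`!%:R^-1 * (c%:C ^+ (N.+1 - m) * G m (N.+1 - m)%N).
(* From |w|^2 = w conj(w); at the origin both sides vanish because b > 0. *)
have powE a b p : (a + b = N.+1)%N -> (0 < b)%N ->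
    ((c * nc (latpt tau p) ^+ 2) ^+ a)%:C / latpt tau p ^+ N.+1 =
    c%:C ^+ a * (conjc (latpt tau p) ^+ a / latpt tau p ^+ b).
  move=> ab b0; have [l0|l0] := eqVneq (latpt tau p) 0.
    by rewrite l0 !expr0n /= eqn0Ngt b0 !invr0 !mulr0.
  rewrite rmorphXn rmorphM /= -sqr_normc_conj -ab exprD exprMn exprMn.
  by field; rewrite !expf_neq0.
have HT : has_sum T S.
  have := has_sumD (has_sumZ (2 / N`!%:R * c%:C ^+ N) (HG 1%N N))
    (@has_sum_sum _ _ _ (index_iota 2 N.+2) xpredT _ _ (fun m _ =>
      has_sumZ ((N.+1 - m)`!%:R^-1 * c%:C ^+ (N.+1 - m)) (HG m (N.+1 - m)%N))).
  congr has_sum; last first.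
    by rewrite /S mulrA; congr (_ + _); apply: eq_bigr => m _; exact/esym/mulrA.
  apply/funext => p; rewrite /T horner_P /gauss_term.
  rewrite (rmorphD (real_complex R)) (rmorph_sum (real_complex R)).
  rewrite [in RHS]mulrDl [in RHS]mulrDl.
  rewrite mulr_suml mulr_suml; congr (_ + _).
    rewrite (rmorphM (real_complex R)) /= -(mulrA _%:C) (powE N 1%N) ?addn1//.
    by rewrite rmorphM fmorphV !rmorph_nat; ring.
  rewrite big_nat [RHS]big_nat; apply: eq_bigr => m /andP[m2 mN].
  rewrite rmorphM /= -(mulrA _%:C) (powE (N.+1 - m)%N m); [|lia|lia].
  by rewrite fmorphV rmorph_nat; ring.
have fE m : (0 < m <= N.+1)%N ->
    f_ w1 w2 (N.+1%:Z - m%:Z) m%:Z = c%:C ^+ (N.+1 - m) * G m (N.+1 - m)%N / w1 ^+ N.+1.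
  move=> /andP[m0 mN]; rewrite subzn//.
  have H := HG m (N.+1 - m)%N; rewrite cE in H.
  by rewrite (f_latpt hw m0 H) -cE subnK.
have -> : 2 / N`!%:R * f_ w1 w2 (N.+1%:Z - 1) 1 +
    \sum_(2 <= m < N.+2) (N.+1 - m)`!%:R^-1 * f_ w1 w2 (N.+1%:Z - m%:Z) m%:Z =
    S / w1 ^+ N.+1.
  rewrite (fE 1%N)// subSS subn0 /S [in RHS]mulrDl [in RHS]mulr_suml; congr (_ + _).
    by rewrite !mulrA.
  rewrite big_nat [RHS]big_nat; apply: eq_bigr => m /andP[m2 mN].
  by rewrite fE ?mulrA//; lia.
split; last first.
  apply/esym/(lattice_sum_latpt hw).
    by rewrite expr0n /= invr0 mulr0 mul0r.
  have := has_sumZ (w1 ^+ N.+1)^-1 HT; rewrite [_^-1 * S]mulrC; congr has_sum.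
  apply/funext => p; rewrite (norm_scaling hw) -cE /T [(w1 * _) ^+ _]exprMn invfM.
  by move: (_.[_]%:C) (expR _)%:C => y e; ring.
(* The Gaussian sum is K(1), that is u = 0. *)
have TK : T = split_term tau N 0.
  apply/funext => p; rewrite /T /split_term -cE oppr0 expR0 !mulr1.
  set x := c * nc (latpt tau p) ^+ 2.
  rewrite mulrAC -rmorphM [_.[x] * _]mulrC expR_horner_P// rmorphD mulrDl; congr (_ + _).
  rewrite rmorphM /= mulrAC; congr (_ * _).
  rewrite rmorphM /= mulrAC (powE N 1%N) ?addn1// expr1 rmorphM rmorphXn /=.
  by move: (_^-1%:C) => F; ring.
rewrite TK in HT; rewrite /estar /e_.
(* In weight 2, e_2 = (S + c) / w1^2, and the correction (pi / a(L)) conj(w1) / w1 equals c /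
   w1^2. *)
have [N1|N1] := eqVneq N 1%N.
  rewrite N1 eqxx in HT *; have [q [Hq HS]] := has_sum_weight2_rows tau0 HT.
  rewrite (e2_rows hw Hq HS) -cE (pi_div_area hw) -cE mulrDl fmorph_div.
  rewrite /= -sqr_normc_conj; have cw0 : conjc w1 != 0 by rewrite conjc_eq0.
  by move: (c%:C) (S) => C S'; field; rewrite cw0 w10.
have n2 : (N.+1 == 2)%N = false by rewrite eqSS (negbTE N1).
rewrite n2; apply: (lattice_sum_latpt hw); first by rewrite expr0n /= invr0.
have N2 : (1 < N)%N by rewrite ltn_neqAle eq_sym N1.
have := has_sumZ (w1 ^+ N.+1)^-1 (has_sum_eisenstein tau0 N2 oddN HT).
rewrite [_^-1 * S]mulrC; congr has_sum.
by apply/funext => p; rewrite exprMn invfM.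
Qed.
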